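(* Let $\mathcal H$ be a separable real Hilbert space. Let $(M_n,\mathcal F_n)_{n\ge0}$ be a martingale in $\mathcal H$ with $M_0=0$ and increments $X_n=M_n-M_{n-1}$ satisfying $\mathbb E[X_n\mid\mathcal F_{n-1}]=0$ and $\|X_n\|\le1$ a.s. for all $n\ge1$. Write $V_n=\sum_{i=1}^n\mathbb E[X_i\otimes X_i\mid\mathcal F_{i-1}]$ and, for $\rho>0$, $R_{n,\rho}=\|(V_n+\rho I)^{-1/2}M_n\|$. Let $\pi$ be a Borel probability measure on $(0,\infty)$ and, for $a>0$ and $u>1$, let $\Delta_\pi(a,u)=-\log\pi([a,ua])$, with the convention $-\log0=\infty$. Then for every $y\ge0$, \[ \mathbb P\Bigl[\exists n\ge1,\ \exists a>0,\ \exists u>1:\ ua\,h\Bigl(\frac{R_{n,a}}{u\sqrt a}\Bigr)>y+\ell_a(V_n)+\Delta_\pi(a,u)\Bigr]\le e^{-y}. \]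
   Context: $h(u)=(1+u)\log(1+u)-u$ for $u\ge0$. For $a>0$ and $V$ a positive (self-adjoint, positive semidefinite) trace-class operator, $\ell_a(V)=\frac12\log\det(I+a^{-1}V)$, with $\det$ the Fredholm determinant (for self-adjoint trace-class $A$, $\det(I+A)=\prod_j(1+\lambda_j(A))$ over the nonzero eigenvalues with multiplicity). $x\otimes y$ is the rank-one operator $(x\otimes y)u=\langle x,u\rangle y$, and $\mathbb E[X\otimes X\mid\mathcal G]$ is the conditional Bochner expectation in the trace-class operators, characterized by $\langle u,\mathbb E[X\otimes X\mid\mathcal G]v\rangle=\mathbb E[\langle u,X\rangle\langle X,v\rangle\mid\mathcal G]$. *)

(* Defs.v *)
From HB Require Import structures.
From mathcomp Require Import all_boot all_order all_algebra.
From mathcomp Require Import sesquilinear.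
From mathcomp Require Import all_classical all_reals all_analysis.
Import Order.TTheory GRing.Theory Num.Theory.
Import numFieldNormedType.Exports.

Set Implicit Arguments.
Unset Strict Implicit.
Unset Printing Implicit Defensive.

Local Open Scope classical_set_scope.
Local Open Scope ring_scope.

(* A real Hilbert space is a complete normed module whose norm is induced by
   a symmetric positive definite bilinear form. *)
Definition norm_induced_by (R : realType) (H : completeNormedModType R)
    (ip : {dot H for idfun}) : Prop :=
  forall x : H, ip x x = `|x| ^+ 2.

Definition separable (T : topologicalType) : Prop :=
  exists D : set T, countable D /\ dense D.

Section Operators.
Variables (R : realType) (H : completeNormedModType R).
Variable ip : {dot H for idfun}.

Definition rank_one (x y : H) : H -> H := fun u => ip x u *: y.

Definition positive_operator (T : H -> H) : Prop :=
  [/\ linear T, continuous T,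
      forall u v, ip (T u) v = ip u (T v) &
      forall u, 0 <= ip u (T u)].

Definition orthonormal_basis (B : set H) : Prop :=
  [/\ forall e, B e -> ip e e = 1,
      forall e f, B e -> B f -> e != f -> ip e f = 0 &
      forall x, (forall e, B e -> ip e x = 0) -> x = 0].

(* For a positive operator the absolute value is T itself, so that being
   trace class means having a finite trace. *)
Definition positive_trace_class (T : H -> H) : Prop :=
  positive_operator T /\
  forall B, orthonormal_basis B -> (\esum_(e in B) (ip e (T e))%:E < +oo)%E.

Definition eigenspace (T : H -> H) (mu : R) : set H :=
  [set x | T x = mu *: x].

Definition has_dim (E : set H) (n : nat) : Prop :=
  exists e : 'I_n -> H, (forall i, E (e i)) /\
    forall x, E x -> exists! c : 'rV[R]_n, x = \sum_i c 0 i *: e i.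

(* lam lists the nonzero eigenvalues of T, each repeated according to its
   multiplicity; the value 0 may occur any number of times in lam, as padding
   (so that the finite rank case is covered). *)
Definition eigenvalue_sequence (T : H -> H) (lam : nat -> R) : Prop :=
  forall mu, mu != 0 -> exists n,
    has_dim (eigenspace T mu) n /\ ([set j | lam j = mu] #= `I_n)%card.

(* det (I + T), for T self-adjoint and trace class. The eigenvalues are
   absolutely summable, so that the enumeration chosen by get is immaterial. *)
Definition fredholm_det (T : H -> H) : R :=
  let lam : nat -> R := get [set lam | eigenvalue_sequence T lam] in
  lim ((\prod_(j < n) (1 + lam j)) @[n --> \oo]).

Definition ell (a : R) (V : H -> H) : R :=
  2^-1 * ln (fredholm_det (fun x => a^-1 *: V x)).

(* T^{-1/2}, for T positive and invertible: the positive operator whose square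
   is the inverse of T. *)
Definition inv_sqrt_op (T : H -> H) : H -> H :=
  get [set S : H -> H | positive_operator S /\
    forall x, S (S (T x)) = x /\ T (S (S x)) = x].

(* || (V + rho I)^{-1/2} m || *)
Definition self_norm (V : H -> H) (rho : R) (m : H) : R :=
  `|inv_sqrt_op (fun x => V x + rho *: x) m|.

End Operators.

Section Conditioning.
Variables (d : measure_display) (Omega : measurableType d) (R : realType).
Variable P : probability Omega R.

Definition filtration (F : nat -> set (set Omega)) : Prop :=
  forall n, [/\ sigma_algebra setT (F n), F n `<=` measurable &
                F n `<=` F n.+1].

(* When G is a sigma-algebra: measurability from G to the Borel sets. *)
Definition borel_wrt (T : topologicalType) (G : set (set Omega))
    (f : Omega -> T) : Prop :=
  forall U, open U -> G (f @^-1` U).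

(* g is a version of E[f | G], for f real-valued and integrable. *)
Definition is_condexp (G : set (set Omega)) (f g : Omega -> R) : Prop :=
  [/\ P.-integrable setT (EFin \o f), P.-integrable setT (EFin \o g),
      borel_wrt G g &
      forall A, G A ->
        (\int[P]_(w in A) (g w)%:E = \int[P]_(w in A) (f w)%:E)%E].

Section BochnerIntegral.
Variable H : completeNormedModType R.

Definition simple_function (s : Omega -> H) : Prop :=
  finite_set (range s) /\ forall x, measurable (s @^-1` [set x]).

Definition simple_integral (A : set Omega) (s : Omega -> H) : H :=
  \sum_(x \in range s) fine (P (A `&` s @^-1` [set x])) *: x.

(* z is the Bochner integral of f over A. *)
Definition is_bochner_integral (A : set Omega) (f : Omega -> H) (z : H) :
    Prop :=
  exists s : nat -> Omega -> H,
    [/\ forall k, simple_function (s k),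
        (\int[P]_(w in A) `|f w - s k w|%:E)%E @[k --> \oo] --> 0%E &
        simple_integral A (s k) @[k --> \oo] --> z].

(* Bochner integrability, for H separable. *)
Definition vintegrable (f : Omega -> H) : Prop :=
  borel_wrt measurable f /\ (\int[P]_w `|f w|%:E < +oo)%E.

(* g is a version of E[f | G], for f vector-valued and Bochner integrable. *)
Definition is_vcondexp (G : set (set Omega)) (f g : Omega -> H) : Prop :=
  [/\ vintegrable f, vintegrable g, borel_wrt G g &
      forall A, G A ->
        exists z, is_bochner_integral A f z /\ is_bochner_integral A g z].

Definition martingale (F : nat -> set (set Omega)) (M : nat -> Omega -> H) :
    Prop :=
  [/\ filtration F, forall n, borel_wrt (F n) (M n),
      forall n, vintegrable (M n) &
      forall n, is_vcondexp (F n) (M n.+1) (M n)].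

Definition increment (M : nat -> Omega -> H) (n : nat) (w : Omega) : H :=
  M n w - M n.-1 w.

End BochnerIntegral.

(* C is a version of E[Y | G], where Y takes its values in the trace-class
   operators and E[Y | G] is positive: the version is taken with values in the
   positive trace-class operators, and is characterized weakly by
   <u, E[Y | G] v> = E[<u, Y v> | G]. *)
Definition is_opcondexp (H : completeNormedModType R)
    (ip : {dot H for idfun}) (G : set (set Omega))
    (Y C : Omega -> H -> H) : Prop :=
  (forall w, positive_trace_class ip (C w)) /\
  forall u v : H,
    is_condexp G (fun w => ip u (Y w v)) (fun w => ip u (C w v)).

End Conditioning.

(* V_n = \sum_(i = 1)^n C_i *)
Definition bracket (R : realType) (H : completeNormedModType R) (Omega : Type)
    (C : nat -> Omega -> H -> H) (n : nat) (w : Omega) : H -> H :=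
  fun x => \sum_(1 <= i < n.+1) C i w x.

Definition hfun (R : realType) (u : R) : R := (1 + u) * ln (1 + u) - u.

(* lne 0 = -oo, so that Delta is +oo on the intervals of measure zero. *)
Definition Delta (R : realType) (pi : probability (measurableTypeR R) R)
    (a u : R) : \bar R :=
  (- lne (pi `[a, (u * a)%R]%classic))%E.

(* Main.v *)
(* For a fixed scale r, the process
     exp (r h (R_{n,r} / sqrt r)) / sqrt (det (I + V_n / r))
   is a supermartingale.  One step adds x = X_{n+1} to M_n and C_{n+1} to V_n:
   with the new bracket V_{n+1}, which is predictable, a deterministic inequality
   bounds the exponential at M_n + x by its value at M_n times a polynomial of
   degree 2 in x; its conditional expectation is obtained by replacing x by 0 and
   x (x) x by C_{n+1}, and the concavity of log det absorbs the result when
   V_{n+1} is turned back into V_n.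

   Since r h (R_r / sqrt r) >= ua h (R_a / (u sqrt a)) and det (I + V / r) <=
   det (I + V / a) for a <= r <= ua, averaging the supermartingales over pi gives
   at least pi [a, ua] exp (ua h (R_a / (u sqrt a)) - ell_a (V_n)), and Ville's
   inequality for the average is the claim.

   All of this is done for the sections of the operators to the first k vectors of
   an orthonormal sequence and for a discretization of pi by cells of length
   1 / (k + 1); the self-normalized norms and the determinants converge as k tends
   to infinity, by the spectral theorem.  The event is measurable because rational
   parameters a' <= a and b' >= ua approximate every crossing: R_a is
   antitone in a, and ell_a is controlled by the trace of V_n. *)
Require Import Defs.
From HB Require Import structures.
From mathcomp Require Import all_boot all_order all_algebra.
From mathcomp Require Import sesquilinear.
From mathcomp Require Import all_classical all_reals all_analysis.
From mathcomp Require Import measurable_realfun.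
From mathcomp Require Import ring lra.
Import Order.TTheory GRing.Theory Num.Theory.
Import numFieldNormedType.Exports.
Local Open Scope classical_set_scope.
Local Open Scope ring_scope.
Set Implicit Arguments.
Unset Strict Implicit.
Unset Printing Implicit Defensive.

(** The shape of the one-step majorant is dictated by what can be repaid. With W = V + r its
    quadratic part is W^-1 / 2 plus a rank-one term of weight c / 2, where c = h'(R) / R. Averaging
    turns the first piece into half a trace, which the concavity of log det repays. The second is
    repaid by R itself: removing the new covariance from the bracket enlarges the norm, and
    convexity of h makes the gain just sufficient. Reaching exactly these two coefficients is the
    analytic core. It reduces to a scalar inequality between the old norm, the new norm and the
    angle of the step, delicate enough that the logarithms are replaced by Pade approximants before
    polynomial algebra can finish.

    Finite sections are natural for a further reason: the conditional covariances are given weakly,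
    so measurability is available entry by entry. The discretized mixture is a finite sum and needs
    no joint measurability in the scale and the sample point. Moving the mass of a cell to its right
    end enlarges u a little, which is harmless in the limit because a crossing is a strict
    inequality. *)

(** * Scalar inequalities for the logarithm, the exponential and h *)

Section ScalarCalculus.
Variable R : realType.
Implicit Types (x y r k l : R).

Lemma quadratic_disc_le (a b c : R) : 0 <= c ->
  (forall r, 0 <= a + 2 * r * b + r ^+ 2 * c) -> b ^+ 2 <= a * c.
Proof.
move=> c_ge0 H.
have [c0|c0] := eqVneq c 0.
  rewrite c0 mulr0.
  have [->|b0] := eqVneq b 0; first by rewrite expr0n.
  (* With c = 0 the form is affine in r, and this r brings it to -1. *)
  have := H (- (a + 1) / (2 * b)); rewrite c0 mulr0 addr0.
  have -> : 2 * (- (a + 1) / (2 * b)) * b = - (a + 1) by field.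
  lra.
have cp : 0 < c by rewrite lt_neqAle eq_sym c0.
have := ler_wpM2l (ltW cp) (H (- b / c)).
have -> : c * (a + 2 * (- b / c) * b + (- b / c) ^+ 2 * c) = a * c - b ^+ 2.
  by field.
by rewrite mulr0 subr_ge0.
Qed.

(** Engine of most estimates of this part: the gap between two sides vanishes at one end, and an
    explicit derivative settles its sign. *)
Lemma is_derive_ge0_le (f df : R -> R) (a b : R) : a <= b ->
  (forall x, a <= x <= b -> is_derive x (1 : R) f (df x)) ->
  (forall x, a <= x <= b -> 0 <= df x) -> f a <= f b.
Proof.
move=> ab fdf df0.
have [x xab|c|c cab fE] := @MVT_segment R f df a b ab.
- by apply: fdf; move: xab; rewrite in_itv /= => /andP[/ltW -> /ltW ->].
- apply: derivable_within_continuous => x; rewrite in_itv/= => xab.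
  by have ? := fdf _ xab; exact: ex_derive.
by rewrite -subr_ge0 fE mulr_ge0 ?subr_ge0// df0 //; move: cab; rewrite in_itv.
Qed.

Lemma is_derive_ln1D x : 0 <= x ->
  is_derive x (1 : R) (fun x => ln (1 + x)) (1 + x)^-1.
Proof.
move=> x0; have x1 : 0 < 1 + x by lra.
have := is_derive1_ln x1 => ?.
by apply: is_derive_eq; rewrite /GRing.scale /=; field; lra.
Qed.

Lemma ln1D_diff_le x y : 0 <= x -> 0 <= y ->
  ln (1 + y) - ln (1 + x) <= (y - x) / (1 + x).
Proof.
move=> x0 y0; rewrite -ln_div ?posrE; [|lra..].
have -> : (1 + y) / (1 + x) = 1 + (y - x) / (1 + x) by field; lra.
by apply: le_ln1Dx; rewrite ltr_pdivlMr; lra.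
Qed.

Lemma ln1D_ge0 x : 0 <= x -> 0 <= ln (1 + x).
Proof. by move=> x0; apply: ln_ge0; lra. Qed.

Lemma ln1D_ge x : 0 <= x -> x / (1 + x) <= ln (1 + x).
Proof.
move=> x0; have := @ln1D_diff_le x 0 x0 (lexx 0).
rewrite !addr0 ln1 sub0r sub0r mulNr; lra.
Qed.

(** Concavity of the logarithm makes ln (1 + x) / x nonincreasing; the fractions are cleared so that
    x = 0 is allowed. *)
Lemma ln1D_div_nincr x y : 0 <= x -> x <= y ->
  ln (1 + y) * x <= ln (1 + x) * y.
Proof.
move=> x0 xy; have y0 : 0 <= y by lra.
have h1 := ln1D_diff_le x0 y0; have h2 := ln1D_ge x0.
have : (ln (1 + y) - ln (1 + x)) * x <= (y - x) * (x / (1 + x)).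
  by rewrite mulrCA mulrC ler_wpM2l.
have : (y - x) * (x / (1 + x)) <= (y - x) * ln (1 + x).
  by rewrite ler_wpM2l// subr_ge0.
lra.
Qed.

(** The [1/1] Pade approximant, cleared of its denominator. *)
Lemma ln1D_ge2 x : 0 <= x -> 2 * x <= (2 + x) * ln (1 + x).
Proof.
move=> x0.
have := @is_derive_ge0_le (fun x => (2 + x) * ln (1 + x) - 2 * x)
  (fun x => ln (1 + x) + (2 + x) / (1 + x) - 2) 0 x x0.
rewrite !addr0 ln1 !mulr0 subr0; move=> H; rewrite -subr_ge0; apply: H.
- move=> z /andP[z0 _]; have := is_derive_ln1D z0 => ?.
  by apply: is_derive_eq; rewrite /GRing.scale /=; field; lra.
- move=> z /andP[z0 _]; have := ln1D_ge z0.
  have -> : (2 + z) / (1 + z) = 2 - z / (1 + z) by field; lra.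
  lra.
Qed.

(* The diagonal Pade approximant of order 2. *)
Lemma ln1D_ge_pade x : 0 <= x ->
  3 * x * (2 + x) / (6 + 6 * x + x ^+ 2) <= ln (1 + x).
Proof.
move=> x0.
have := @is_derive_ge0_le
  (fun x => ln (1 + x) - 3 * x * (2 + x) * (6 + 6 * x + x ^+ 2)^-1)
  (fun x => x ^+ 4 / ((1 + x) * (6 + 6 * x + x ^+ 2) ^+ 2)) 0 x x0.
rewrite !addr0 ln1 mulr0 !mul0r subr0; move=> H; rewrite -subr_ge0; apply: H.
- move=> z /andP[z0 _]; have := is_derive_ln1D z0 => ?.
  have p0 : 6 + 6 * z + z ^+ 2 != 0 :> R by nra.
  have p1 : 1 + z != 0 by lra.
  apply: is_derive_eq.
  by rewrite /GRing.scale /= ?expr1; field; rewrite p0 p1.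
- by move=> z /andP[z0 _]; rewrite divr_ge0 ?exprn_ge0// mulr_ge0 ?exprn_ge0//; nra.
Qed.

(** The [2/1] Pade approximant: the derivative of the gap is of order x ^+ 3, so the bound is exact
    to third order at 0. *)
Lemma ln1D_le_pade x : 0 <= x -> ln (1 + x) <= x * (6 + x) / (6 + 4 * x).
Proof.
move=> x0.
have := @is_derive_ge0_le
  (fun x => x * (6 + x) * (6 + 4 * x)^-1 - ln (1 + x))
  (fun x => 4 * x ^+ 3 / ((1 + x) * (6 + 4 * x) ^+ 2)) 0 x x0.
rewrite !addr0 ln1 !mul0r subr0; move=> H; rewrite -subr_ge0; apply: H.
- move=> z /andP[z0 _]; have := is_derive_ln1D z0 => ?.
  have p0 : 6 + 4 * z != 0 :> R by lra.
  have p1 : 1 + z != 0 by lra.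
  apply: is_derive_eq.
  by rewrite /GRing.scale /= ?expr1; field; rewrite p0 p1.
- move=> z /andP[z0 _]; rewrite divr_ge0 ?mulr_ge0 ?exprn_ge0//; lra.
Qed.

(** Convexity: on [0, l] the exponential stays below its chord. *)
Lemma expR_chord k l : 0 <= k <= 1 -> 0 <= l ->
  expR (k * l) <= 1 + k * (expR l - 1).
Proof.
move=> /andP[k0 k1] l0; rewrite -subr_ge0.
have := @is_derive_ge0_le (fun l => 1 + k * (expR l - 1) - expR (k * l))
  (fun l => k * expR l - k * expR (k * l)) 0 l l0.
rewrite mulr0 expR0 subrr mulr0 addr0 subrr; apply.
- move=> z _; apply: is_derive_eq.
  by rewrite /GRing.scale /=; ring.
- move=> z /andP[z0 _]; rewrite -mulrBr mulr_ge0// subr_ge0 ler_expR.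
  by rewrite ler_piMl.
Qed.

(* (exp s - 1 - s) / s ^ 2 is nondecreasing. *)
Lemma expR_quad k l : 0 <= k <= 1 -> 0 <= l ->
  expR (k * l) <= 1 + k * l + k ^+ 2 * (expR l - 1 - l).
Proof.
move=> k01 l0; rewrite -subr_ge0.
have := @is_derive_ge0_le
  (fun l => 1 + k * l + k ^+ 2 * (expR l - 1 - l) - expR (k * l))
  (fun l => k * (1 + k * (expR l - 1) - expR (k * l))) 0 l l0.
rewrite [in X in X <= _](_ : _ - _ = 0); last by rewrite mulr0 expR0; ring.
apply.
- move=> z _; apply: is_derive_eq.
  by rewrite /GRing.scale /=; ring.
- move=> z /andP[z0 _]; have := expR_chord k01 z0.
  by case/andP: k01 => k0 _ ?; rewrite mulr_ge0// subr_ge0.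
Qed.

Lemma expR_le_quadN x : x <= 0 -> expR x <= 1 + x + x ^+ 2 / 2.
Proof.
move=> x0; have y0 : 0 <= - x by lra.
rewrite -subr_ge0.
have := @is_derive_ge0_le (fun y => 1 - y + y * y * 2^-1 - expR (- y))
  (fun y => y - 1 + expR (- y)) 0 (- x) y0.
rewrite [in X in X <= _](_ : _ - expR _ = 0); last by rewrite oppr0 expR0; ring.
rewrite !opprK mulrNN expr2; apply.
- move=> z _; apply: is_derive_eq.
  by rewrite /GRing.scale /=; field.
- by move=> z _; have := expR_ge1Dx (- z); lra.
Qed.

Lemma hfun0 : hfun (0 : R) = 0.
Proof. by rewrite /hfun addr0 ln1 mulr0 subr0. Qed.

Lemma is_derive_hfun x : 0 <= x -> is_derive x (1 : R) (@hfun R) (ln (1 + x)).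
Proof.
move=> x0; have := is_derive_ln1D x0 => ?; rewrite /hfun.
by apply: is_derive_eq; rewrite /GRing.scale /=; field; lra.
Qed.

(** Convexity of [hfun], whose derivative is ln (1 + x). *)
Lemma hfun_tangent x y : 0 <= x -> 0 <= y ->
  (y - x) * ln (1 + x) <= hfun y - hfun x.
Proof.
move=> x0 y0; have := ln1D_diff_le y0 x0.
by rewrite ler_pdivlMr ?/hfun; nra.
Qed.

Lemma hfun_ge0 x : 0 <= x -> 0 <= hfun x.
Proof.
by move=> x0; have := hfun_tangent (lexx 0) x0; rewrite hfun0 addr0 ln1; lra.
Qed.

Lemma hfun_le x y : 0 <= x -> x <= y -> hfun x <= hfun y.
Proof.
move=> x0 xy; have := hfun_tangent x0 (le_trans x0 xy).
have := ln1D_ge0 x0; nra.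
Qed.

(* Hermite-Hadamard for the concave derivative of hfun. *)
Lemma hfun_midpoint r y : 0 <= r -> r <= y ->
  hfun y - hfun r <= (y - r) * ln (1 + (y + r) / 2).
Proof.
move=> r0 ry; rewrite -subr_ge0.
have := @is_derive_ge0_le
  (fun y => (y - r) * ln (1 + (y + r) * 2^-1) - (hfun y - hfun r))
  (fun y => ln (1 + (y + r) / 2) + (y - r) / 2 / (1 + (y + r) / 2) - ln (1 + y))
  r y ry.
rewrite !subrr mul0r subr0; apply.
- move=> z /andP[rz _]; have z0 : 0 <= z by lra.
  have m0 : 0 < 1 + (z + r) * 2^-1 by lra.
  have := is_derive1_ln m0 => ?; have := is_derive_hfun z0 => ?.
  by apply: is_derive_eq; rewrite /GRing.scale /=; field; lra.
- move=> z /andP[rz _]; have z0 : 0 <= z by lra.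
  have m0 : 0 <= (z + r) / 2 by lra.
  have := ln1D_diff_le m0 z0.
  have -> : z - (z + r) / 2 = (z - r) / 2 by field.
  lra.
Qed.

(** As a function of the square of its argument, h has derivative ln (1 + r) / (2 r), which is
    nonincreasing; this is the resulting tangent bound at r ^+ 2. *)
Lemma hfun_sqr_concave r y : 0 <= y -> y <= r -> 0 < r ->
  hfun y - hfun r <= ln (1 + r) / r / 2 * (y ^+ 2 - r ^+ 2).
Proof.
move=> y0 yr r0; rewrite -subr_ge0.
set c := ln (1 + r) / r.
have := @is_derive_ge0_le
  (fun y => (hfun y - hfun r) - c / 2 * (y * y - r * r))
  (fun y => ln (1 + y) - c * y) y r yr.
rewrite !subrr mulr0 subr0 !expr2 -[X in _ -> _ <= X]opprB oppr_ge0; apply.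
- move=> z /andP[yz zr]; have z0 : 0 <= z by lra.
  have := is_derive_hfun z0 => ?.
  by apply: is_derive_eq; rewrite /GRing.scale /=; field.
- move=> z /andP[yz zr]; have z0 : 0 <= z by lra.
  have := ln1D_div_nincr z0 zr.
  by rewrite /c mulrAC -ler_pdivrMr// subr_ge0.
Qed.
End ScalarCalculus.

Ltac pos_terms := repeat match goal with
  | |- is_true (0 <= _ + _) => apply: addr_ge0
  | |- is_true (0 <= _ * _) => apply: mulr_ge0
  | |- is_true (0 <= _ ^+ _) => apply: exprn_ge0
  end; first [assumption | exact: ler0n].

(** * Polynomial inequalities left after the Pade bounds *)

Section PadePolynomial.
Variable R : realFieldType.
Implicit Types (r k s d f : R).

(* The next three polynomials are nonnegative on the triangle
   d, f, s >= 0, d + f + s = 1/2, because their homogenizations have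
   nonnegative coefficients. *)
Lemma pade_poly_bracket (d f s : R) : 0 <= d -> 0 <= f -> 0 <= s -> s = 1/2 - d - f ->
  0 <= 3 * (1 - d) * (d + (d + f) - d * (d + f)) + 2 * (1 - (d + f)) * (2 - d) * (1 - 3 * (d + f)).
Proof.
move=> d0 f0 s0 sE.
have -> : 3 * (1 - d) * (d + (d + f) - d * (d + f)) + 2 * (1 - (d + f)) * (2 - d) * (1 - 3 * (d + f)) =
    32 * s ^+ 3 + 44 * f * s ^+ 2 + 16 * f ^+ 2 * s + 4 * f ^+ 3 + 48 * d * s ^+ 2 + 44 * d * f * s + 14 * d * f ^+ 2 + 22 * d ^+ 2 * s + 13 * d ^+ 2 * f + 3
    * d ^+ 3.
  by rewrite sE; field.
by pos_terms.
Qed.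

Lemma pade_poly_sum0 (d f s : R) : 0 <= d -> 0 <= f -> 0 <= s -> s = 1/2 - d - f ->
  0 <= 2 * (18 * (1 - d) * (d + (d + f) - d * (d + f)) ^+ 2 - 18 * (1 - (d + f)) * (2 - d) ^+ 2 * (d + f) * d) +
    (18 * (1 - d) * (d + (d + f) - d * (d + f)) ^+ 2 -
    (1 - (d + f)) * (2 - d) * (12 * (d + f) * (d + (d + f) - d * (d + f)) +
      (9 * (d + f) - 3) * d * (2 - d))).
Proof.
move=> d0 f0 s0 sE.
have -> : 2 * (18 * (1 - d) * (d + (d + f) - d * (d + f)) ^+ 2 - 18 * (1 - (d + f)) * (2 - d) ^+ 2 * (d + f) * d) +
    (18 * (1 - d) * (d + (d + f) - d * (d + f)) ^+ 2 -
    (1 - (d + f)) * (2 - d) * (12 * (d + f) * (d + (d + f) - d * (d + f)) +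
      (9 * (d + f) - 3) * d * (2 - d))) =
    240 * f ^+ 2 * s ^+ 3 + 816 * f ^+ 3 * s ^+ 2 + 912 * f ^+ 4 * s + 336 * f ^+ 5 + 192 * d * s ^+ 4 + 384 * d * f * s ^+ 3 + 1320 * d * f
    ^+ 2 * s ^+ 2 + 2376 * d * f ^+ 3 * s + 1248 * d * f ^+ 4 + 480 * d ^+ 2 * s ^+ 3 + 1152 * d ^+ 2 * f * s
    ^+ 2 + 2484 * d ^+ 2 * f ^+ 2 * s + 1848 * d ^+ 2 * f ^+ 3
    + 444 * d ^+ 3 * s ^+ 2 + 1200 * d ^+ 3 * f * s +
    1323 * d ^+ 3 * f ^+ 2 + 180 * d ^+ 4 * s + 414 *
    d ^+ 4 * f + 27 * d ^+ 5.
  by rewrite sE; field.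
by pos_terms.
Qed.

Lemma pade_poly_sum2 (d f s : R) : 0 <= d -> 0 <= f -> 0 <= s -> s = 1/2 - d - f ->
  0 <= 2 * ((d + (d + f) - d * (d + f)) * (3 * (1 - d) * (d + (d + f) - d * (d + f)) + 2 * (1 - (d + f)) * (2 - d) * (1 - 3 * (d + f)))) +
    (18 * (1 - d) * (d + (d + f) - d * (d + f)) ^+ 2 -
    (1 - (d + f)) * (2 - d) * (12 * (d + f) * (d + (d + f) - d * (d + f)) +
      (9 * (d + f) - 3) * d * (2 - d))).
Proof.
move=> d0 f0 s0 sE.
have -> : 2 * ((d + (d + f) - d * (d + f)) * (3 * (1 - d) * (d + (d + f) - d * (d + f)) + 2 * (1 - (d + f)) * (2 - d) * (1 - 3 * (d + f)))) +
    (18 * (1 - d) * (d + (d + f) - d * (d + f)) ^+ 2 -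
    (1 - (d + f)) * (2 - d) * (12 * (d + f) * (d + (d + f) - d * (d + f)) +
      (9 * (d + f) - 3) * d * (2 - d))) =
    128 * f * s ^+ 4 + 256 * f ^+ 2 * s ^+ 3 + 192 * f ^+ 3 * s ^+ 2 + 128 * f ^+ 4 * s + 64
    * f ^+ 5 + 448 * d * s ^+ 4 + 1248 * d * f * s ^+ 3 + 1248 * d * f ^+ 2 * s ^+ 2 + 784 * d * f ^+ 3
    * s + 336 * d * f ^+ 4 + 1056 * d ^+ 2 * s
    ^+ 3 + 2048 * d ^+ 2 * f * s ^+ 2 + 1616 * d ^+ 2 * f ^+ 2 * s
    + 696 * d ^+ 2 * f ^+ 3 + 908 * d ^+ 3 * s ^+ 2 + 1296
    * d ^+ 3 * f * s + 685 * d ^+ 3 * f ^+ 2 + 336 * d ^+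
    4 * s + 306 * d ^+ 4 * f + 45 * d ^+ 5.
  by rewrite sE; field.
by pos_terms.
Qed.

(** What [slope_gap_step] becomes for s >= 1/2 once the logarithms are replaced by Pade
    approximants. With d = 1 - k and f = k - s the gap is a quadratic a0 + a1 r + a2 r^2; the three
    lemmas above control a2, 2 a0 + a1 and 2 a2 + a1. *)
Lemma pade_poly r k s : 0 <= r -> 1/2 <= s -> s <= k -> k <= 1 ->
  s * (1 + k) * (3 * (1 - s) + r * (1 - 3 / 2 * s)) *
    (6 * (1 - k ^+ 2) + 4 * r * (1 - k * s)) <=
  3 * k * (1 - k * s) ^+ 2 * (6 + 6 * r + r ^+ 2).
Proof.
move=> r0 s2 sk k1.
pose d := 1 - k; pose f := k - s.
have d0 : 0 <= d by rewrite /d; lra.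
have f0 : 0 <= f by rewrite /f; lra.
have h0 : 0 <= 1/2 - d - f by rewrite /d /f; lra.
have -> : s = 1 - (d + f) by rewrite /d /f; ring.
have -> : k = 1 - d by rewrite /d; ring.
move: d f d0 f0 h0 => d f d0 f0 h0 {s2 sk k1}.
have G0 : 0 <= d + (d + f) - d * (d + f) by nra.
have A2 := mulr_ge0 G0 (pade_poly_bracket d0 f0 h0 erefl).
have S0 := pade_poly_sum0 d0 f0 h0 erefl.
have S2 := pade_poly_sum2 d0 f0 h0 erefl.
have A0 : 0 <= 18 * (1 - d) * (d + (d + f) - d * (d + f)) ^+ 2 -
    18 * (1 - (d + f)) * (2 - d) ^+ 2 * (d + f) * d.
  have -> : 18 * (1 - d) * (d + (d + f) - d * (d + f)) ^+ 2 -
      18 * (1 - (d + f)) * (2 - d) ^+ 2 * (d + f) * d =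
    18 * f * (f * (1 + d * (1 - d)) + d ^+ 2 * (2 - d)) by ring.
  rewrite mulr_ge0//; first by rewrite mulr_ge0.
  rewrite addr_ge0// mulr_ge0 ?sqr_ge0//; last lra.
  by rewrite addr_ge0// mulr_ge0//; lra.
rewrite -subr_ge0.
set a0 := 18 * (1 - d) * _ - _ in A0 S0.
set a2 := (d + (d + f) - d * (d + f)) * _ in A2 S2.
set a1 := 18 * (1 - d) * _ - _ in S0 S2.
rewrite [leRHS](_ : _ = a0 + a1 * r + a2 * r ^+ 2); last first.
  by rewrite /a0 /a1 /a2; field.
have [a10|a10] := leP 0 a1.
  apply: addr_ge0; last by apply: mulr_ge0; last exact: sqr_ge0.
  by apply: addr_ge0; last exact: mulr_ge0.
(* With a1 < 0, the bounds on 2 a0 + a1 and 2 a2 + a1 put twice the quadratic above - a1 (r -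
   1)^2. *)
have r2 := sqr_ge0 (r - 1).
have : 0 <= (2 * a2 + a1) * r ^+ 2 by apply: mulr_ge0; [lra|exact: sqr_ge0].
have : 0 <= (- a1) * (r - 1) ^+ 2 by apply: mulr_ge0; [lra|exact: sqr_ge0].
lra.
Qed.
End PadePolynomial.

(** * The one-step estimate for h *)

Section BennettStep.
Variable R : realType.
Implicit Types (r m k s t q B : R).

Lemma ln1D_slope_bounds r : 0 < r ->
  [/\ 0 <= ln (1 + r) / r, ln (1 + r) / r <= 1,
      1 <= ln (1 + r) / r * (1 + r / 2) &
      3 * (2 + r) / (6 + 6 * r + r ^+ 2) <= ln (1 + r) / r].
Proof.
move=> r0; have r1 := ltW r0; split.
- by rewrite divr_ge0// ln1D_ge0.
- by rewrite ler_pdivrMr// mul1r le_ln1Dx//; lra.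
- rewrite mulrAC ler_pdivlMr//; have := ln1D_ge2 r1; lra.
- rewrite ler_pdivlMr//; apply: le_trans (ln1D_ge_pade r1).
  rewrite le_eqVlt; apply/orP; left; apply/eqP; field.
  by rewrite lt0r_neq0//; nra.
Qed.

Lemma slope_gap_le r m : 0 < r -> r <= m ->
  1 - ln (1 + r) / r <= 1 - ln (1 + m) / m.
Proof.
move=> r0 rm; rewrite lerB// ler_pdivrMr ?(lt_le_trans r0)//.
by rewrite mulrAC ler_pdivlMr//; apply: ln1D_div_nincr => //; exact: ltW.
Qed.

Lemma slope_gap_pade m : 0 < m -> 3 * m / (6 + 4 * m) <= 1 - ln (1 + m) / m.
Proof.
move=> m0; have := ln1D_le_pade (ltW m0).
rewrite -[_ <= 1 - _]subr_ge0 -[_ <= _ / (_ + _)]subr_ge0 => H.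
have -> : 1 - ln (1 + m) / m - 3 * m / (6 + 4 * m) =
  (m * (6 + m) / (6 + 4 * m) - ln (1 + m)) / m.
  by field; rewrite !lt0r_neq0//; lra.
by rewrite divr_ge0// ltW.
Qed.

(** The case of a step of maximal length. Here r is the old norm, m the midpoint of the old and new
    norms, s the cosine between position and step, and k the growth of the norm per unit of step.
    The equation between them is the law of cosines with the step length eliminated. *)
Lemma slope_gap_step r m k s : 0 < r -> r <= m -> 0 < s -> s <= k -> k <= 1 ->
  m * (1 - k ^+ 2) = r * (1 - k * s) ->
  let c := ln (1 + r) / r in
  r * s * (1 - c - c * (r * s) / 2) <= k * (1 - k) * (m - ln (1 + m)).
Proof.
move=> r0 rm s0 sk k1 mE /=; set c := ln (1 + r) / r.
have m0 : 0 < m by lra.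
have := ln1D_slope_bounds r0; rewrite -/c => -[c0 c1 c2 c3].
have := slope_gap_le r0 rm; rewrite -/c => dd; have := slope_gap_pade m0.
pose d := 1 - ln (1 + m) / m.
have -> : m - ln (1 + m) = m * d by rewrite /d; field; rewrite lt0r_neq0.
rewrite -/d in dd *; move=> dp.
(* k = 1 forces s = 1, and the claim follows from 1 <= c (1 + r / 2). *)
have [kE|kn1] := eqVneq k 1.
  move: mE; rewrite kE expr1n subrr mulr0 mul1r => /esym/eqP.
  rewrite mulf_eq0 gt_eqF//= subr_eq0 => /eqP <-.
  rewrite mulr0 mul0r mulr1; nra.
have kl1 : k < 1 by rewrite lt_neqAle kn1.
have k0 : 0 < k by lra.
have kk : 0 < 1 - k ^+ 2 by rewrite expr2; nra.
have ks0 : 0 < 1 - k * s by nra.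
rewrite -(ler_pM2r (_ : 0 < 1 + k)); last lra.
have -> : k * (1 - k) * (m * d) * (1 + k) = k * (m * (1 - k ^+ 2)) * d by ring.
rewrite mE.
suff : s * (1 - c - c * (r * s) / 2) * (1 + k) <= k * (1 - k * s) * d.
  move=> H; rewrite -[leLHS]mulrA -mulrA [in leLHS]mulrA.
  have := ler_wpM2l (ltW r0) H; rewrite mulrCA; lra.
(* For small cosines the monotonicity of 1 - ln (1 + x) / x suffices. For s > 1/2 the gain from r to
   m has to be quantified, and the Pade bounds lead to [pade_poly]. *)
have [s2|s2] := lerP s (1/2).
  have cr : c * r / 2 >= 1 - c by lra.
  have : s * (1 - c - c * (r * s) / 2) * (1 + k) <= s * ((1 - s) * (1 - c)) * (1 + k).
    rewrite ler_wpM2r; [by []|lra|]; rewrite ler_wpM2l//; first exact: ltW.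
    have : s * (1 - c) <= s * (c * r / 2) by rewrite ler_wpM2l// ltW.
    lra.
  move=> /le_trans; apply.
  apply: (@le_trans _ _ (k * (1 - k * s) * (1 - c))).
    have -> : s * ((1 - s) * (1 - c)) * (1 + k) = (s * (1 - s) * (1 + k)) * (1 - c) by ring.
    rewrite ler_wpM2r//; first lra.
    have -> : k * (1 - k * s) = s * (1 - s) * (1 + k) + (k - s) * (1 - s - s * k) by ring.
    by rewrite lerDl mulr_ge0//; nra.
  by rewrite ler_wpM2l// mulr_ge0// ltW.
have P : 0 < 6 + 6 * r + r ^+ 2 by nra.
have Q : 0 < 6 * (1 - k ^+ 2) + 4 * r * (1 - k * s) by nra.
have dE : 3 * m / (6 + 4 * m) =
    3 * (r * (1 - k * s)) / (6 * (1 - k ^+ 2) + 4 * r * (1 - k * s)).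
  apply/eqP; rewrite eqr_div ?lt0r_neq0//; last lra.
  have -> : 4 * r * (1 - k * s) = 4 * (r * (1 - k * s)) by ring.
  by rewrite -mE; apply/eqP; ring.
apply: (@le_trans _ _ (k * (1 - k * s) *
  (3 * (r * (1 - k * s)) / (6 * (1 - k ^+ 2) + 4 * r * (1 - k * s))))); last first.
  by rewrite -dE ler_wpM2l// mulr_ge0// ltW.
apply: (@le_trans _ _ (s * (r * (3 * (1 - s) + r * (1 - 3 / 2 * s)) /
  (6 + 6 * r + r ^+ 2)) * (1 + k))).
  rewrite ler_wpM2r//; first lra.
  rewrite ler_wpM2l//; first exact: ltW.
  have -> : r * (3 * (1 - s) + r * (1 - 3 / 2 * s)) / (6 + 6 * r + r ^+ 2) =
    1 - (3 * (2 + r) / (6 + 6 * r + r ^+ 2)) * (1 + r * s / 2).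
    by field; rewrite lt0r_neq0.
  have : 3 * (2 + r) / (6 + 6 * r + r ^+ 2) * (1 + r * s / 2) <= c * (1 + r * s / 2).
    by rewrite ler_wpM2r//; nra.
  lra.
set X := r * _; set Y := 3 * (r * _).
have -> : s * (X / (6 + 6 * r + r ^+ 2)) * (1 + k) =
  (s * (1 + k) * X) / (6 + 6 * r + r ^+ 2)
  by move: (_ ^-1) => p; ring.
rewrite [leRHS]mulrA ler_pdivrMr// [leRHS]mulrAC ler_pdivlMr// {}/X {}/Y.
have := ler_wpM2l (ltW r0) (pade_poly (ltW r0) (ltW s2) sk k1).
lra.
Qed.

(* The one-step estimate behind Bennett's inequality in a Hilbert space, for
   r = |x|, s = |x + z|, t = <x, z>, q = |z|^2 and |z| <= B. *)
Lemma hfun_step r s t q B : 0 < B -> 0 <= r -> 0 <= s ->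
  s ^+ 2 = r ^+ 2 + 2 * t + q -> t ^+ 2 <= r ^+ 2 * q ->
  0 <= q -> q <= B ^+ 2 ->
  let c := ln (1 + r) / r in
  expR ((hfun s - hfun r) / B) <=
    1 + (c * t + q / 2) / B + c * t ^+ 2 / (2 * B ^+ 2).
Proof.
move=> B0 r0 s0 sE tq q0 qB /=; set c := ln (1 + r) / r.
have Bn0 : B != 0 by rewrite gt_eqF.
(* The sign tells whether the norm decreases. If it does, concavity of h in the squared norm bounds
   the exponent by g = c (t + q / 2) / B <= 0, and the second-order Taylor bound for nonpositive
   arguments is enough. *)
have [N0|N0] := ltP (t + q / 2) 0.
  have r1 : 0 < r.
    rewrite lt_neqAle r0 andbT; apply/negP => /eqP rE.
    have t0 : t = 0.

      apply/eqP; rewrite -sqrf_eq0 eq_le sqr_ge0 andbT (le_trans tq)//.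
      by rewrite -rE expr0n/= mul0r.
    lra.
  have := ln1D_slope_bounds r1; rewrite -/c => -[c0 c1 _ _].
  have sr : s <= r.
    rewrite -(ler_pXn2r (_ : 0 < 2)%N) ?nnegrE// sE; lra.
  have := hfun_sqr_concave s0 sr r1; rewrite -/c sE => D.
  set g := c * (t + q / 2) / B.
  have g0 : g <= 0
    by rewrite /g mulrAC; apply: mulr_ge0_le0; [rewrite divr_ge0// ltW | exact: ltW].
  apply: (@le_trans _ _ (expR g)).
    by rewrite ler_expR /g ler_pM2r ?invr_gt0//; lra.
  apply: le_trans (expR_le_quadN g0) _.
  apply: lerD.
    rewrite lerD2l /g ler_pM2r ?invr_gt0//.
    rewrite mulrDr lerD2l ler_piMl//; lra.
  have -> : g ^+ 2 / 2 = (c * (c * (t + q / 2) ^+ 2)) / (2 * B ^+ 2).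
    by rewrite /g; field.
  rewrite ler_pM2r ?invr_gt0 ?mulr_gt0 ?exprn_gt0//.
  rewrite ler_wpM2l//.
  apply: (@le_trans _ _ ((t + q / 2) ^+ 2)); first by rewrite ler_piMl// sqr_ge0.
  have : 0 <= (- t - q / 2) by lra.
  have : 0 <= q by []. nra.
(* The norm grows: the midpoint bound gives the exponent k ln (1 + m) with k in [0, 1], to which
   [expR_quad] applies. *)
have rs : r <= s by rewrite -(ler_pXn2r (_ : 0 < 2)%N) ?nnegrE// sE; lra.
pose m := (s + r) / 2.
have m0 : 0 <= m by rewrite /m; lra.
have rm : r <= m by rewrite /m; lra.
have smE : (s - r) * m = t + q / 2 by rewrite /m; nra.
set v := Num.sqrt q.
have v0 : 0 <= v by exact: sqrtr_ge0.
have vE : v ^+ 2 = q by rewrite sqr_sqrtr.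
have vB : v <= B by rewrite -(ler_pXn2r (_ : 0 < 2)%N) ?nnegrE ?vE// ltW.
have trv : `|t| <= r * v.
  rewrite -(ler_pXn2r (_ : 0 < 2)%N) ?nnegrE ?mulr_ge0// exprMn vE.
  by rewrite real_normK ?num_real.
have srv : s <= r + v.
  rewrite -(ler_pXn2r (_ : 0 < 2)%N) ?nnegrE ?addr_ge0// sE sqrrD vE.
  by have := ler_norm t; rewrite -mulr_natl; lra.
set k := (s - r) / B.
have k01 : 0 <= k <= 1.
  by rewrite /k divr_ge0 ?subr_ge0 ?(ltW B0)//= ler_pdivrMr//; lra.
have l0 := ln1D_ge0 m0.
apply: (@le_trans _ _ (expR (k * ln (1 + m)))).
  by rewrite ler_expR /k mulrAC ler_pM2r ?invr_gt0// hfun_midpoint.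
apply: le_trans (expR_quad k01 l0) _.
rewrite lnK ?posrE; last lra.
have kmE : k * m = (t + q / 2) / B by rewrite /k mulrAC smE.
(* Both majorants are 1 + k m minus a correction; H compares the two corrections. *)
suff H : t / B * (1 - c - c * (t / B) / 2) <= k * (1 - k) * (m - ln (1 + m)).
  have -> : 1 + (c * t + q / 2) / B + c * t ^+ 2 / (2 * B ^+ 2) =
     1 + k * m - t / B * (1 - c - c * (t / B) / 2).
    by rewrite kmE; field.
  lra.
have [k0 k1] := andP k01.
have ml : ln (1 + m) <= m by apply: le_ln1Dx; lra.
have [t0|t0] := lerP t 0.
  apply: (@le_trans _ _ 0); last first.
    by apply: mulr_ge0; [apply: mulr_ge0 => //|]; lra.
  have tB : t / B <= 0 by apply: mulr_le0_ge0; rewrite // invr_ge0 ltW.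
  apply: mulr_le0_ge0 => //.
  (* Division by zero makes c = 0 at r = 0, instead of the limit 1. *)
  have [rE|rn0] := eqVneq r 0.
    have -> : c = 0 by rewrite /c rE invr0 mulr0.
    lra.
  have := @ln1D_slope_bounds r; rewrite -/c lt_neqAle r0 eq_sym rn0 => /(_ isT)[c0 c1 _ _].
  have : c * (t / B) <= 0 by apply: mulr_ge0_le0.
  lra.
have rvp : 0 < r * v by apply: lt_le_trans trv; rewrite normr_gt0 gt_eqF.
have r1 : 0 < r by rewrite lt_neqAle r0 andbT; apply: contraTneq rvp => <-; rewrite mul0r ltxx.
have v1 : 0 < v by rewrite lt_neqAle v0 andbT; apply: contraTneq rvp => <-; rewrite mulr0 ltxx.
have := ln1D_slope_bounds r1; rewrite -/c => -[c0 c1 _ _].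
(* lam is the relative length of the step and u its cosine. Divided by lam, both sides of the goal
   are affine in lam, so it is enough to have them at lam = 0 (H0) and at lam = 1 (H1). *)
pose lam := v / B; pose k' := (s - r) / v; pose u := t / (r * v).
have lam01 : 0 <= lam <= 1 by rewrite /lam divr_ge0 ?(ltW B0)//= ler_pdivrMr// mul1r.
have kE : k = lam * k' by rewrite /k /lam /k'; field; rewrite Bn0 gt_eqF.
have tE : t / B = lam * (r * u) by rewrite /lam /u; field; rewrite Bn0 !gt_eqF.
have u0 : 0 < u by rewrite /u divr_gt0.
have tu : t = r * v * u by rewrite /u; field; rewrite !gt_eqF.
have sk' : s = r + v * k' by rewrite /k'; field; rewrite gt_eqF.
have u1 : u <= 1 by rewrite /u ler_pdivrMr// mul1r; apply: le_trans trv; exact: ler_norm.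
have uk : u <= k'.
  rewrite /k' ler_pdivlMr// lerBrDr -(ler_pXn2r (_ : 0 < 2)%N) ?nnegrE//; last first.
    by rewrite addr_ge0// mulr_ge0// ltW.
  rewrite sE -vE tu; have : (u * v) ^+ 2 <= v ^+ 2.
    by rewrite exprMn ler_piMl ?sqr_ge0// expr_le1// ltW.
  lra.
have k'1 : k' <= 1 by rewrite /k' ler_pdivrMr// mul1r; lra.
have vk : v * (1 - k' ^+ 2) = 2 * r * (k' - u).
  have : v * (v * (1 - k' ^+ 2)) = v * (2 * r * (k' - u)).
    by move: sE; rewrite sk' tu -vE; lra.
  by move/mulfI; apply; rewrite gt_eqF.
have mE : m * (1 - k' ^+ 2) = r * (1 - k' * u).
  rewrite /m sk'; have := congr1 (fun x => k' * x / 2) vk; lra.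
have := slope_gap_step r1 rm u0 uk k'1 mE; rewrite /= -/c => H1.
have H0 : r * u * (1 - c) <= k' * (m - ln (1 + m)).
  have mp : 0 < m by lra.
  have := slope_gap_le r1 rm; rewrite -/c => dd.
  have -> : m - ln (1 + m) = m * (1 - ln (1 + m) / m).
    by field; rewrite gt_eqF.
  rewrite mulrA; apply: ler_pM => //.
  - by rewrite mulr_ge0// ltW.
  - by lra.
  - have : v * (r * u) <= v * (k' * m).
      have -> : v * (k' * m) = (s - r) * m by rewrite sk'; ring.
      by rewrite smE tu; lra.
    by rewrite ler_pM2l.
rewrite kE tE; case/andP: lam01 => la0 la1.
have := ler_wpM2l la0 (lerD (ler_wpM2l (_ : 0 <= 1 - lam) H0) (ler_wpM2l la0 H1)).
rewrite subr_ge0 => /(_ la1); lra.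
Qed.

(** Repays the rank-one term in [bennett_average]. The hypothesis gives r >= s (1 + k / 2), because
    (1 + k / 2)^2 (1 - k) <= 1, and the tangent of h at s does the rest. *)
Lemma hfun_contract s k : 0 <= s -> 0 <= k -> k < 1 -> forall r, 0 <= r ->
  s ^+ 2 <= (1 - k) * r ^+ 2 -> k * (s * ln (1 + s)) / 2 <= hfun r - hfun s.
Proof.
move=> s0 k0 k1 r r0 sr.
apply: le_trans (hfun_tangent s0 r0).
rewrite mulrA mulrAC ler_wpM2r ?ln1D_ge0// lerBrDl.
have -> : s + k * s / 2 = s * (1 + k / 2) by field.
rewrite -(ler_pXn2r (_ : 0 < 2)%N) ?nnegrE// ?mulr_ge0 ?addr_ge0 ?divr_ge0//.
rewrite exprMn; apply: le_trans (ler_wpM2r (sqr_ge0 _) sr) _.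
rewrite -mulrA mulrCA ler_piMr ?sqr_ge0//.
have : 0 <= k ^+ 2 by exact: sqr_ge0.
have : 0 <= k ^+ 3 by rewrite exprn_ge0.
lra.
Qed.
End BennettStep.

(** * Quadratic forms, Cholesky factors and determinants *)

Section QuadraticForms.
Variable R : realType.

Definition dotc n (u v : 'cV[R]_n) : R := (u^T *m v) 0 0.
Definition qform n (A : 'M[R]_n) (u v : 'cV[R]_n) : R := dotc u (A *m v).
Definition posdefmx n (A : 'M[R]_n) :=
  A^T = A /\ forall u, u != 0 -> 0 < qform A u u.
Definition psdmx n (A : 'M[R]_n) :=
  A^T = A /\ forall u, 0 <= qform A u u.

Lemma dotc_mull m n (A : 'M[R]_(m, n)) u v : dotc (A *m u) v = dotc u (A^T *m v).
Proof. by rewrite /dotc trmx_mul mulmxA. Qed.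

Lemma dotc_col_mx m n (x y : 'cV[R]_m) (u v : 'cV[R]_n) :
  dotc (col_mx x u) (col_mx y v) = dotc x y + dotc u v.
Proof. by rewrite /dotc tr_col_mx mul_row_col mxE. Qed.

Section Basics.
Variable n : nat.
Implicit Types (A B : 'M[R]_n) (u v w : 'cV[R]_n).

Lemma dotcE u v : dotc u v = \sum_i u i 0 * v i 0.
Proof. by rewrite /dotc mxE; apply: eq_bigr => i _; rewrite mxE. Qed.

Lemma dotcC u v : dotc u v = dotc v u.
Proof. by rewrite !dotcE; apply: eq_bigr => i _; rewrite mulrC. Qed.

Lemma dotcDl u v w : dotc (u + v) w = dotc u w + dotc v w.
Proof. by rewrite /dotc linearD/= mulmxDl mxE. Qed.

Lemma dotcDr u v w : dotc w (u + v) = dotc w u + dotc w v.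
Proof. by rewrite /dotc mulmxDr mxE. Qed.

Lemma dotcZl a u v : dotc (a *: u) v = a * dotc u v.
Proof. by rewrite /dotc linearZ/= -scalemxAl mxE. Qed.

Lemma dotcZr a u v : dotc u (a *: v) = a * dotc u v.
Proof. by rewrite /dotc -scalemxAr mxE. Qed.

Lemma dotc_ge0 u : 0 <= dotc u u.
Proof. by rewrite dotcE sumr_ge0// => i _; rewrite -expr2 sqr_ge0. Qed.

Lemma dotc_gt0 u : u != 0 -> 0 < dotc u u.
Proof.
move=> u0; rewrite lt_neqAle dotc_ge0 andbT eq_sym; apply: contra u0.
rewrite dotcE psumr_eq0; last by move=> i _; rewrite -expr2 sqr_ge0.
move=> /allP H; apply/eqP/matrixP => i j; rewrite ord1 mxE.
by have := H i (mem_index_enum _); rewrite mulf_eq0 orbb => /eqP.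
Qed.

Lemma qformE A u v : qform A u v = \sum_i \sum_j A i j * (u i 0 * v j 0).
Proof.
rewrite /qform dotcE; apply: eq_bigr => i _; rewrite mxE mulr_sumr.
by apply: eq_bigr => j _; ring.
Qed.

Lemma qformDl A u v w : qform A (u + v) w = qform A u w + qform A v w.
Proof. by rewrite /qform dotcDl. Qed.

Lemma qformDr A u v w : qform A w (u + v) = qform A w u + qform A w v.
Proof. by rewrite /qform mulmxDr dotcDr. Qed.

Lemma qformZl A a u v : qform A (a *: u) v = a * qform A u v.
Proof. by rewrite /qform dotcZl. Qed.

Lemma qformZr A a u v : qform A u (a *: v) = a * qform A u v.
Proof. by rewrite /qform -scalemxAr dotcZr. Qed.

Lemma qformDm A B u v : qform (A + B) u v = qform A u v + qform B u v.
Proof. by rewrite /qform mulmxDl dotcDr. Qed.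

Lemma qformZm a A u v : qform (a *: A) u v = a * qform A u v.
Proof. by rewrite /qform -scalemxAl dotcZr. Qed.

Lemma qform_scalar a u v : qform a%:M u v = a * dotc u v.
Proof. by rewrite /qform mul_scalar_mx dotcZr. Qed.

Lemma qformC A u v : A^T = A -> qform A u v = qform A v u.
Proof. by move=> sA; rewrite /qform dotcC dotc_mull sA. Qed.

Lemma qform_sqrD A u v : A^T = A ->
  qform A (u + v) (u + v) = qform A u u + 2 * qform A u v + qform A v v.
Proof.
by move=> sA; rewrite qformDl !qformDr (qformC v u sA) mulr_natl mulr2n; ring.
Qed.

Lemma posdef_psd A : posdefmx A -> psdmx A.
Proof.
move=> [sA pA]; split=> // u; have [->|u0] := eqVneq u 0.
  by rewrite /qform mulmx0 dotcE big1// => i _; rewrite mxE mul0r.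
exact/ltW/pA.
Qed.

Lemma posdef_addscalar A r : psdmx A -> 0 < r -> posdefmx (A + r%:M).
Proof.
move=> [sA pA] r0; split; first by rewrite linearD/= sA tr_scalar_mx.
move=> u u0; rewrite qformDm qform_scalar.
by apply: ltr_wpDl; [exact: pA | rewrite mulr_gt0// dotc_gt0].
Qed.

Lemma psdD A B : psdmx A -> psdmx B -> psdmx (A + B).
Proof.
move=> [sA pA] [sB pB]; split; first by rewrite linearD/= sA sB.
by move=> u; rewrite qformDm addr_ge0.
Qed.

Lemma psdZ a A : 0 <= a -> psdmx A -> psdmx (a *: A).
Proof.
move=> a0 [sA pA]; split; first by rewrite linearZ/= sA.
by move=> u; rewrite qformZm mulr_ge0.
Qed.
End Basics.

(** Induction through the Schur complement of the first pivot a. The determinant bound is carried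
    along, which makes eigenvalues unnecessary: a <= exp (a - 1), and the Schur complement has no
    larger trace than the block it replaces. *)
Lemma posdef_cholesky n (A : 'M[R]_n) : posdefmx A ->
  exists L : 'M[R]_n, [/\ A = L *m L^T, 0 < \det L &
    (\det L) ^+ 2 <= expR (\tr A - n%:R)].
Proof.
elim: n A => [|n IHn] A [sA pA].
  exists 1%:M; rewrite det1 expr1n /mxtrace big_ord0 subrr expR0; split=> //.
  by apply/matrixP => -[].
pose B : 'M[R]_(1 + n) := A; have BA : B = A by [].
pose a : R := A 0 0.
pose b : 'rV[R]_n := ursubmx B; pose D : 'M[R]_n := drsubmx B.
have aE : ulsubmx B = a%:M.
  apply/matrixP => i j; rewrite !mxE !ord1 eqxx mulr1n /a.
  by congr (A _ _); apply/val_inj.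
have bE : dlsubmx B = b^T by rewrite /b trmx_ursub /B sA.
have DE : D^T = D by rewrite /D trmx_drsub /B sA.
have blk : B = block_mx a%:M b b^T D by rewrite -aE -bE submxK.
have qB (x : 'cV[R]_1) (v : 'cV[R]_n) : qform B (col_mx x v) (col_mx x v) =
    a * x 0 0 ^+ 2 + 2 * (x 0 0 * (b *m v) 0 0) + qform D v v.
  rewrite /qform blk mul_block_col dotc_col_mx !dotcDr.
  have E (y z : 'cV[R]_1) : dotc y z = y 0 0 * z 0 0 by rewrite dotcE big_ord1.
  by rewrite -(dotc_mull b) mul_scalar_mx dotcZr !E; ring.
have a0 : 0 < a.
  have := pA (delta_mx 0 0); rewrite -/B.
  have -> : qform A (delta_mx 0 0) (delta_mx 0 0) = a.
    by rewrite /qform -colE /dotc trmx_delta -rowE !mxE.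
  apply; apply/eqP => /matrixP/(_ 0 0); rewrite !mxE !eqxx.
  by move/eqP; rewrite oner_eq0.
pose D' := D - a^-1 *: (b^T *m b).
have pD' : posdefmx D'.
  split.
    by rewrite /D' linearB/= linearZ/= DE trmx_mul trmxK.
  move=> v v0; pose x : 'cV[R]_1 := (- a^-1 * (b *m v) 0 0)%:M.
  have : 0 < qform B (col_mx x v) (col_mx x v).
    apply: pA; apply: contra v0 => /eqP.
    by move/(congr1 (@dsubmx _ 1 n 1)); rewrite col_mxKd linear0 => ->.
  have xE : x 0 0 = - a^-1 * (b *m v) 0 0 by rewrite /x [LHS]mxE eqxx mulr1n.
  rewrite qB xE.
  suff -> : qform D' v v = a * (- a^-1 * (b *m v) 0 0) ^+ 2 +
      2 * (- a^-1 * (b *m v) 0 0 * (b *m v) 0 0) + qform D v v by [].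
  have -> : qform D' v v = qform D v v - a^-1 * (b *m v) 0 0 ^+ 2.
    rewrite /D' qformDm -scaleNr qformZm mulNr; congr (_ - _ * _).
    by rewrite /qform -mulmxA -(dotc_mull b) dotcE big_ord1 expr2.
  by field; rewrite gt_eqF.
have [L' [LE L0 LD]] := IHn _ pD'.
pose s := Num.sqrt a.
have s0 : 0 < s by rewrite sqrtr_gt0.
have ss : s * s = a by rewrite -expr2 sqr_sqrtr// ltW.
pose L : 'M[R]_(1 + n) := block_mx s%:M 0 (s^-1 *: b^T) L'.
have LL : L *m L^T = B.
  rewrite /L tr_block_mx mulmx_block blk.
  rewrite !trmx0 !tr_scalar_mx !mul0mx !mulmx0 !addr0 -scalar_mxM ss.
  rewrite linearZ/= trmxK mul_scalar_mx scalerA divff ?gt_eqF// scale1r.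
  rewrite -scalemxAl mul_mx_scalar scalerA mulVf ?gt_eqF// scale1r.
  congr block_mx; rewrite -LE /D' -scalemxAl -scalemxAr scalerA -invfM ss.
  by rewrite addrC subrK.
have dL : \det L = s * \det L' by rewrite /L det_lblock det_scalar1.
have trA : \tr B = a + \tr D by rewrite blk mxtrace_block mxtrace_scalar mulr1n.
exists L; split; [by rewrite LL | by rewrite [\det _]dL mulr_gt0 | ].
rewrite [\det _]dL [\tr A]trA exprMn expr2 ss.
apply: (@le_trans _ _ (expR (a - 1) * expR (\tr D' - n%:R))).
  apply: ler_pM => //; [exact: ltW | exact: sqr_ge0 |].
  by have := expR_ge1Dx (a - 1); lra.
rewrite -expRD ler_expR /D' linearB/= linearZ/=.
have : 0 <= a^-1 * \tr (b^T *m b).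
  rewrite mulr_ge0 ?invr_ge0 ?(ltW a0)// mxtrace_mulC.
  rewrite /mxtrace big_ord1 mxE sumr_ge0// => i _.
  by rewrite [b^T _ _]mxE -expr2 sqr_ge0.
rewrite -[n.+1%:R]natr1; lra.
Qed.

Section Determinants.
Variable n : nat.
Implicit Types (A B : 'M[R]_n) (u v w : 'cV[R]_n).

Lemma det_posdef_gt0 A : posdefmx A -> 0 < \det A.
Proof.
move=> /posdef_cholesky[L [-> L0 _]].
by rewrite det_mulmx det_tr mulr_gt0.
Qed.

Lemma posdef_unitmx A : posdefmx A -> A \in unitmx.
Proof. by move=> /det_posdef_gt0 A0; rewrite unitmxE unitfE gt_eqF. Qed.

Lemma det_posdef_le_expR A : posdefmx A -> \det A <= expR (\tr A - n%:R).
Proof.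
move=> pA; have [L [AE _ LD]] := posdef_cholesky pA.
by rewrite [X in \det X]AE det_mulmx det_tr -expr2.
Qed.

Lemma qform_congr A (K : 'M[R]_n) u :
  qform (K *m A *m K^T) u u = qform A (K^T *m u) (K^T *m u).
Proof. by rewrite /qform dotc_mull trmxK !mulmxA. Qed.

Lemma posdef_congr A (K : 'M[R]_n) : posdefmx A -> K \in unitmx ->
  posdefmx (K *m A *m K^T).
Proof.
move=> [sA pA] uK; split; first by rewrite !trmx_mul trmxK sA mulmxA.
move=> u u0; rewrite qform_congr; apply: pA; apply: contra u0 => /eqP Ku.
have : invmx K^T *m (K^T *m u) = 0 by rewrite Ku mulmx0.
by rewrite mulmxA mulVmx ?unitmx_tr// mul1mx => ->.
Qed.

(* Symmetric square roots are avoided: a Cholesky factor L of B reduces the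
   comparison of A with B to that of L^-1 A L^-T with the identity. *)
Lemma posdef_reduce A B : posdefmx A -> posdefmx B -> exists K : 'M[R]_n,
  [/\ K \in unitmx, K *m B *m K^T = 1%:M,
    \det A = \det B * \det (K *m A *m K^T) &
    \tr (invmx B *m A) = \tr (K *m A *m K^T)].
Proof.
move=> pA pB; have [L [BE L0 _]] := posdef_cholesky pB.
have uL : L \in unitmx by rewrite unitmxE unitfE gt_eqF.
have uLT : L^T \in unitmx by rewrite unitmx_tr.
exists (invmx L); rewrite unitmx_inv trmx_inv; split => //.
- by rewrite BE mulmxA mulVmx// mul1mx mulmxV.
- rewrite BE !det_mulmx !det_inv det_tr; field; exact: lt0r_neq0.
- rewrite BE [RHS]mxtrace_mulC mulmxA; congr (\tr (_ *m A)).
  have uLL : L *m L^T \in unitmx by rewrite unitmx_mul uL.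
  rewrite -[RHS](mulKmx uLL) -mulmxA [L^T *m _]mulmxA mulmxV// mul1mx.
  by rewrite mulmxV// mulmx1.
Qed.

(* ln det is concave. *)
Lemma det_posdef_le_trace A B : posdefmx A -> posdefmx B ->
  \det A <= \det B * expR (\tr (invmx B *m A) - n%:R).
Proof.
move=> pA pB; have [K [uK _ -> ->]] := posdef_reduce pA pB.
rewrite ler_pM2l ?det_posdef_gt0//.
exact/det_posdef_le_expR/posdef_congr.
Qed.

Lemma qform_delta A i : qform A (delta_mx i 0) (delta_mx i 0) = A i i.
Proof. by rewrite /qform -colE /dotc trmx_delta -rowE !mxE. Qed.

(** A consequence of the tangent bound: after reduction of B to the identity, the diagonal of A is
    at most 1 entrywise, so the trace in the exponent is at most n. *)
Lemma det_posdef_le A B : posdefmx A -> posdefmx B ->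
  (forall u, qform A u u <= qform B u u) -> \det A <= \det B.
Proof.
move=> pA pB AB; apply: le_trans (det_posdef_le_trace pA pB) _.
have [K [uK KB _ ->]] := posdef_reduce pA pB.
rewrite ler_piMr ?(ltW (det_posdef_gt0 pB))// -[leRHS]expR0 ler_expR subr_le0.
have <- : \tr (K *m B *m K^T) = n%:R by rewrite KB mxtrace1.
apply: ler_sum => i _; rewrite -!qform_delta !qform_congr; exact: AB.
Qed.

Lemma posdef_inv_sym A : posdefmx A -> (invmx A)^T = invmx A.
Proof. by move=> [sA _]; rewrite trmx_inv sA. Qed.

Definition iqform A u := qform (invmx A) u u.

Lemma iqformE A u : posdefmx A -> iqform A u = qform A (invmx A *m u) (invmx A *m u).
Proof.
move=> pA; rewrite /iqform /qform dotcC mulmxA mulmxV ?posdef_unitmx//.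
by rewrite mul1mx.
Qed.

Lemma qform_inv A u v : posdefmx A -> qform A u (invmx A *m v) = dotc u v.
Proof. by move=> pA; rewrite /qform mulmxA mulmxV ?posdef_unitmx// mul1mx. Qed.

(** Completing the square. This variational form gives lower bounds for the self-normalized norm
    from test vectors, without inverting A. *)
Lemma iqform_ge A u v : posdefmx A -> 2 * dotc u v - qform A u u <= iqform A v.
Proof.
move=> pA; have [sA pA0] := posdef_psd pA.
have := pA0 (u + (-1) *: (invmx A *m v)).
rewrite (qform_sqrD _ _ sA) qformZl !qformZr -iqformE// qform_inv//.
lra.
Qed.

Lemma iqform_ge0 A v : posdefmx A -> 0 <= iqform A v.
Proof. by move=> pA; rewrite iqformE//; have [_] := posdef_psd pA; apply. Qed.

Lemma iqform_CauchySchwarz A u v : posdefmx A ->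
  dotc u v ^+ 2 <= qform A u u * iqform A v.
Proof.
move=> pA; have [_ p0] := posdef_psd pA.
have [->|u0] := eqVneq u 0.
  by rewrite /qform /dotc trmx0 !mul0mx mxE expr0n/= mul0r.
have q0 : 0 < qform A u u by case: pA => _; apply.
(* The multiple of u that maximizes the lower bound. *)
have := iqform_ge ((dotc u v / qform A u u) *: u) v pA.
rewrite dotcZl qformZl qformZr => H.
have := ler_wpM2l (ltW q0) H.
have -> : qform A u u * (2 * (dotc u v / qform A u u * dotc u v) -
  dotc u v / qform A u u * (dotc u v / qform A u u * qform A u u)) =
  dotc u v ^+ 2 by field; rewrite gt_eqF.
by [].
Qed.

Lemma iqformD A u v : posdefmx A ->
  iqform A (u + v) = iqform A u + 2 * dotc (invmx A *m u) v + iqform A v.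
Proof.
move=> pA; rewrite /iqform qform_sqrD ?posdef_inv_sym//.
by rewrite dotc_mull posdef_inv_sym.
Qed.

Lemma iqform_le A r v : posdefmx A -> 0 < r ->
  (forall u, r * dotc u u <= qform A u u) -> iqform A v <= dotc v v / r.
Proof.
move=> pA r0 rA; set y := invmx A *m v.
have e1 : iqform A v = dotc y v by rewrite iqformE// qform_inv.
have := rA y; rewrite -iqformE// => h1.
have := dotc_ge0 (v + (- r) *: y).
rewrite dotcDl !dotcDr !dotcZl !dotcZr [dotc v y]dotcC -e1 => h2.
rewrite ler_pdivlMr//; nra.
Qed.
End Determinants.
End QuadraticForms.

(** * One step of the exponential process, for matrices *)

Section BennettMatrix.
Variables (R : realType) (n : nat).
Implicit Types (V U S W : 'M[R]_n) (m x : 'cV[R]_n) (r : R).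

(** The finite-dimensional R_r / sqrt r, written with the inverse of V + r so that no operator
    square root occurs. *)
Definition bnorm r V m := Num.sqrt (iqform (V + r%:M) m / r).
Definition bennett r V m :=
  expR (r * hfun (bnorm r V m) - ln (\det (1%:M + r^-1 *: V)) / 2).
Definition bslope r V m := ln (1 + bnorm r V m) / bnorm r V m.
(** Coefficients of the majorant as a polynomial in the entries of x. They are spelled out entrywise
    because the conditional expectations are known entry by entry. *)
Definition bcoef1 r V m i :=
  bennett r V m * (bslope r V m * (invmx (V + r%:M) *m m) i 0).
Definition bcoef2 r V m i j :=
  bennett r V m * (invmx (V + r%:M) i j / 2 + bslope r V m / 2 *
    ((invmx (V + r%:M) *m m) i 0 * (invmx (V + r%:M) *m m) j 0)).

Lemma bnorm_ge0 r V m : 0 <= bnorm r V m.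
Proof. exact: sqrtr_ge0. Qed.

Lemma bnorm_sqr r V m : psdmx V -> 0 < r ->
  bnorm r V m ^+ 2 = iqform (V + r%:M) m / r.
Proof.
move=> pV r0; rewrite sqr_sqrtr// divr_ge0 ?(ltW r0)//.
exact/iqform_ge0/posdef_addscalar.
Qed.

Lemma shift_ge V r u : psdmx V -> r * dotc u u <= qform (V + r%:M) u u.
Proof. by move=> [_ pV]; rewrite qformDm qform_scalar lerDr. Qed.

Lemma det_shift V r : 0 < r -> \det (V + r%:M) = r ^+ n * \det (1%:M + r^-1 *: V).
Proof.
move=> r0; rewrite -detZ; congr (\det _); rewrite scalerDr scalerA.
by rewrite divff ?gt_eqF// scale1r addrC scalemx1.
Qed.

Lemma det_normalized_gt0 V r : psdmx V -> 0 < r -> 0 < \det (1%:M + r^-1 *: V).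
Proof.
move=> pV r0; apply: det_posdef_gt0; rewrite addrC; apply: posdef_addscalar => //.
by apply: psdZ => //; rewrite invr_ge0 ltW.
Qed.

(** This is [hfun_step] for the inner product of (U + r)^-1 / r and B = 1 / r: since U + r >= r, a
    vector x of length at most 1 has length at most 1 / r there. *)
Lemma bennett_step r U m x : psdmx U -> 0 < r -> dotc x x <= 1 ->
  bennett r U (m + x) <= bennett r U m + \sum_i bcoef1 r U m i * x i 0 +
    \sum_i \sum_j bcoef2 r U m i j * (x i 0 * x j 0).
Proof.
move=> pU r0 x1; set W := U + r%:M; have pW : posdefmx W by exact: posdef_addscalar.
set y := invmx W *m m.
have -> : \sum_i bcoef1 r U m i * x i 0 = bennett r U m * (bslope r U m * dotc y x).
  rewrite dotcE !mulr_sumr; apply: eq_bigr => i _.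
  by rewrite /bcoef1 -/W -/y !mulrA.
have -> : \sum_i \sum_j bcoef2 r U m i j * (x i 0 * x j 0) =
  bennett r U m * (iqform W x / 2 + bslope r U m / 2 * dotc y x ^+ 2).
  rewrite mulrDr /iqform qformE mulr_suml mulr_sumr.
  rewrite expr2 dotcE big_distrlr/= !mulr_sumr -big_split/=; apply: eq_bigr => i _.
  rewrite mulr_suml !mulr_sumr -big_split/=; apply: eq_bigr => j _.
  by rewrite /bcoef2 -/W -/y; ring.
have -> : bennett r U (m + x) = bennett r U m *
    expR ((hfun (bnorm r U (m + x)) - hfun (bnorm r U m)) / r^-1).
  rewrite /bennett -expRD invrK; congr expR; ring.
rewrite -[X in X + _ + _]mulr1 -!mulrDr ler_pM2l ?expR_gt0//.
have sq := bnorm_sqr _ pU r0; rewrite -/W in sq.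
have := @hfun_step R (bnorm r U m) (bnorm r U (m + x)) (dotc y x / r)
   (iqform W x / r) r^-1.
rewrite invr_gt0 r0 !bnorm_ge0 => /(_ isT isT isT).
have q0 : 0 <= iqform W x by exact: iqform_ge0.
rewrite !sq iqformD// -/y => H.
apply: le_trans (H _ _ _ _) _.
- by field; rewrite gt_eqF.
- rewrite !exprMn -/W.
  have := iqform_CauchySchwarz y x pW.
  rewrite -iqformE// => CS.
  have -> : iqform W m / r * (iqform W x / r) = iqform W m * iqform W x * r^-1 ^+ 2.
    by rewrite expr2; ring.
  by rewrite ler_wpM2r// sqr_ge0.
- by rewrite divr_ge0// ltW.
- rewrite expr2 ler_pM2r ?invr_gt0//.
  have := iqform_le x pW r0 (fun u => shift_ge r u pU); move=> /le_trans; apply.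
  by rewrite ler_piMl ?invr_ge0 ?(ltW r0).
rewrite -/(bslope r U m) le_eqVlt; apply/orP; left; apply/eqP.
by field; rewrite gt_eqF.
Qed.

(** After 1 + z <= exp z, the trace in z is at most the change of log det, and the slope term is at
    most r times the change of h, by [hfun_contract]. *)
Lemma bennett_average r V S m : psdmx V -> psdmx S -> 0 < r ->
  bennett r (V + S) m + \sum_i \sum_j bcoef2 r (V + S) m i j * S i j <=
  bennett r V m.
Proof.
move=> pV pS r0; set U := V + S; have pU : psdmx U by exact: psdD.
set W' := U + r%:M; have pW' : posdefmx W' by exact: posdef_addscalar.
set W := V + r%:M; have pW : posdefmx W by exact: posdef_addscalar.
have WE : W' = W + S by rewrite /W' /W /U addrAC.
set y := invmx W' *m m.
have [sS S0] := pS.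
have -> : \sum_i \sum_j bcoef2 r U m i j * S i j =
  bennett r U m * (\tr (invmx W' *m S) / 2 + bslope r U m / 2 * qform S y y).
  rewrite mulrDr qformE /mxtrace mulr_suml !mulr_sumr -big_split/=; apply: eq_bigr => i _.
  rewrite mxE mulr_suml !mulr_sumr -big_split/=; apply: eq_bigr => j _.
  have -> : S j i = S i j by rewrite -[in LHS]sS mxE.
  by rewrite /bcoef2 -/W' -/y; ring.
rewrite -[X in X + _ <= _]mulr1 -mulrDr.
apply: (@le_trans _ _ (bennett r U m *
   expR (\tr (invmx W' *m S) / 2 + bslope r U m / 2 * qform S y y))).
  by rewrite ler_pM2l ?expR_gt0// expR_ge1Dx.
rewrite /bennett -expRD ler_expR.
have trS : \tr (invmx W' *m S) <= ln (\det (1%:M + r^-1 *: U)) - ln (\det (1%:M + r^-1 *: V)).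
  have := det_posdef_le_trace pW pW'.
  have -> : W = W' - S by rewrite WE addrK.
  rewrite mulmxBr mulVmx ?posdef_unitmx// linearB/= mxtrace1.
  have -> : W' - S = V + r%:M by rewrite WE addrK.
  rewrite addrAC subrr add0r !det_shift// -mulrA ler_pM2l ?exprn_gt0//.
  rewrite -ler_ln ?posrE ?mulr_gt0 ?expR_gt0 ?det_normalized_gt0//.
  by rewrite lnM ?posrE ?expR_gt0 ?det_normalized_gt0// expRK; lra.
suff H : bslope r U m / 2 * qform S y y <= r * (hfun (bnorm r V m) - hfun (bnorm r U m)).
  lra.
have [y0|y0] := eqVneq y 0.
  rewrite /qform y0 /dotc trmx0 mul0mx mxE mulr0 mulr_ge0 ?(ltW r0)//.
  rewrite subr_ge0 [leLHS](_ : _ = 0) ?hfun_ge0 ?bnorm_ge0//.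
  rewrite /bnorm iqformE// -/y y0 /qform /dotc trmx0 mul0mx mxE mul0r sqrtr0.
  exact: hfun0.
have qW' : 0 < qform W' y y by case: pW' => _; apply.
have qW : 0 < qform W y y by case: pW => _; apply.
have q' : qform W' y y = qform W y y + qform S y y by rewrite WE qformDm.
have iq' : iqform W' m = qform W' y y by rewrite iqformE.
set s := bnorm r U m; have s2 : s ^+ 2 = qform W' y y / r.
  by rewrite /s bnorm_sqr// -/W' iq'.
have sp : 0 < s.
  by rewrite lt_neqAle bnorm_ge0 andbT eq_sym -sqrf_eq0 s2 gt_eqF ?divr_gt0.
(* The contraction factor is the share of S in the form of V + S + r at y = (V + S + r)^-1 m. *)
have := @hfun_contract R s (qform S y y / qform W' y y) (ltW sp).
have k0 : 0 <= qform S y y / qform W' y y by rewrite divr_ge0// ltW.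
have k1 : qform S y y / qform W' y y < 1 by rewrite ltr_pdivrMr//; lra.
move=> /(_ k0 k1 (bnorm r V m) (bnorm_ge0 _ _ _)).
rewrite s2 bnorm_sqr// -/W => H.
(* Cauchy-Schwarz for W: the square of <y, m> = W'(y, y) is at most W(y, y) times the dual form of
   m, and W(y, y) is the fraction 1 - k of W'(y, y). *)
have C : qform W' y y / r <=
    (1 - qform S y y / qform W' y y) * (iqform W m / r).
  rewrite mulrA ler_pM2r ?invr_gt0// -(ler_pM2l qW').
  have := iqform_CauchySchwarz y m pW; rewrite qform_inv//.
  have -> : dotc y m = qform W' y y by rewrite qform_inv.
  rewrite expr2 => /le_trans; apply.
  rewrite mulrA mulrBr mulr1 mulrCA divff ?gt_eqF// mulr1 q' addrK.
  by [].
have := H C.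
have -> : qform S y y / qform W' y y * (s * ln (1 + s)) / 2 =
   bslope r U m / 2 * qform S y y / r.
  rewrite /bslope -/s.
  have -> : s * ln (1 + s) = s ^+ 2 * (ln (1 + s) / s) by field; rewrite gt_eqF.
  by rewrite s2; field; rewrite !gt_eqF.
by rewrite ler_pdivrMr// [X in _ <= X]mulrC.
Qed.

(* The factor u absorbs the mismatch between the scale r of the mixture and
   the scale a of the boundary. *)
Lemma bennett_ge a u r V m : psdmx V -> 0 < a -> a <= r -> r <= u * a ->
  expR (u * a * hfun (bnorm a V m / u) - ln (\det (1%:M + a^-1 *: V)) / 2) <=
  bennett r V m.
Proof.
move=> pV a0 ar ru; have r0 : 0 < r by lra.
have a0' := ltW a0; have r0' := ltW r0.
have u0 : 0 < u by rewrite -(pmulr_lgt0 _ a0); lra.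
rewrite ler_expR lerB//; last first.
  rewrite ler_pM2r ?invr_gt0// ler_ln ?posrE ?det_normalized_gt0//.
  have pd b : 0 < b -> posdefmx (1%:M + b^-1 *: V).
    by move=> b0; rewrite addrC; apply: posdef_addscalar => //; apply: psdZ => //; rewrite invr_ge0 ltW.
  apply: det_posdef_le; [exact: pd..|] => x.
  rewrite !qformDm lerD2l !qformZm ler_wpM2r//; first by case: pV.
  by rewrite lef_pV2 ?posrE.
have pWa := posdef_addscalar pV a0; have pWr := posdef_addscalar pV r0.
set z := bnorm a V m; have z0 : 0 <= z := bnorm_ge0 _ _ _.
have zr : a / r * z <= bnorm r V m.
  rewrite -(ler_pXn2r (_ : 0 < 2)%N) ?nnegrE ?bnorm_ge0//; last first.
    by rewrite mulr_ge0// divr_ge0.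
  rewrite exprMn /z !bnorm_sqr//.
  set y := invmx (V + a%:M) *m m.
  (* The maximizer for the scale a, rescaled, is a test vector for r; as V + r <= (r / a) (V + a),
     this yields R_r^2 >= (a / r) R_a^2. *)
  have := iqform_ge ((a / r) *: y) m pWr.
  rewrite dotcZl qformZl qformZr.
  have iy : iqform (V + a%:M) m = dotc y m by rewrite iqformE// qform_inv.
  have yr : qform (V + r%:M) y y <= r / a * iqform (V + a%:M) m.
    rewrite iqformE// -/y !qformDm !qform_scalar mulrDr lerD//.
      by rewrite ler_peMl//; [case: pV => _; apply | rewrite ler_pdivlMr// mul1r].
    by rewrite mulrA divfK ?gt_eqF.
  rewrite -iy => H.
  have h2 : 0 <= a / r by rewrite divr_ge0.
  have := ler_wpM2l h2 (ler_wpM2l h2 yr).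
  have -> : a / r * (a / r * (r / a * iqform (V + a%:M) m)) = a / r * iqform (V + a%:M) m.
    by field; rewrite !gt_eqF.
  move=> H2.
  have H3 : a / r * iqform (V + a%:M) m <= iqform (V + r%:M) m by lra.
  have -> : (a / r) ^+ 2 * (iqform (V + a%:M) m / a) = a / r * iqform (V + a%:M) m / r.
    by field; rewrite !gt_eqF.
  by rewrite ler_pM2r ?invr_gt0.
apply: (@le_trans _ _ (r * hfun (a / r * z))); last first.
  rewrite ler_pM2l//; apply: hfun_le => //.
  by rewrite mulr_ge0// divr_ge0.
(* Since z / u = t w with t <= 1, it remains to see h (t w) <= t h (w), which is convexity together
   with h 0 = 0. *)
set t := r / (u * a); set w := a / r * z.
have ua0 : 0 < u * a by rewrite mulr_gt0.
have -> : z / u = t * w by rewrite /t /w; field; rewrite !gt_eqF.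
have -> : r = u * a * t by rewrite /t; field; rewrite !gt_eqF.
rewrite -[leRHS]mulrA ler_pM2l//.
have w0 : 0 <= w by rewrite mulr_ge0// divr_ge0.
have t0 : 0 <= t by rewrite divr_ge0// ltW.
have t1 : t <= 1 by rewrite ler_pdivrMr// mul1r.
have tw0 : 0 <= t * w by exact: mulr_ge0.
have h1 := hfun_tangent tw0 w0; have h2 := hfun_tangent tw0 (lexx 0).
rewrite hfun0 in h2.
have t1' : 0 <= 1 - t by lra.
have := lerD (ler_wpM2l t0 h1) (ler_wpM2l t1' h2); lra.
Qed.

Lemma bennett0 r : 0 < r -> bennett r 0 0 = 1.
Proof.
move=> r0; rewrite /bennett scaler0 addr0 det1 ln1 mul0r subr0.
rewrite /bnorm /iqform /qform mulmx0 /dotc mulmx0 mxE mul0r sqrtr0 hfun0.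
by rewrite mulr0 expR0.
Qed.
End BennettMatrix.

(** * Conditional expectations with unbounded coefficients *)

Section ConditionalExpectation.
Variables (d : measure_display) (Omega : measurableType d) (R : realType).
Variable P : probability Omega R.
Implicit Types (G : set (set Omega)) (A : set Omega).

(** Phrased on the measurable type generated by G, so that the closure properties of measurable
    functions apply to a sub-sigma-algebra. *)
Definition wrt_measurable G (f : Omega -> R) :=
  measurable_fun [set: g_sigma_algebraType G]
    (f : g_sigma_algebraType G -> measurableTypeR R).

Definition sub_sigma G := sigma_algebra setT G /\ G `<=` measurable.

Lemma wrt_measurable_set G f (B : set R) : sub_sigma G -> wrt_measurable G f ->
  measurable B -> G (f @^-1` B).
Proof.
move=> [sG _] mf mB; rewrite -(measurable_g_measurableTypeE sG) -[X in _ X]setTI.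
exact: mf.
Qed.

Lemma wrt_measurable_fun G f : sub_sigma G -> wrt_measurable G f ->
  measurable_fun [set: Omega] f.
Proof.
by move=> sG mf _ B mB; rewrite setTI; apply: sG.2; exact: wrt_measurable_set.
Qed.

Lemma wrt_measurable_borel G f : sub_sigma G -> borel_wrt G f -> wrt_measurable G f.
Proof.
move=> [sG _] bf; apply: (measurability _ (RGenOpens.measurableE R)).
move=> _ [_ [a [b ->] <-]]; rewrite setTI measurable_g_measurableTypeE//.
by apply: bf; exact: interval_open.
Qed.

Lemma wrt_measurableI G A (B : set Omega) : sub_sigma G -> G A -> G B -> G (A `&` B).
Proof.
move=> [sG _]; rewrite -(measurable_g_measurableTypeE sG); exact: measurableI.
Qed.

Lemma wrt_measurableT G : sub_sigma G -> G setT.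
Proof.
move=> [sG _]; rewrite -(measurable_g_measurableTypeE sG); exact: measurableT.
Qed.

Lemma wrt_measurableC G A : sub_sigma G -> G A -> G (~` A).
Proof.
move=> [sG _]; rewrite -(measurable_g_measurableTypeE sG); exact: measurableC.
Qed.

Lemma integrable_bounded_mul A (a f : Omega -> R) (K : R) : measurable A ->
  measurable_fun setT a -> (forall w, A w -> `|a w| <= K) ->
  P.-integrable setT (EFin \o f) -> P.-integrable A (fun w => (a w * f w)%:E).
Proof.
move=> mA ma aK intf.
have intfA : P.-integrable A (EFin \o f) by apply: integrableS intf.
apply: (le_integrable mA _ _ (integrableZl mA K intfA)).
- apply/measurable_EFinP; apply: measurable_funM; first exact: measurable_funTS.
  apply: measurable_funTS; apply/measurable_EFinP; exact: measurable_int intf.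
- move=> w Aw /=; rewrite lee_fin !normrM ler_wpM2r//.
  exact: le_trans (aK _ Aw) (ler_norm _).
Qed.

(* Halving the range of the coefficient a splits A into two pieces on which a
   is close to a constant; the constants do not contribute. *)
Lemma condexp0_bounded_mul_le G (f : Omega -> R) : sub_sigma G ->
  P.-integrable setT (EFin \o f) ->
  (forall A, G A -> \int[P]_(w in A) f w = 0) ->
  forall n (a : Omega -> R) A (K : R), wrt_measurable G a -> G A ->
    (forall w, A w -> `|a w| <= K) ->
    `|\int[P]_(w in A) (a w * f w)| <= K / 2 ^+ n * \int[P]_(w in A) `|f w|.
Proof.
move=> sG intf f0; elim=> [|n IHn] a A K ma GA aK.
  have mA : measurable A by exact: sG.2.
  have ma' := wrt_measurable_fun sG ma.
  have intaf := integrable_bounded_mul mA ma' aK intf.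
  have intfA : P.-integrable A (EFin \o f) by apply: integrableS intf.
  have intnA : P.-integrable A (EFin \o (fun w => `|f w|)) by exact: integrable_norm.
  rewrite expr0 divr1; apply: le_trans (le_normr_Rintegral mA intaf) _.
  rewrite -RintegralZl//; apply: le_Rintegral => //.
  - exact: integrable_norm.
  - exact: (integrableZl mA K intnA).
  - by move=> w Aw; rewrite normrM ler_wpM2r// aK.
have split_bound (B : set Omega) (c : R) : G B -> B `<=` A ->
    (forall w, B w -> `|a w - c| <= K / 2) ->
    `|\int[P]_(w in B) (a w * f w)| <= K / 2 ^+ n.+1 * \int[P]_(w in B) `|f w|.
  move=> GB BA acK.
  have mB : measurable B by exact: sG.2.
  have mac : wrt_measurable G (fun w => a w - c).
    by apply: measurable_funB => //; exact: measurable_cst.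
  have := IHn _ B _ mac GB acK.
  have -> : \int[P]_(w in B) ((a w - c) * f w) = \int[P]_(w in B) (a w * f w).
    have intfB : P.-integrable B (EFin \o f) by apply: integrableS intf.
    under eq_Rintegral do rewrite mulrBl.
    rewrite RintegralB//.
    - by rewrite RintegralZl// f0// mulr0 subr0.
    - apply: (@integrable_bounded_mul _ _ _ K mB _ _ intf).
        exact: wrt_measurable_fun ma.
      by move=> w /BA; exact: aK.
    - exact: (integrableZl mB c intfB).
  by rewrite exprS invfM mulrA.
pose Ap := A `&` a @^-1` `[0, +oo[; pose An := A `&` a @^-1` `]-oo, 0[.
have GAp : G Ap by apply: wrt_measurableI => //; apply: wrt_measurable_set => //.
have GAn : G An by apply: wrt_measurableI => //; apply: wrt_measurable_set => //.
have AE : A = Ap `|` An.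
  apply/seteqP; split=> w; last by case=> -[].
  by move=> Aw; have [a0|a0] := leP 0 (a w); [left|right]; split=> //=;
    rewrite in_itv/= ?a0.
have dis : [disjoint Ap & An].
  apply/eqP/seteqP; split=> // w [[_ /=] + [_ /=]]; rewrite !in_itv/= andbT.
  by move=> h1 h2; have := le_lt_trans h1 h2; rewrite ltxx.
have mAp := sG.2 _ GAp; have mAn := sG.2 _ GAn; have mA := sG.2 _ GA.
have ma' := wrt_measurable_fun sG ma.
have intaf := integrable_bounded_mul mA ma' aK intf.
have intnA : P.-integrable A (EFin \o (fun w => `|f w|)).
  by apply: integrable_norm => //; apply: integrableS intf.
rewrite [in leLHS]AE [in leRHS]AE !Rintegral_setU -?AE// mulrDr.
apply: le_trans (ler_normD _ _) _; apply: lerD.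
- apply: (split_bound _ (K / 2)) => // [w []//|w [Aw /=]].
  rewrite in_itv/= andbT => a0; have := aK _ Aw; rewrite ger0_norm//.
  by rewrite ler_norml; lra.
- apply: (split_bound _ (- (K / 2))) => // [w []//|w [Aw /=]].
  rewrite in_itv/= => a0; have := aK _ Aw; rewrite ltr0_norm//.
  by rewrite ler_norml; lra.
Qed.

Lemma condexp0_bounded_mul G (f a : Omega -> R) A (K : R) : sub_sigma G ->
  P.-integrable setT (EFin \o f) ->
  (forall A, G A -> \int[P]_(w in A) f w = 0) ->
  wrt_measurable G a -> G A -> (forall w, A w -> `|a w| <= K) ->
  \int[P]_(w in A) (a w * f w) = 0.
Proof.
move=> sG intf f0 ma GA aK; apply/eqP; rewrite -normr_le0.
set c := `|_|; set I := \int[P]_(w in A) `|f w|.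
have h n : c <= K * I * (2^-1) ^+ n.
  have := condexp0_bounded_mul_le sG intf f0 n ma GA aK.
  by rewrite -/c -/I exprVn mulrAC.
have cv : (fun n => K * I * (2^-1) ^+ n) @ \oo --> (K * I * 0 : R).
  by apply: cvgMr; apply: cvg_expr; rewrite ger0_norm; lra.
rewrite mulr0 in cv.
by rewrite -(cvg_lim (@Rhausdorff R) cv); apply: limr_ge; [apply/cvg_ex; eexists; exact: cv|apply: nearW].
Qed.

Lemma integrable_sum_fun A (I : finType) (c : I -> Omega -> R) :
  measurable A -> (forall i, P.-integrable A (EFin \o c i)) ->
  P.-integrable A (fun w => (\sum_i c i w)%:E).
Proof.
move=> mA ci; under eq_fun do rewrite -sumEFin.
by apply: integrable_sum => // i _; exact: ci.
Qed.

Lemma Rintegral_sum A (I : finType) (c : I -> Omega -> R) : measurable A ->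
  (forall i, P.-integrable A (EFin \o c i)) ->
  \int[P]_(w in A) (\sum_i c i w) = \sum_i \int[P]_(w in A) c i w.
Proof.
move=> mA ci; rewrite /Rintegral.
under eq_integral do rewrite -sumEFin.
rewrite integral_sum//.
by rewrite -EFin_sum_fine// => i _; exact: integrable_fin_num (ci i).
Qed.

(* The coefficients need not be bounded: they are localized on the sets where
   the sum of their absolute values lies in [k, k + 1[. *)
Lemma condexp_lincomb_le G (I : finType) (c Z Z' : I -> Omega -> R)
    (f g : Omega -> R) : sub_sigma G ->
  (forall i, wrt_measurable G (c i)) ->
  (forall i, P.-integrable setT (EFin \o Z i)) ->
  (forall i, P.-integrable setT (EFin \o Z' i)) ->
  (forall i A, G A -> \int[P]_(w in A) Z i w = \int[P]_(w in A) Z' i w) ->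
  measurable_fun setT f -> measurable_fun setT g ->
  (forall w, 0 <= f w) -> (forall w, 0 <= g w) ->
  {ae P, forall w, f w <= \sum_i c i w * Z i w} ->
  (forall w, \sum_i c i w * Z' i w <= g w) ->
  forall A, G A ->
    (\int[P]_(w in A) (f w)%:E <= \int[P]_(w in A) (g w)%:E)%E.
Proof.
move=> sG mc iZ iZ' ZZ' mf mg f0 g0 fZ gZ A GA.
pose s w := \sum_i `|c i w|.
have ms : wrt_measurable G s.
  rewrite /wrt_measurable /s; apply: measurable_sum => i.
  by apply: measurableT_comp => //; exact: mc.
pose B k := A `&` s @^-1` `[k%:R, k.+1%:R[.
have GB k : G (B k) by apply: wrt_measurableI => //; apply: wrt_measurable_set.
have mB k := sG.2 _ (GB k).
have AE : A = \bigcup_k B k.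
  apply/seteqP; split=> [w Aw|w [k _ []//]].
  have s0 : 0 <= s w by rewrite sumr_ge0.
  exists (Num.truncn (s w)) => //; split=> //=; rewrite in_itv/=.
  exact: truncn_itv.
have tB : trivIset setT B.
  apply/trivIsetP => i j _ _ ij; apply/seteqP; split=> // w [[_ +] [_ +]].
  rewrite /= !in_itv/= => /andP[i1 i2] /andP[j1 j2].
  have := le_lt_trans i1 j2; have := le_lt_trans j1 i2; rewrite !ltr_nat !ltnS.
  by move=> h1 h2; move/eqP: ij; apply; apply/eqP; rewrite eqn_leq h1 h2.
have slice (h : Omega -> R) : measurable_fun setT h -> (forall w, 0 <= h w) ->
    (\int[P]_(w in \bigcup_k B k) (h w)%:E =
     \sum_(k <oo) \int[P]_(w in B k) (h w)%:E)%E.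
  move=> mh h0; apply: ge0_integral_bigcup => //.
    by apply: measurable_funTS; exact/measurable_EFinP.
  by move=> w _; rewrite lee_fin.
rewrite AE !slice//.
apply: lee_nneseries => [k _ _|k _]; first by apply: integral_ge0 => w _; rewrite lee_fin.
have cK i w : B k w -> `|c i w| <= k.+1%:R.
  move=> [_ /=]; rewrite in_itv/= => /andP[_ /ltW]; apply: le_trans.
  by rewrite /s (bigD1 i)//= lerDl sumr_ge0.
have mci i := wrt_measurable_fun sG (mc i).
have icZ i := integrable_bounded_mul (mB k) (mci i) (cK i) (iZ i).
have icZ' i := integrable_bounded_mul (mB k) (mci i) (cK i) (iZ' i).
have iS : P.-integrable (B k) (fun w => (\sum_i c i w * Z i w)%:E).
  exact: (integrable_sum_fun (mB k) icZ).
have iS' : P.-integrable (B k) (fun w => (\sum_i c i w * Z' i w)%:E).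
  exact: (integrable_sum_fun (mB k) icZ').
have E : \int[P]_(w in B k) (\sum_i c i w * Z i w) =
         \int[P]_(w in B k) (\sum_i c i w * Z' i w).
  rewrite !Rintegral_sum//; apply: eq_bigr => i _.
  apply/eqP; rewrite -subr_eq0 -(RintegralB (mB k) (icZ i) (icZ' i)); apply/eqP.
  under eq_Rintegral do rewrite -mulrBr.
  apply: (@condexp0_bounded_mul G (fun w => Z i w - Z' i w) (c i) (B k) k.+1%:R) => //.
  - exact: (integrableB measurableT (iZ i) (iZ' i)).
  - move=> C GC; have mC := sG.2 _ GC.
    rewrite RintegralB ?ZZ' ?subrr//; exact: integrableS (iZ _) || exact: integrableS (iZ' _).
  - by move=> w; exact: cK.
(* Truncation at 0 makes the integrand nonnegative, as the almost sure comparison requires; as 0 <=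
   f, it changes the sum only on a null set. *)
apply: (@le_trans _ _ (\int[P]_(w in B k) (Num.max (\sum_i c i w * Z i w) 0)%:E)%E).
  apply: ae_ge0_le_integral => //.
  - by move=> w _; rewrite lee_fin.
  - by apply: measurable_funTS; exact/measurable_EFinP.
  - by move=> w _; rewrite lee_fin le_max lexx orbT.
  - apply/measurable_EFinP; apply: measurable_maxr => //; apply/measurable_EFinP.
    exact: measurable_int iS.
  - by apply: filterS fZ => w h _; rewrite lee_fin le_max h.
rewrite [leLHS](_ : _ = (\int[P]_(w in B k) (\sum_i c i w * Z i w)%:E)%E); last first.
  apply: ae_eq_integral => //.
  - apply/measurable_EFinP; apply: measurable_maxr => //; apply/measurable_EFinP.
    exact: measurable_int iS.
  - exact: measurable_int iS.
  - by apply: filterS fZ => w h _; rewrite /= max_l// (le_trans (f0 w)).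
apply: (@le_trans _ _ (\int[P]_(w in B k) (\sum_i c i w * Z' i w)%:E)%E).
  rewrite -(fineK (integrable_fin_num (mB k) iS)) -(fineK (integrable_fin_num (mB k) iS')).
  by rewrite lee_fin; move: E; rewrite /Rintegral => ->.
(* The averaged sum may be negative; here the truncation increases the integral, yet stays below g
   because g is nonnegative. *)
apply: (@le_trans _ _ (\int[P]_(w in B k) (Num.max (\sum_i c i w * Z' i w) 0)%:E)%E).
  have im : P.-integrable (B k) (fun w => (Num.max (\sum_i c i w * Z' i w) 0)%:E).
    apply: (le_integrable (mB k) _ _ iS').
      apply/measurable_EFinP; apply: measurable_maxr => //; apply/measurable_EFinP.
      exact: measurable_int iS'.
    move=> w _ /=; rewrite lee_fin ger0_norm ?le_max ?lexx ?orbT//.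
    by rewrite ge_max ler_norm normr_ge0.
  by apply: le_integral => // w _; rewrite lee_fin le_max lexx.
apply: ge0_le_integral => //.
- by move=> w _; rewrite lee_fin le_max lexx orbT.
- apply/measurable_EFinP; apply: measurable_maxr => //; apply/measurable_EFinP.
  exact: measurable_int iS'.
- by apply: measurable_funTS; exact/measurable_EFinP.
- by move=> w _; rewrite lee_fin ge_max gZ g0.
Qed.
End ConditionalExpectation.

(** * Inner products and Cauchy-Schwarz *)

Section InnerProduct.
Variables (R : realType) (H : completeNormedModType R).
Variable ip : {dot H for idfun}.
Hypothesis ipn : norm_induced_by ip.
Implicit Types (x y z u v : H) (a : R).

Lemma ipDl x y z : ip (x + y) z = ip x z + ip y z.
Proof. exact: linearDl. Qed.

Lemma ipDr x y z : ip z (x + y) = ip z x + ip z y.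
Proof. exact: linearDr. Qed.

Lemma ipBl x y z : ip (x - y) z = ip x z - ip y z.
Proof. exact: linearBl. Qed.

Lemma ipBr x y z : ip z (x - y) = ip z x - ip z y.
Proof. exact: linearBr. Qed.

Lemma ip0l x : ip 0 x = 0.
Proof. exact: linear0l. Qed.

Lemma ip0r x : ip x 0 = 0.
Proof. exact: linear0r. Qed.

Lemma ipZl a x y : ip (a *: x) y = a * ip x y.
Proof. exact: linearZl_LR. Qed.

Lemma ipZr a x y : ip x (a *: y) = a * ip x y.
Proof. exact: linearZr_LR. Qed.

Lemma ip_suml (I : Type) (r : seq I) (p : pred I) (f : I -> H) y :
  ip (\sum_(i <- r | p i) f i) y = \sum_(i <- r | p i) ip (f i) y.
Proof. exact: linear_sumlz. Qed.

Lemma ip_sumr (I : Type) (r : seq I) (p : pred I) (f : I -> H) y :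
  ip y (\sum_(i <- r | p i) f i) = \sum_(i <- r | p i) ip y (f i).
Proof. exact: linear_sumr. Qed.

Lemma ipC x y : ip x y = ip y x.
Proof. by rewrite hermC expr0 mul1r. Qed.

Lemma ip_ge0 x : 0 <= ip x x.
Proof. by rewrite ipn sqr_ge0. Qed.

Lemma ip_eq0 x : ip x x = 0 -> x = 0.
Proof. by rewrite ipn => /eqP; rewrite sqrf_eq0 normr_eq0 => /eqP. Qed.

Lemma normB_sqr x y : `|x - y| ^+ 2 = `|x| ^+ 2 - 2 * ip x y + `|y| ^+ 2.
Proof. by rewrite -!ipn ipBl !ipBr (ipC y x); ring. Qed.

(** The discriminant of the form along the line x + r y. A degenerate T is covered because
    [quadratic_disc_le] allows a zero leading coefficient. *)
Lemma positive_operator_CauchySchwarz (T : H -> H) x y : positive_operator ip T ->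
  ip x (T y) ^+ 2 <= ip x (T x) * ip y (T y).
Proof.
move=> [lT _ sT pT]; apply: quadratic_disc_le => // r.
have -> : ip x (T x) + 2 * r * ip x (T y) + r ^+ 2 * ip y (T y) =
   ip (r *: y + x) (T (r *: y + x)).
  rewrite lT ipDl !ipDr !ipZl !ipZr -[ip y (T x)]sT (ipC (T y)); ring.
exact: pT.
Qed.

Lemma positive_operator_id : positive_operator ip id.
Proof.
by split=> //; [move=> x; exact: cvg_id | exact: ip_ge0].
Qed.

Lemma ip_CauchySchwarz_sqr x y : ip x y ^+ 2 <= ip x x * ip y y.
Proof. exact: positive_operator_CauchySchwarz positive_operator_id. Qed.

Lemma ip_CauchySchwarz x y : `|ip x y| <= `|x| * `|y|.
Proof.
rewrite -(ler_pXn2r (_ : 0 < 2)%N) ?nnegrE ?mulr_ge0//.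
by rewrite real_normK ?num_real// exprMn -!ipn ip_CauchySchwarz_sqr.
Qed.

Lemma ip_continuous u : continuous (ip u).
Proof.
move=> x; apply/cvgrPdist_lt => e e0.
have k0 : 0 < e / (`|u| + 1) by rewrite divr_gt0// ltr_wpDl.
have /cvgrPdist_lt/(_ _ k0) : x0 @[x0 --> x] --> x by exact: cvg_id.
apply: filterS => y yx.
rewrite -ipBr; apply: le_lt_trans (ip_CauchySchwarz _ _) _.
apply: (@le_lt_trans _ _ ((`|u| + 1) * `|x - y|)).
  by rewrite ler_wpM2r// lerDl.
by rewrite mulrC -ltr_pdivlMr ?ltr_wpDl.
Qed.

Lemma cvg_ip (T : Type) (F : set_system T) (FF : Filter F) (f g : T -> H) x y :
  f @ F --> x -> g @ F --> y -> (fun t => ip (f t) (g t)) @ F --> ip x y.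
Proof.
move=> fx gy.
have h : (fun t => ip x (g t) + ip (g t) (f t - x)) @ F --> ip x y + 0.
  apply: cvgD; first exact: continuous_cvg (@ip_continuous x y) gy.
  have -> : (fun t => ip (g t) (f t - x)) =
    (fun t => ip y (f t - x) + ip (g t - y) (f t - x)).
    by apply/funext => t; rewrite ipBl [RHS]addrC subrK.
  rewrite -[X in _ --> X]addr0; apply: cvgD.
    rewrite -(ip0r y); apply: continuous_cvg (@ip_continuous y 0) _.
    by rewrite -(subrr x); apply: cvgB => //; exact: cvg_cst.
  apply: norm_cvg0.
  have n0 : (fun t => `|g t - y| * `|f t - x|) @ F --> (0 * 0 : R).
    apply: cvgM; rewrite -(normr0 H); apply: cvg_norm.
    - by rewrite -(subrr y); apply: cvgB => //; exact: cvg_cst.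
    - by rewrite -(subrr x); apply: cvgB => //; exact: cvg_cst.
  rewrite mulr0 in n0.
  apply: (squeeze_cvgr _ (cvg_cst 0) n0); apply: nearW => t.
  by rewrite normr_ge0 ip_CauchySchwarz.
rewrite addr0 in h; apply: cvg_trans h.
by apply: near_eq_cvg; apply: nearW => t; rewrite ipBr ![ip (g t) _]ipC [LHS]addrC subrK.
Qed.
End InnerProduct.

(** * Ville's maximal inequality *)

Section Ville.
Variables (d : measure_display) (Omega : measurableType d) (R : realType).
Variable P : probability Omega R.

(** The event is split by the first passage above l: [A n] is a first passage at time n, and [B n]
    is the event of no passage before n. On [A n] the process exceeds l, so the passage
    probabilities are paid for by the initial mean. *)
Lemma ville (F : nat -> set (set Omega)) (S : nat -> Omega -> R) (l : R) :
  filtration F -> (forall n, wrt_measurable (F n) (S n)) ->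
  (forall n w, 0 <= S n w) -> (\int[P]_w (S 0%N w)%:E <= 1)%E ->
  (forall n A, F n A ->
    (\int[P]_(w in A) (S n.+1 w)%:E <= \int[P]_(w in A) (S n w)%:E)%E) ->
  0 < l ->
  measurable [set w | exists n, l < S n w] /\
  (P [set w | exists n, (l < S n w)%R] <= (l^-1)%:E)%E.
Proof.
move=> fF mS S0 S01 SS l0.
have sF n : sub_sigma (F n) by case: (fF n).
have incF n m : (n <= m)%N -> F n `<=` F m.
  elim: m => [|m IHm]; first by rewrite leqn0 => /eqP ->.
  rewrite leq_eqVlt => /predU1P[->//|]; rewrite ltnS => /IHm h.
  by apply: subset_trans h _; case: (fF m).
pose U n := S n @^-1` `]l, +oo[.
have FU n : F n (U n) by apply: wrt_measurable_set => //; exact: measurable_itv.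
pose B n := [set w | forall i, (i < n)%N -> ~ U i w].
have FB n : F n (B n).
  elim: n => [|n IHn].
    by rewrite [B 0%N](_ : _ = setT); [exact: wrt_measurableT|apply/seteqP; split].
  have -> : B n.+1 = B n `&` ~` U n.
    apply/seteqP; split=> w; first by move=> h; split; [move=> i /ltnW|]; apply: h.
    by move=> [h1 h2] i; rewrite ltnS leq_eqVlt => /predU1P[->//|]; exact: h1.
  apply: (incF n) => //; apply: wrt_measurableI => //; exact: wrt_measurableC.
pose A n := B n `&` U n.
have FA n : F n (A n) by exact: wrt_measurableI.
have mA n : measurable (A n) by exact: (sF n).2.
have mB n : measurable (B n) by exact: (sF n).2.
have mSE n (D : set Omega) : measurable_fun D (fun w => (S n w)%:E).
  by apply: measurable_funTS; apply/measurable_EFinP; exact: wrt_measurable_fun (mS n).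
have AE : [set w | exists n, l < S n w] = \bigcup_n A n.
  apply/seteqP; split=> w; last first.
    by move=> [n _ [_]]; rewrite /U/= in_itv/= andbT => h; exists n.
  move=> [n ln].
  have ex : exists n, `[< U n w >] by exists n; apply/asboolP; rewrite /U/= in_itv/= ln.
  exists (ex_minn ex) => //; case: ex_minnP => m /asboolP Um mmin; split=> // i im Ui.
  by have := mmin i (asboolT Ui); rewrite leqNgt im.
have tA : trivIset setT A.
  apply/trivIsetP => i j _ _ ij; apply/seteqP; split=> // w [[Bi Ui] [Bj Uj]].
  by have [h|h|h] := ltngtP i j; [apply: (Bj i)|apply: (Bi j)|rewrite h eqxx in ij].
rewrite AE; split; first exact: bigcup_measurable.
(* The mean of the process stopped at its first passage: the past passages contribute the sum, the
   paths still running the last integral. *)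
have step n : (\sum_(0 <= i < n) \int[P]_(w in A i) (S i w)%:E +
    \int[P]_(w in B n) (S n w)%:E <= 1)%E.
  elim: n => [|n IHn].
    rewrite big_geq// add0e [B 0%N](_ : _ = setT)//.
    by apply/seteqP; split.
  apply: le_trans IHn; rewrite big_nat_recr//= -addeA leeD2l//.
  have -> : B n = A n `|` B n.+1.
    apply/seteqP; split=> w.
      move=> h; have [Un|nU] := pselect (U n w); [by left|right=> i].
      by rewrite ltnS leq_eqVlt => /predU1P[->//|]; exact: h.
    by move=> [[]//|h i /ltnW]; exact: h.
  rewrite ge0_integral_setU//.
  - rewrite leeD2l//; apply: SS; rewrite (_ : B n.+1 = B n `&` ~` U n).
      by apply: wrt_measurableI => //; exact: wrt_measurableC.
    apply/seteqP; split=> w; first by move=> h; split; [move=> i /ltnW|]; apply: h.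
    by move=> [h1 h2] i; rewrite ltnS leq_eqVlt => /predU1P[->//|]; exact: h1.
  - by move=> w _; rewrite lee_fin.
  - by apply/eqP/seteqP; split=> // w [[_ Un]] /(_ n (ltnSn n)).
rewrite measure_bigcup//=.
apply: lime_le => [|]; first by apply: is_cvg_nneseries => *; exact: measure_ge0.
apply: nearW => n.
apply: (@le_trans _ _ (\sum_(0 <= i < n) ((l^-1)%:E * \int[P]_(w in A i) (S i w)%:E))%E).
  rewrite big_mkcond/=.
  apply: lee_sum => i _; rewrite in_setT.
  rewrite lee_pdivlMl// -integral_cst//.
  apply: ge0_le_integral => //.
  - by move=> w _; rewrite lee_fin ltW.
  - by move=> w [_]; rewrite /U/= in_itv/= andbT lee_fin => /ltW.
rewrite -ge0_sume_distrr; last first.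
  by move=> i _; apply: integral_ge0 => w _; rewrite lee_fin.
rewrite -[leRHS]mule1; apply: lee_wpmul2l; first by rewrite lee_fin invr_ge0 ltW.
apply: le_trans (step n); rewrite leeDl//.
by apply: integral_ge0 => w _; rewrite lee_fin.
Qed.
End Ville.

(** * Bochner integrals through their coordinates *)

Section BochnerCoordinates.
Variables (R : realType) (H : completeNormedModType R).
Variable ip : {dot H for idfun}.
Hypothesis ipn : norm_induced_by ip.
Variables (d : measure_display) (Omega : measurableType d).
Variable P : probability Omega R.

Lemma borel_wrt_comp (G : set (set Omega)) (f : Omega -> H) (g : H -> R) :
  sub_sigma G -> borel_wrt G f -> continuous g -> wrt_measurable G (g \o f).
Proof.
move=> sG bf cg; apply: wrt_measurable_borel => // U oU.
rewrite comp_preimage; apply: bf.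
by apply: open_comp => // x _; exact: cg.
Qed.

Lemma borel_wrt_measurable_comp (f : Omega -> H) (g : H -> R) :
  borel_wrt (@measurable d Omega) f -> continuous g -> measurable_fun setT (g \o f).
Proof.
move=> bf cg.
have sG : sub_sigma (@measurable d Omega) by split=> //; exact: sigma_algebra_measurable.
exact: wrt_measurable_fun sG (borel_wrt_comp sG bf cg).
Qed.

(** Gives the measurability of |f - s| one value of s at a time, without appeal to differences of
    measurable maps into H. *)
Lemma measurable_simple_comp (s : Omega -> H) (g : H -> Omega -> R) :
  simple_function s -> (forall x, measurable_fun setT (g x)) ->
  measurable_fun setT (fun w => g (s w) w).
Proof.
move=> [fs ms] mg _ B mB; rewrite setTI.
have -> : (fun w => g (s w) w) @^-1` B =
    \bigcup_(x in range s) (s @^-1` [set x] `&` g x @^-1` B).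
  apply/seteqP; split=> w /=; first by move=> h; exists (s w).
  by move=> [x _ [<-]].
apply: fin_bigcup_measurable => // x _; apply: measurableI => //.
by rewrite -[X in measurable X]setTI; exact: mg.
Qed.

Lemma simple_integrable (A : set Omega) (s : Omega -> H) (u : H) :
  measurable A -> simple_function s ->
  P.-integrable A (fun w => (ip u (s w))%:E) /\
  \int[P]_(w in A) ip u (s w) = ip u (simple_integral P A s).
Proof.
move=> mA ss; have [fs ms] := ss.
pose r := finmap.enum_fset (fset_set (range s)).
have sE w : ip u (s w) = \sum_(x <- r) ip u x * \1_(s @^-1` [set x]) w.
  have ws : s w \in r by rewrite in_fset_set// inE; exists w.
  rewrite (bigD1_seq (s w))//=; last exact: finmap.fset_uniq.
  rewrite indicE mem_set//= mulr1 big1 ?addr0// => x xs.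
  by rewrite indicE memNset ?mulr0//= => h; rewrite h eqxx in xs.
have i1 x : P.-integrable A (fun w => (\1_(s @^-1` [set x]) w)%:E).
  by apply: integrableS (integrable_indic _ (ms x)).
have i2 x : P.-integrable A (fun w => (ip u x * \1_(s @^-1` [set x]) w)%:E).
  exact: (integrableZl mA _ (i1 x)).
split.
  under eq_fun do rewrite sE -sumEFin; exact: integrable_sum.
rewrite /simple_integral fsbig_finite//= ip_sumr.
transitivity (\sum_(x <- r) \int[P]_(w in A) (ip u x * \1_(s @^-1` [set x]) w)).
  rewrite /Rintegral; under eq_integral do rewrite sE -sumEFin.
  rewrite integral_sum//.
  by rewrite -EFin_sum_fine// => x _; exact: integrable_fin_num (i2 x).
apply: eq_bigr => x _; rewrite ipZr [RHS]mulrC RintegralZl//; last exact: i1.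
by rewrite /Rintegral integral_indic// setIC.
Qed.

(** The bridge from vector-valued to scalar integrals: [ip u] is Lipschitz, so L1 approximation by
    simple functions passes to the coordinate along u. *)
Lemma bochner_integral_inner (A : set Omega) (f : Omega -> H) (z u : H) :
  measurable A -> vintegrable P f -> is_bochner_integral P A f z ->
  P.-integrable A (fun w => (ip u (f w))%:E) /\
  \int[P]_(w in A) ip u (f w) = ip u z.
Proof.
move=> mA [bf intf] [s [ss s0 sz]].
have mu (v : H) : measurable_fun setT (fun w => ip v (f w)).
  exact: borel_wrt_measurable_comp (@ip_continuous _ _ _ ipn v).
have mn (x : H) : measurable_fun setT (fun w => `|f w - x|).
  apply: (@borel_wrt_measurable_comp f (fun y => `|y - x|)) => // y.
  by apply: cvg_norm; apply: cvgB; [exact: cvg_id|exact: cvg_cst].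
have mns k : measurable_fun setT (fun w => `|f w - s k w|).
  exact: (@measurable_simple_comp (s k) (fun x w => `|f w - x|)).
have mnf : measurable_fun setT (fun w => `|f w|).
  by apply: (@borel_wrt_measurable_comp f (fun y => `|y|)) => // y; exact: norm_continuous.
have iu : P.-integrable setT (fun w => (ip u (f w))%:E).
  have inf : P.-integrable setT (fun w => `|f w|%:E).
    apply/integrableP; split; first exact/measurable_EFinP.
    by under eq_integral do rewrite gee0_abs ?lee_fin//.
  apply: (le_integrable measurableT _ _ (integrableZl measurableT `|u| inf)).
    exact/measurable_EFinP.
  move=> w _ /=; rewrite lee_fin [leRHS]ger0_norm ?mulr_ge0//.
  exact: ip_CauchySchwarz.
have iuA : P.-integrable A (fun w => (ip u (f w))%:E) by apply: integrableS iu.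
split=> //.
have [isk skE] : (forall k, P.-integrable A (fun w => (ip u (s k w))%:E)) /\
    (forall k, \int[P]_(w in A) ip u (s k w) = ip u (simple_integral P A (s k))).
  by split=> k; have [] := simple_integrable u mA (ss k).
have l1 : (fun k => ip u (simple_integral P A (s k))) @ \oo --> ip u z.
  exact: (continuous_cvg _ (@ip_continuous _ _ _ ipn u z) sz).
suff l3 : (fun k => ip u (simple_integral P A (s k))) @ \oo -->
    \int[P]_(w in A) ip u (f w) by exact: (cvg_unique (@Rhausdorff R) l3 l1).
suff l2 : (fun k => \int[P]_(w in A) ip u (f w) -
    ip u (simple_integral P A (s k))) @ \oo --> (0 : R).
  have -> : (fun k => ip u (simple_integral P A (s k))) =
      (fun k => \int[P]_(w in A) ip u (f w) - (\int[P]_(w in A) ip u (f w) -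
        ip u (simple_integral P A (s k)))).
    by apply/funext => k; rewrite opprB addrC subrK.
  rewrite -[X in _ --> X]subr0; apply: cvgB => //; exact: cvg_cst.
have /fine_cvgP[s0f s0g] := s0.
have s0' : (fun k => `|u| * fine (\int[P]_(w in A) `|f w - s k w|%:E)) @ \oo --> (0 : R).
  rewrite -[X in _ --> X](mulr0 `|u|); apply: cvgMr.
  exact: s0g.
apply: norm_cvg0; apply: (squeeze_cvgr _ (cvg_cst 0) s0').
(* [fine] sends an infinite integral to 0, so the estimate is made only for those k at which the L1
   distance is finite. *)
apply: filterS s0f => k fk; rewrite normr_ge0/= -skE -(RintegralB mA iuA (isk k)).
have mD : measurable_fun A (fun w => (`|f w - s k w|)%:E).
  by apply: measurable_funTS; exact/measurable_EFinP.
have iD : P.-integrable A (fun w => `|f w - s k w|%:E).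
  apply/integrableP; split=> //.
  under eq_integral do rewrite gee0_abs ?lee_fin//.
  by rewrite -ge0_fin_numE// integral_ge0// => w _; rewrite lee_fin.
under eq_Rintegral do rewrite -(ipBr ip).
have iuD : P.-integrable A (EFin \o (fun w => ip u (f w - s k w))).
  rewrite (_ : _ \o _ = (fun w => (ip u (f w))%:E) \- (fun w => (ip u (s k w))%:E))%E.
    exact: integrableB.
  by apply/funext => w /=; rewrite ipBr.
apply: le_trans (le_normr_Rintegral mA iuD) _.
rewrite -[X in _ <= _ * X]/(\int[P]_(w in A) `|f w - s k w|) -RintegralZl//.
apply: le_Rintegral => //.
- exact: integrable_norm.
- exact: (integrableZl mA `|u| iD).
- by move=> w _; exact: ip_CauchySchwarz.
Qed.
End BochnerCoordinates.

Lemma cvg_series_bounded (R : realType) (u : nat -> R) (K : R) :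
  (forall i, 0 <= u i) -> (forall n, \sum_(0 <= i < n) u i <= K) -> cvgn (series u).
Proof.
move=> u0 uK; apply: nondecreasing_is_cvgn.
  exact: nondecreasing_series.
by exists K => _ [n _ <-]; exact: uK.
Qed.

(** * Orthogonal sequences and Gram-Schmidt *)

Section OrthogonalSequences.
Variables (R : realType) (H : completeNormedModType R).
Variable ip : {dot H for idfun}.
Hypothesis ipn : norm_induced_by ip.
Implicit Types (x y u v : H) (e : nat -> H) (T : H -> H).

(* Zero vectors are allowed, so that a finite orthonormal family is covered. *)
Definition orthoseq e :=
  (forall i, ip (e i) (e i) = 1 \/ e i = 0) /\
  forall i j, i != j -> ip (e i) (e j) = 0.

Definition total e := forall x, (forall i, ip (e i) x = 0) -> x = 0.

Definition fproj e k x := \sum_(0 <= i < k) ip (e i) x *: e i.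

Lemma orthoseq_sqr_le1 e i : orthoseq e -> 0 <= ip (e i) (e i) <= 1.
Proof. by move=> [ue _]; rewrite ip_ge0//=; case: (ue i) => ->; rewrite ?ip0l. Qed.

(** Takes care of the zero vectors: either the squared norm is 1 or the coefficient vanishes. *)
Lemma orthoseq_absorb e i x : orthoseq e -> ip (e i) x * ip (e i) (e i) = ip (e i) x.
Proof. by move=> [ue _]; case: (ue i) => ->; rewrite ?mulr1// !ip0l mulr0. Qed.

Lemma orthoseq_ip_sum e (r : seq nat) (a : nat -> R) j : orthoseq e -> uniq r ->
  ip (e j) (\sum_(i <- r) a i *: e i) = (j \in r)%:R * (a j * ip (e j) (e j)).
Proof.
move=> [_ oe] ur; rewrite ip_sumr; case: (boolP (j \in r)) => jr.
  rewrite (bigD1_seq j)//= ipZr mul1r big1 ?addr0// => i ij.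
  by rewrite ipZr oe ?mulr0// eq_sym.
rewrite mul0r big_seq big1// => i ir; rewrite ipZr oe ?mulr0//.
by apply: contraNneq jr => ->.
Qed.

Lemma orthoseq_sum_sqr e (r : seq nat) (a b : nat -> R) : orthoseq e -> uniq r ->
  ip (\sum_(i <- r) a i *: e i) (\sum_(i <- r) b i *: e i) =
  \sum_(i <- r) a i * b i * ip (e i) (e i).
Proof.
move=> oe ur; rewrite ip_suml !big_seq; apply: eq_bigr => i ir.
by rewrite ipZl -big_seq orthoseq_ip_sum// ir mul1r mulrA.
Qed.

Lemma orthoseq_sum_norm_le e (r : seq nat) (a : nat -> R) : orthoseq e -> uniq r ->
  `|\sum_(i <- r) a i *: e i| ^+ 2 <= \sum_(i <- r) a i ^+ 2.
Proof.
move=> oe ur; rewrite -ipn orthoseq_sum_sqr//; apply: ler_sum => i _.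
by rewrite -expr2 ler_piMr ?sqr_ge0//; case/andP: (orthoseq_sqr_le1 i oe).
Qed.

Lemma cvg_orthoseq_series e (a : nat -> R) (K : R) : orthoseq e ->
  (forall n, \sum_(0 <= i < n) a i ^+ 2 <= K) ->
  cvgn (series (fun i => a i *: e i)).
Proof.
move=> oe aK; apply/cauchy_cvgP/cauchy_seriesP => eps eps0.
have /cauchy_cvgP/cauchy_seriesP/(_ (eps ^+ 2)) :=
  cvg_series_bounded (fun i => sqr_ge0 (a i)) aK.
rewrite exprn_gt0// => /(_ isT); apply: filterS => n.
rewrite ger0_norm; last by rewrite sumr_ge0// => i _; exact: sqr_ge0.
move=> h; rewrite -(ltr_pXn2r (_ : 0 < 2)%N) ?nnegrE ?(ltW eps0)//.
by apply: le_lt_trans h; apply: orthoseq_sum_norm_le => //; exact: iota_uniq.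
Qed.

Lemma ip_fproj e k x j : orthoseq e ->
  ip (e j) (fproj e k x) = (j < k)%N%:R * ip (e j) x.
Proof.
move=> oe; rewrite orthoseq_ip_sum ?iota_uniq// mem_index_iota/=.
by rewrite orthoseq_absorb.
Qed.

Lemma fproj_sqr e k x : orthoseq e ->
  ip (fproj e k x) (fproj e k x) = \sum_(0 <= i < k) ip (e i) x ^+ 2.
Proof.
move=> oe; rewrite orthoseq_sum_sqr ?iota_uniq//; apply: eq_bigr => i _.
by rewrite -mulrA orthoseq_absorb.
Qed.

Lemma ip_fproj_self e k x :
  ip x (fproj e k x) = \sum_(0 <= i < k) ip (e i) x ^+ 2.
Proof.
rewrite /fproj ip_sumr; apply: eq_bigr => i _.
by rewrite ipZr (ipC ip x) expr2.
Qed.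

Lemma bessel e k x : orthoseq e -> \sum_(0 <= i < k) ip (e i) x ^+ 2 <= ip x x.
Proof.
move=> oe; have := ip_ge0 ipn (x - fproj e k x).
rewrite ipBl !ipBr (ipC ip (fproj e k x) x) fproj_sqr// ip_fproj_self; lra.
Qed.

(** Bessel's inequality makes the projections converge; the limit has the coordinates of x, and
    totality identifies it with x. *)
Lemma fproj_cvg e x : orthoseq e -> total e -> (fun k => fproj e k x) @ \oo --> x.
Proof.
move=> oe te.
have cf : cvgn (series (fun i => ip (e i) x *: e i)).
  exact: cvg_orthoseq_series (fun n => bessel n x oe).
suff lx : limn (series (fun i => ip (e i) x *: e i)) = x.
  by rewrite -[X in _ --> X]lx; exact: cf.
apply/eqP; rewrite eq_sym -subr_eq0; apply/eqP/te => j; rewrite ipBr.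
have h : (fun k => ip (e j) (fproj e k x)) @ \oo -->
    ip (e j) (limn (series (fun i => ip (e i) x *: e i))).
  exact: (continuous_cvg _ (@ip_continuous _ _ _ ipn (e j) _) cf).
have h' : (fun k => ip (e j) (fproj e k x)) @ \oo --> ip (e j) x.
  apply: cvg_near_cst; exists j.+1 => // k /= jk.
  by rewrite ip_fproj// jk mul1r.
by rewrite (cvg_unique (@Rhausdorff R) h h') subrr.
Qed.

Lemma parseval e x : orthoseq e -> total e ->
  (fun k => \sum_(0 <= i < k) ip (e i) x ^+ 2) @ \oo --> ip x x.
Proof.
move=> oe te; have -> : (fun k => \sum_(0 <= i < k) ip (e i) x ^+ 2) =
    (fun k => ip x (fproj e k x)) by apply/funext => k; rewrite ip_fproj_self.
exact: (continuous_cvg _ (@ip_continuous _ _ _ ipn x _) (fproj_cvg oe te)).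
Qed.

Section GramSchmidt.
Variable dn : nat -> H.

(** Recursion on the projections instead of the vectors keeps the definition structural: the next
    vector needs only the previous projection. A vanishing remainder yields the vector 0. *)
Fixpoint gs_proj n : H -> H := if n is n'.+1 then
    let v := dn n' - gs_proj n' (dn n') in
    fun x => gs_proj n' x + ip (`|v|^-1 *: v) x *: (`|v|^-1 *: v)
  else fun=> 0.

Definition gs_seq n := let v := dn n - gs_proj n (dn n) in `|v|^-1 *: v.

Lemma gs_projE n x : gs_proj n x = fproj gs_seq n x.
Proof.
elim: n => [|n IHn]; first by rewrite /fproj big_geq.
by rewrite /fproj big_nat_recr//= -/(fproj _ _ _) IHn.
Qed.

Lemma gs_seqE n : dn n = `|dn n - fproj gs_seq n (dn n)| *: gs_seq n +
  fproj gs_seq n (dn n).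
Proof.
rewrite /gs_seq gs_projE; set v := _ - _.
have -> : `|v| *: (`|v|^-1 *: v) = v.
  have [->|v0] := eqVneq v 0; first by rewrite !scaler0.
  by rewrite scalerA divff ?scale1r ?normr_eq0.
by rewrite /v subrK.
Qed.

Lemma gs_seq_norm n : ip (gs_seq n) (gs_seq n) = 1 \/ gs_seq n = 0.
Proof.
rewrite /gs_seq; set v := _ - _.
have [->|v0] := eqVneq v 0; [by right; rewrite scaler0|left].
by rewrite ipZl ipZr ipn; field; rewrite normr_eq0.
Qed.

Lemma gs_seq_ortho_lt n i : (i < n)%N -> ip (gs_seq i) (gs_seq n) = 0.
Proof.
elim/ltn_ind: n i => n IHn i lin.
rewrite [gs_seq n]/gs_seq gs_projE ipZr ipBr.
suff -> : ip (gs_seq i) (fproj gs_seq n (dn n)) = ip (gs_seq i) (dn n).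
  by rewrite subrr mulr0.
rewrite /fproj ip_sumr (bigD1_seq i) ?iota_uniq ?mem_index_iota//=.
rewrite ipZr big_seq_cond big1 ?addr0.
  by case: (gs_seq_norm i) => ->; rewrite ?mulr1// !ip0l mulr0.
move=> j /andP[]; rewrite mem_index_iota/= => ljn ji; rewrite ipZr.
have [h|h|h] := ltngtP i j; last by rewrite h eqxx in ji.
- by rewrite (IHn j) ?mulr0.
- by rewrite ipC (IHn i) ?mulr0.
Qed.

Lemma gs_orthoseq : orthoseq gs_seq.
Proof.
split=> [i|i j ij]; first exact: gs_seq_norm.
have [h|h|h] := ltngtP i j; last by rewrite h eqxx in ij.
- exact: gs_seq_ortho_lt.
- by rewrite ipC gs_seq_ortho_lt.
Qed.

Lemma gs_seq_span x n : (forall i, ip (gs_seq i) x = 0) -> ip (dn n) x = 0.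
Proof.
move=> h; rewrite gs_seqE ipDl ipZl h mulr0 add0r /fproj ip_suml big1// => i _.
by rewrite ipZl h mulr0.
Qed.
End GramSchmidt.

Lemma separable_total_orthoseq : separable H -> exists e, orthoseq e /\ total e.
Proof.
move=> [D [/countable_injP[f fi] dD]].
(* Inverts the injection of D into the naturals; indices outside its image give the harmless value
   0. *)
pose dn n := match pselect (exists x, D x /\ f x = n) with
  | left ex => projT1 (cid ex) | right _ => 0 end.
exists (gs_seq dn); split; first exact: gs_orthoseq.
move=> x hx; apply/eqP/negPn/negP => x0.
(* A point y of D closer to x than |x| / 2 is orthogonal to x, so |x|^2 = <x - y, x> would be at
   most half of itself. *)
have nx : 0 < `|x| / 2 by rewrite divr_gt0 ?normr_gt0.
have [|y [/= By Dy]] := dD (ball x (`|x| / 2)) _ (ball_open x (`|x| / 2)).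
  by exists x; exact: ballxx.
have dy : dn (f y) = y.
  rewrite /dn; case: pselect => [ex|]; last by case; exists y.
  by case: cid => z [Dz fz] /=; apply: fi => //; rewrite inE.
have h : ip x x = ip (x - y) x by rewrite ipBl -dy gs_seq_span// subr0.
have := ip_CauchySchwarz ipn (x - y) x; rewrite -h ipn.
rewrite ger0_norm ?sqr_ge0// expr2 ler_pM2r ?normr_gt0//.
move: By; rewrite -ball_normE/= => By.
by apply/negP; rewrite -ltNge; lra.
Qed.

(** Bases are sets in the definition of trace class; the nonzero vectors of the sequence form one,
    and the zero vectors add nothing to the trace. *)
Lemma trace_class_bounded_trace e T : orthoseq e -> total e ->
  positive_trace_class ip T ->
  exists K, forall n, \sum_(0 <= i < n) ip (e i) (T (e i)) <= K.
Proof.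
move=> oe te [[_ _ _ pT] trT].
pose I := [set i | e i != 0].
pose B := e @` I.
have bB : orthonormal_basis ip B.
  split.
  - by move=> _ [i /= ei <-]; case: (oe.1 i) => // e0; move: ei; rewrite /I/= e0 eqxx.
  - move=> _ _ [i /= ei <-] [j /= ej <-] eij; apply: oe.2.
    by apply: contraNneq eij => ->.
  - move=> x hx; apply: te => i; have [->|ei] := eqVneq (e i) 0; first by rewrite ip0l.
    by apply: hx; exists i.
have bij : set_bij I B e.
  split=> //; first by move=> i Ii; exists i.
  move=> i j; rewrite !inE => /= ei ej eij; apply/eqP/negPn/negP => ij.
  have := oe.2 _ _ ij; rewrite eij => h; have := ip_eq0 ipn h => e0.
  by move: ej; rewrite /I/= e0 eqxx.
have := trT _ bB.
rewrite (reindex_esum I B e)//.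
rewrite -nneseries_esum; last by move=> i _; rewrite lee_fin.
set s := (\sum_(_ <oo | _) _)%E => sfin.
have s0 : (0 <= s)%E by apply: nneseries_ge0 => i _ _; rewrite lee_fin.
exists (fine s) => n; rewrite -lee_fin fineK ?ge0_fin_numE//.
rewrite -sumEFin; apply: le_trans (nneseries_lim_ge n _); last first.
  by move=> i _ _; rewrite lee_fin.
rewrite big_mkcond [leRHS]big_mkcond; apply: lee_sum => i _.
case: ifPn => //; rewrite negbK => /eqP ->.
by rewrite ip0l.
Qed.
End OrthogonalSequences.

(** * Iterates of a positive contraction *)

Section SpectralTheorem.
Variables (R : realType) (H : completeNormedModType R).
Variable ip : {dot H for idfun}.
Hypothesis ipn : norm_induced_by ip.
Implicit Types (x y u v f : H) (T A : H -> H).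

Lemma lin_sum T (I : Type) (r : seq I) (a : I -> R) (g : I -> H) : linear T ->
  T (\sum_(i <- r) a i *: g i) = \sum_(i <- r) a i *: T (g i).
Proof.
move=> lT; elim: r => [|i r IHr]; last by rewrite !big_cons lT IHr.
have := lT (-1) 0 0; rewrite !big_nil scaler0 addr0 scaleN1r => ->.
by rewrite addNr.
Qed.

Lemma lin0 T : linear T -> T 0 = 0.
Proof.
by move=> lT; have := lT (-1) 0 0; rewrite scaler0 addr0 scaleN1r addNr.
Qed.

Lemma linZ T a x : linear T -> T (a *: x) = a *: T x.
Proof. by move=> lT; have := lT a x 0; rewrite (lin0 lT) !addr0. Qed.

Lemma linB T x y : linear T -> T (x - y) = T x - T y.
Proof. by move=> lT; rewrite -scaleN1r addrC lT scaleN1r addrC. Qed.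

Lemma positive_operatorZ T a : 0 <= a -> positive_operator ip T ->
  positive_operator ip (fun x => a *: T x).
Proof.
move=> a0 [lT cT sT pT]; split.
- by move=> b u v /=; rewrite lT scalerDr !scalerA mulrC.
- by move=> x; apply: cvgZr => //; exact: cT.
- by move=> u v; rewrite ipZl ipZr sT.
- by move=> u; rewrite ipZr mulr_ge0.
Qed.

Section Iterates.
Variable A : H -> H.
Hypothesis pA : positive_operator ip A.

Let moment n x := ip x (iter n A x).

Lemma iter_sym n u v : ip (iter n A u) v = ip u (iter n A v).
Proof. by case: pA => _ _ sA _; elim: n u v => // n IHn u v; rewrite iterSr IHn sA. Qed.

Lemma moment_double m x : moment (m + m) x = ip (iter m A x) (iter m A x).
Proof. by rewrite /moment iterD iter_sym. Qed.

Lemma moment_doubleS m x : moment (m + m).+1 x = ip (iter m A x) (A (iter m A x)).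
Proof. by rewrite /moment -addnS iterD iter_sym. Qed.

Lemma moment_doubleSS m x : moment (m + m).+2 x =
  ip (A (iter m A x)) (A (iter m A x)).
Proof. by rewrite -[RHS](moment_double m.+1) addSn addnS. Qed.

Lemma moment_doubleSSS m x : moment (m + m).+3 x =
  ip (A (iter m A x)) (A (A (iter m A x))).
Proof. by rewrite -[RHS](moment_doubleS m.+1) addSn addnS. Qed.

Lemma double_cases (Q : nat -> Prop) :
  (forall m, Q (m + m)%N) -> (forall m, Q (m + m).+1) -> forall n, Q n.
Proof.
move=> h0 h1 n; rewrite -(odd_double_half n) -addnn.
by case: (odd n); [exact: h1|exact: h0].
Qed.

Lemma moment_ge0 n x : 0 <= moment n x.
Proof.
elim/double_cases: n => m; first by rewrite moment_double ip_ge0.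
by rewrite moment_doubleS; case: pA => _ _ _; apply.
Qed.

Lemma positive_operator_iter n : positive_operator ip (iter n A).
Proof.
case: pA => lA cA sA _; split; last by move=> u; exact: moment_ge0.
- by elim: n => // n IHn a u v /=; rewrite IHn lA.
- elim: n => [x|n IHn x]; first exact: cvg_id.
  by apply: continuous_comp; [exact: IHn|exact: cA].
- by move=> u v; exact: iter_sym.
Qed.

(** Cauchy-Schwarz for the identity or for A, according to the parity of n. *)
Lemma moment_log_convex n x : moment n.+1 x ^+ 2 <= moment n x * moment n.+2 x.
Proof.
elim/double_cases: n => m.
  rewrite moment_double moment_doubleS moment_doubleSS.
  exact: ip_CauchySchwarz_sqr.
rewrite moment_doubleS moment_doubleSS moment_doubleSSS.
have [_ _ sA _] := pA.
by rewrite sA; exact: positive_operator_CauchySchwarz.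
Qed.

(** By log-convexity the ratios of successive moments increase, starting from a ratio at least
    [moment 1 x] since <x, x> <= 1. The exponent 0 is set apart because [moment 0 x] may be less
    than 1. *)
Lemma moment_submul n x : ip x x <= 1 -> (forall k, moment k.+1 x <= moment k x) ->
  moment 1 x ^+ n <= moment n x \/ n = 0%N.
Proof.
move=> x1 dec.
have step k : moment 1 x * moment k x <= moment k.+1 x.
  elim: k => [|k IHk]; first by rewrite ler_piMr// moment_ge0.
  have [m0|m0] := eqVneq (moment k x) 0.
    have -> : moment k.+1 x = 0.
      by apply/eqP; rewrite eq_le moment_ge0 andbT -m0 dec.
    by rewrite mulr0 moment_ge0.
  have mk : 0 < moment k x by rewrite lt_neqAle eq_sym m0 moment_ge0.
  rewrite -(ler_pM2l mk); apply: le_trans (moment_log_convex k x).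
  have -> : moment k x * (moment 1 x * moment k.+1 x) =
    moment k.+1 x * (moment 1 x * moment k x) by ring.
  by rewrite expr2 ler_wpM2l ?moment_ge0.
case: n => [|n]; [by right|left].
elim: n => [|n IHn]; first by rewrite expr1.
rewrite exprS; apply: le_trans (step n.+1); rewrite ler_wpM2l ?moment_ge0//.
Qed.

Section Contraction.
Hypothesis A1 : forall x, ip x (A x) <= ip x x.

Lemma contraction_sqr x : ip (A x) (A x) <= ip x (A x).
Proof.
have [_ _ _ p0] := pA.
have [h|h] := eqVneq (ip (A x) (A x)) 0; first by rewrite h p0.
have hp : 0 < ip (A x) (A x) by rewrite lt_neqAle eq_sym h ip_ge0.
rewrite -(ler_pM2l hp) -expr2.
apply: le_trans (positive_operator_CauchySchwarz (A x) x pA) _.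
by rewrite ler_wpM2r.
Qed.

Lemma moment_dec n x : moment n.+1 x <= moment n x.
Proof.
elim/double_cases: n => m; first by rewrite moment_double moment_doubleS.
by rewrite moment_doubleS moment_doubleSS contraction_sqr.
Qed.

Lemma moment_nonincreasing x : nonincreasing_seq (moment ^~ x).
Proof. by apply/nonincreasing_seqP => n; exact: moment_dec. Qed.

(** The squared distance of two iterates is a combination of the moments of orders 2 N, N + m and 2
    m, and the moments decrease to a limit. *)
Lemma iter_cvg x : cvgn (fun n => iter n A x).
Proof.
have cm : cvgn (moment ^~ x).
  apply: nonincreasing_is_cvgn; first exact: moment_nonincreasing.
  by exists 0 => _ [n _ <-]; exact: moment_ge0.
set l := limn (moment ^~ x).
have ml n : l <= moment n x by apply: nonincreasing_cvgn_ge => //; exact: moment_nonincreasing.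
apply/cauchy_cvgP; apply: cauchy_exP => e e0.
have e2 : 0 < e ^+ 2 / 2 by rewrite divr_gt0// exprn_gt0.
have /cvgrPdist_lt/(_ _ e2)[N _ hN] := cm.
have hm n : (N <= n)%N -> moment (n + n) x < l + e ^+ 2 / 2.
  move=> Nn; have := hN (n + n)%N (leq_trans Nn (leq_addr _ _)).
  by rewrite -/l ltr_norml => /andP[+ _]; lra.
exists (iter N A x); exists N => // m /= Nm; have Nn := leqnn N.
rewrite -ball_normE/=.
rewrite -(ltr_pXn2r (_ : 0 < 2)%N) ?nnegrE ?(ltW e0)// (normB_sqr ipn) -!ipn.
rewrite -!moment_double.
have -> : ip (iter N A x) (iter m A x) = moment (N + m) x.
  by rewrite /moment iter_sym iterD.
have := hm N Nn; have := hm m Nm; have := ml (N + m)%N; lra.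
Qed.

Lemma iter_lim_fixed x : A (limn (fun n => iter n A x)) = limn (fun n => iter n A x).
Proof.
set y := limn _; have [_ cA _ _] := pA.
have c1 : (fun n => iter n A x) @ \oo --> y by exact: iter_cvg.
have c2 : (fun n => A (iter n A x)) @ \oo --> A y.
  exact: (continuous_cvg _ (cA y) c1).
have c3 : (fun n => iter n.+1 A x) @ \oo --> y by rewrite (cvg_shiftS (fun n => iter n A x)).
exact: (cvg_unique (@norm_hausdorff _ H) c2 c3).
Qed.
End Contraction.
End Iterates.
End SpectralTheorem.

Lemma cvg_sum_nat (R : realType) (u : nat -> nat -> R) (a : nat -> R) k :
  (forall i, u i @ \oo --> a i) ->
  (fun n => \sum_(0 <= i < k) u i n) @ \oo --> \sum_(0 <= i < k) a i.
Proof.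
move=> ua; elim: k => [|k IHk].
  by rewrite big_geq//; under eq_fun do rewrite big_geq//; exact: cvg_cst.
rewrite big_nat_recr//=; under eq_fun do rewrite big_nat_recr//=.
by apply: cvgD.
Qed.

(** * Spectral decomposition by deflation *)

Section SpectralDecomposition.
Variables (R : realType) (H : completeNormedModType R).
Variable ip : {dot H for idfun}.
Hypothesis ipn : norm_induced_by ip.
Variable e : nat -> H.
Hypotheses (oe : orthoseq ip e) (te : total ip e).
Implicit Types (x y u v f : H) (T A : H -> H).

(** The trace bounds the norm: on projections, the entry (i, j) is at most the geometric mean of the
    diagonal entries, and the arithmetic-geometric inequality decouples the double sum. *)
Lemma quad_trace_bound T K : positive_operator ip T ->
  (forall n, \sum_(0 <= i < n) ip (e i) (T (e i)) <= K) ->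
  forall x, ip x (T x) <= K * ip x x.
Proof.
move=> pT trK x; have [lT cT sT p0] := pT.
have yx : (fun k => fproj ip e k x) @ \oo --> x by exact: fproj_cvg.
have h1 : (fun k => ip (fproj ip e k x) (T (fproj ip e k x))) @ \oo --> ip x (T x).
  by apply: (cvg_ip ipn) => //; exact: (continuous_cvg _ (cT x) yx).
rewrite -(cvg_lim (@Rhausdorff R) h1).
apply: limr_le; first by apply/cvg_ex; eexists; exact: h1.
apply: nearW => k.
have K0 : 0 <= K by have := trK 0%N; rewrite big_geq.
apply: le_trans (_ : K * (\sum_(0 <= i < k) ip (e i) x ^+ 2) <= _); last first.
  by rewrite ler_wpM2l// bessel.
apply: le_trans (_ : (\sum_(0 <= i < k) ip (e i) (T (e i))) *
    (\sum_(0 <= i < k) ip (e i) x ^+ 2) <= _); last first.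
  by rewrite ler_wpM2r// sumr_ge0// => i _; exact: sqr_ge0.
rewrite /fproj (lin_sum _ _ _ lT) ip_suml.
set c := fun i => ip (e i) x; set a := fun i => ip (e i) (T (e i)).
have term i j : c i * (c j * ip (e i) (T (e j))) <= (c i ^+ 2 * a j + c j ^+ 2 * a i) / 2.
  have CS := positive_operator_CauchySchwarz (e i) (e j) pT; rewrite -/(a i) -/(a j) in CS.
  have ai : 0 <= a i by exact: p0.
  have aj : 0 <= a j by exact: p0.
  apply: le_trans (ler_norm _) _.
  rewrite -(ler_pXn2r (_ : 0 < 2)%N) ?nnegrE//; last first.
    by rewrite divr_ge0// addr_ge0// mulr_ge0// sqr_ge0.
  rewrite real_normK ?num_real//.
  apply: (@le_trans _ _ (c i ^+ 2 * c j ^+ 2 * (a i * a j))).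
    by rewrite !exprMn mulrA ler_wpM2l// mulr_ge0 ?sqr_ge0.
  rewrite -subr_ge0.
  have -> : ((c i ^+ 2 * a j + c j ^+ 2 * a i) / 2) ^+ 2 - c i ^+ 2 * c j ^+ 2 * (a i * a j) =
    ((c i ^+ 2 * a j - c j ^+ 2 * a i) / 2) ^+ 2 by field.
  exact: sqr_ge0.
apply: (@le_trans _ _ (\sum_(0 <= i < k) \sum_(0 <= j < k)
    (c i ^+ 2 * a j + c j ^+ 2 * a i) / 2)).
  apply: ler_sum => i _; rewrite ipZl ip_sumr mulr_sumr; apply: ler_sum => j _.
  by rewrite ipZr; exact: term.
rewrite le_eqVlt; apply/orP; left; apply/eqP.
under eq_bigr do rewrite -mulr_suml big_split/= -mulr_sumr -mulr_suml.
rewrite -mulr_suml big_split/= -mulr_suml -mulr_sumr.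
by rewrite -/(\sum_(0 <= i < k) a i); field.
Qed.

Definition finite_trace T := positive_operator ip T /\
  exists K, forall n, \sum_(0 <= i < n) ip (e i) (T (e i)) <= K.

Lemma bernoulli_ge (q : R) n : 0 <= q <= 1 -> 1 - n%:R * q <= (1 - q) ^+ n.
Proof.
move=> /andP[q0 q1]; elim: n => [|n IHn]; first by rewrite mul0r subr0 expr0.
rewrite exprS; have := ler_wpM2l (_ : 0 <= 1 - q) IHn; rewrite subr_ge0 => /(_ q1).
have : 0 <= n%:R * (q * q) by rewrite mulr_ge0 ?mulr_ge0.
rewrite -natr1; lra.
Qed.

(* If every iterate A^n (e i) tended to 0, the traces of A^n would tend to 0,
   by domination, although A^n has norm 1. *)
Lemma contraction_fixed_vector A : finite_trace A ->
  (forall x, ip x (A x) <= ip x x) ->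
  (forall q, q < 1 -> exists x, ip x x <= 1 /\ q < ip x (A x)) ->
  exists y, y != 0 /\ A y = y.
Proof.
move=> [pA [K trK]] A1 supA.
have [hex|hno] := pselect (exists i, limn (fun n => iter n A (e i)) != 0).
  by case: hex => i hi; exists (limn (fun n => iter n A (e i))); split=> //; exact: iter_lim_fixed.
exfalso.
have l0 i : (fun n => ip (e i) (iter n A (e i))) @ \oo --> (0 : R).
  have y0 : limn (fun n => iter n A (e i)) = 0.
    by apply/eqP/negPn/negP => h; apply: hno; exists i.
  have ci : (fun n => iter n A (e i)) @ \oo --> limn (fun n => iter n A (e i)).
    exact: (@iter_cvg _ _ _ ipn _ pA A1 (e i)).
  have := continuous_cvg _ (@ip_continuous _ _ _ ipn (e i) _) ci.
  rewrite y0 ip0r => h; exact: h.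
have [_ _ _ p0] := pA.
have ct : cvgn (series (fun i => ip (e i) (A (e i)))).
  exact: cvg_series_bounded trK.
have /cauchy_cvgP/cauchy_seriesP/(_ (4^-1)) := ct.
rewrite invr_gt0 ltr0n => /(_ isT)[[N1 N2]] /= [[k1 _ hk1] [k2 _ hk2]] hN.
pose k := maxn k1 k2.
(* Beyond some k the trace of A leaves at most 1/4; the powers of A have still smaller diagonal
   entries, so this holds for all of them at once. *)
have tail m : \sum_(k <= i < m) ip (e i) (A (e i)) <= 4^-1.
  have [km|mk] := leqP k m; last by rewrite big_geq ?invr_ge0// ltnW.
  have := hN (k, m); rewrite ger0_norm /=; last by rewrite sumr_ge0.
  move=> h; apply/ltW/h; split.
    by apply: hk1; rewrite /= /k leq_maxl.
  by apply: hk2; rewrite /= (leq_trans _ km)// leq_maxr.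
have head : (fun n => \sum_(0 <= i < k) ip (e i) (iter n A (e i))) @ \oo --> (0 : R).
  have := @cvg_sum_nat _ (fun i n => ip (e i) (iter n A (e i))) (fun=> 0) k l0.
  by rewrite big1.
have /cvgrPdist_lt/(_ (4^-1)) := head.
rewrite invr_gt0 ltr0n => /(_ isT)[N _ hN'].
(* A positive exponent: the comparison of A^n with A and [moment_submul] both need it. *)
pose n := N.+1.
have hn : \sum_(0 <= i < k) ip (e i) (iter n A (e i)) <= 4^-1.
  have := hN' n (leqnSn N); rewrite /= sub0r normrN => /ltW; apply: le_trans.
  exact: ler_norm.
have trn m : \sum_(0 <= i < m) ip (e i) (iter n A (e i)) <= 2^-1.
  have dec i : ip (e i) (iter n A (e i)) <= ip (e i) (A (e i)).
    have := @moment_nonincreasing _ _ _ ipn _ pA A1 (e i) 1%N n isT.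
    by [].
  have mp i : 0 <= ip (e i) (iter n A (e i)) by exact: moment_ge0.
  apply: (@le_trans _ _ (\sum_(0 <= i < k + m) ip (e i) (iter n A (e i)))).
    rewrite [leRHS](@big_cat_nat _ _ _ m) ?leq_addl//= lerDl.
    by rewrite sumr_ge0.
  rewrite (@big_cat_nat _ _ _ k) ?leq_addr//=.
  apply: (@le_trans _ _ (4^-1 + 4^-1)); last by lra.
  apply: lerD => //; apply: le_trans (tail (k + m)%N).
  by apply: ler_sum.
have half x : ip x (iter n A x) <= 2^-1 * ip x x.
  by apply: quad_trace_bound => //; exact: positive_operator_iter.
have n0 : 0 < n%:R :> R by rewrite ltr0n.
have n1 : 1 <= n%:R :> R by rewrite ler1n.
(* Chosen so that q ^+ n >= 1/2 by Bernoulli, whereas the form of A^n is at most 1/2 on the unit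
   ball. *)
pose q : R := 1 - (2 * n%:R)^-1.
have q1 : q < 1 by rewrite /q gtrBl invr_gt0 mulr_gt0.
have i01 : 0 <= (2 * n%:R)^-1 :> R /\ (2 * n%:R)^-1 <= 1 :> R.
  by split; [rewrite invr_ge0; lra | rewrite invf_le1; lra].
have [x [x1 qx]] := supA _ q1.
have := moment_submul ipn pA n x1 (fun k => moment_dec ipn pA A1 k x).
case=> // h.
have q0 : 0 <= q by rewrite /q; case: i01; lra.
have : q ^+ n < ip x (A x) ^+ n by rewrite ltr_pXn2r ?nnegrE// (le_trans q0 (ltW qx)).
have := @bernoulli_ge (2 * n%:R)^-1 n _.
case: i01 => -> ->; rewrite -/q => /(_ isT).
have -> : n%:R * (2 * n%:R)^-1 = 2^-1 :> R by field; rewrite gt_eqF.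
have := half x; move: h => /=; lra.
Qed.

(** For s the supremum of the form over the unit ball, T / s is a positive contraction to which
    [contraction_fixed_vector] applies. The alternative with mu = 0 and f = 0 lets deflation
    continue after the rank is exhausted. *)
Lemma top_eigenvector T : finite_trace T -> exists (f : H) (mu : R),
  [/\ T f = mu *: f, forall x, ip x (T x) <= mu * ip x x &
      (0 < mu /\ ip f f = 1) \/ (mu = 0 /\ f = 0)].
Proof.
move=> tT; have [pT [K trK]] := tT; have [lT cT sT p0] := pT.
pose Q := [set q | exists x, ip x x <= 1 /\ q = ip x (T x)].
have Q0 : Q 0 by exists 0; rewrite ip0l; split=> //; rewrite ip0l.
have K0 : 0 <= K by have := trK 0%N; rewrite big_geq.
have ubQ : has_sup Q.
  split; first by exists 0.
  exists K => _ [x [x1 ->]]; apply: le_trans (quad_trace_bound pT trK x) _.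
  by rewrite ler_piMr.
set s := sup Q.
have s0 : 0 <= s by apply: sup_upper_bound.
have Ts x : ip x (T x) <= s * ip x x.
  have [x0|x0] := eqVneq (ip x x) 0.
    by rewrite (ip_eq0 ipn x0) !ip0l mulr0.
  have xp : 0 < ip x x by rewrite lt_neqAle eq_sym x0 ip_ge0.
  pose c := `|x|^-1.
  have c2 : c * c = (ip x x)^-1 by rewrite ipn /c expr2 invfM.
  have : ip (c *: x) (T (c *: x)) <= s.
    apply: sup_upper_bound => //; exists (c *: x); split=> //.
    by rewrite ipZl ipZr mulrA c2 mulVf.
  by rewrite (linZ _ _ lT) ipZl ipZr mulrA c2 mulrC ler_pdivrMr.
have [sE|sn0] := eqVneq s 0.
  exists 0, 0; split; [by rewrite (lin0 lT) scaler0| |by right].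
  by move=> x; rewrite -sE.
have sp : 0 < s by rewrite lt_neqAle eq_sym sn0.
have [y [y0 Ay]] : exists y, y != 0 /\ s^-1 *: T y = y.
  apply: (@contraction_fixed_vector (fun x => s^-1 *: T x)).
  - split; first by apply: positive_operatorZ; rewrite // invr_ge0.
    exists (s^-1 * K) => n; under eq_bigr do rewrite ipZr.
    by rewrite -mulr_sumr ler_wpM2l// invr_ge0.
  - by move=> x; rewrite ipZr mulrC ler_pdivrMr// mulrC.
  - move=> q q1.
    have : q * s < s by rewrite -[ltRHS]mul1r ltr_pM2r.
    move=> /(sup_gt (proj1 ubQ))[_ [x [x1 ->]] qx]; exists x; split=> //.
    by rewrite ipZr mulrC ltr_pdivlMr.
have ny : `|y| != 0 by rewrite normr_eq0.
exists (`|y|^-1 *: y), s; split=> //; last first.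
  by left; split=> //; rewrite ipZl ipZr ipn; field.
have Ty : T y = s *: y by rewrite -[in RHS]Ay scalerA divff// scale1r.
by rewrite (linZ _ _ lT) Ty !scalerA mulrC.
Qed.

Definition deflate T f mu x := T x - (mu * ip f x) *: f.

Lemma finite_trace_deflate T f mu : finite_trace T -> T f = mu *: f ->
  (0 < mu /\ ip f f = 1) \/ (mu = 0 /\ f = 0) ->
  finite_trace (deflate T f mu).
Proof.
move=> tT Tf cases; have [pT [K trK]] := tT; have [lT cT sT p0] := pT.
have mu0 : 0 <= mu by case: cases => [[/ltW//]|[->]].
have quad x : ip x (deflate T f mu x) = ip x (T x) - mu * ip f x ^+ 2.
  by rewrite /deflate ipBr ipZr (ipC ip x f); ring.
split; last first.
  exists K => n; apply: le_trans (trK n); apply: ler_sum => i _.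
  by rewrite quad gerBl mulr_ge0 ?sqr_ge0.
split.
- move=> a u v; rewrite /deflate lT ipDr ipZr mulrDr scalerDl opprD.
  rewrite addrACA scalerBr scalerA; congr (_ + _); congr (_ - _).
  by congr (_ *: _); ring.
- move=> x; apply: cvgB; first exact: cT.
  apply: cvgZl; apply: cvgMr; exact: ip_continuous.
- move=> u v; rewrite /deflate ipBl ipBr ipZl ipZr sT (ipC ip u f); ring.
- move=> x; case: cases => [[mup ff]|[-> ->]]; last first.
    by rewrite /deflate mul0r scale0r subr0.
  rewrite quad.
  have := p0 (x - ip f x *: f).
  rewrite (linB _ _ lT) (linZ _ _ lT) Tf ipBl !ipBr !ipZl !ipZr -[ip f (T x)]sT Tf.
  rewrite ipZl ff (ipC ip x f); lra.
Qed.

(** Eigenvectors for the nonzero eigenvalues; entries with eigenvalue 0 are padding and need not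
    span the kernel. *)
Record spectral T (lam : nat -> R) (f : nat -> H) : Prop := Spectral {
  spectral_ortho : orthoseq ip f;
  spectral_ge0 : forall j, 0 <= lam j;
  spectral_eigen : forall j, T (f j) = lam j *: f j;
  spectral_unit : forall j, lam j != 0 -> ip (f j) (f j) = 1;
  spectral_summable : exists K, forall n, \sum_(0 <= j < n) lam j <= K;
  spectral_cvg : forall x,
    (fun n => \sum_(0 <= j < n) (lam j * ip (f j) x) *: f j) @ \oo --> T x }.

Lemma deflation_sequence T : finite_trace T ->
  exists (D : nat -> H -> H) (f : nat -> H) (lam : nat -> R),
  [/\ D 0%N = T, forall n, finite_trace (D n),
   forall n, D n.+1 = deflate (D n) (f n) (lam n) &
   forall n, [/\ D n (f n) = lam n *: f n, forall x, ip x (D n x) <= lam n * ip x x &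
      (0 < lam n /\ ip (f n) (f n) = 1) \/ (lam n = 0 /\ f n = 0)]].
Proof.
move=> tT.
(* Choosing on the subtype lets the iteration carry the trace bound along. *)
have ch (S : {T | finite_trace T}) : exists p : H * R,
    [/\ sval S p.1 = p.2 *: p.1, forall x, ip x (sval S x) <= p.2 * ip x x &
      (0 < p.2 /\ ip p.1 p.1 = 1) \/ (p.2 = 0 /\ p.1 = 0)].
  by have [f [mu h]] := top_eigenvector (svalP S); exists (f, mu).
have [pick pickP] := choice ch.
have nextP (S : {T | finite_trace T}) :
    finite_trace (deflate (sval S) (pick S).1 (pick S).2).
  by have [h1 _ h3] := pickP S; apply: finite_trace_deflate => //; exact: svalP.
pose next S : {T | finite_trace T} := exist _ _ (nextP S).
pose st n := iter n next (exist _ T tT).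
exists (fun n => sval (st n)), (fun n => (pick (st n)).1), (fun n => (pick (st n)).2).
by split; [|move=> n; exact: svalP| |move=> n; exact: pickP].
Qed.

Lemma spectral_theorem T : finite_trace T -> exists (lam : nat -> R) (f : nat -> H), spectral T lam f.
Proof.
move=> tT; have [D [f [lam [D0 tD Dn top]]]] := deflation_sequence tT.
exists lam, f.
have [_ [K trK]] := tT.
have lam0 j : 0 <= lam j by have [_ _ [[/ltW//]|[->]]] := top j.
have DE n x : D n x = T x - \sum_(0 <= j < n) (lam j * ip (f j) x) *: f j.
  elim: n => [|n IHn]; first by rewrite D0 big_geq// subr0.
  by rewrite Dn /deflate IHn big_nat_recr//= opprD addrA.
have lD n : linear (D n) by have [[]] := tD n.
have sD n u v : ip (D n u) v = ip u (D n v) by have [[_ _ h _] _] := tD n; exact: h.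
have Dself n : D n.+1 (f n) = 0.
  have [h _ c] := top n; rewrite Dn /deflate h.
  by case: c => [[_ ->]|[-> ->]]; rewrite ?mulr1 ?subrr// !scaler0 subr0.
have DfS n i : D n (f i) = 0 -> D n.+1 (f i) = 0.
  move=> h; have [hn _ c] := top n; rewrite Dn /deflate h.
  case: c => [[lp _]|[-> ->]]; last by rewrite scaler0 subr0.
  have : lam n * ip (f n) (f i) = 0 by rewrite -ipZl -hn sD h ip0r.
  by move=> ->; rewrite scale0r subr0.
have Dz i n : (i < n)%N -> D n (f i) = 0.
  elim: n => // n IHn; rewrite ltnS leq_eqVlt => /predU1P[->//|/IHn]; exact: DfS.
have olt i n : (i < n)%N -> ip (f n) (f i) = 0.
  move=> lin; have [hn _ c] := top n.
  case: c => [[lp _]|[_ ->]]; last by rewrite ip0l.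
  have : lam n * ip (f n) (f i) = 0 by rewrite -ipZl -hn sD Dz// ip0r.
  by move/eqP; rewrite mulf_eq0 gt_eqF//= => /eqP.
have of_ : orthoseq ip f.
  split=> [i|i j ij]; first by have [_ _ [[_ ->]|[_ ->]]] := top i; [left|right].
  have [h|h|h] := ltngtP i j; last by rewrite h eqxx in ij.
  - by rewrite ipC olt.
  - exact: olt.
have un j : lam j != 0 -> ip (f j) (f j) = 1.
  by have [_ _ [[_ ->]|[-> _]]] := top j; rewrite ?eqxx.
(* Positivity of [D n] puts the truncated expansion below T on each vector of e; Parseval then
   compares the two traces. *)
have sumK n : \sum_(0 <= j < n) lam j <= K.
  have E : \sum_(0 <= j < n) lam j = \sum_(0 <= j < n) lam j * ip (f j) (f j).
    apply: eq_bigr => j _; have [->|/un ->] := eqVneq (lam j) 0; by rewrite ?mul0r ?mulr1.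
  rewrite E.
  have h : (fun k => \sum_(0 <= j < n) lam j * \sum_(0 <= i < k) ip (e i) (f j) ^+ 2)
     @ \oo --> \sum_(0 <= j < n) lam j * ip (f j) (f j).
    apply: (@cvg_sum_nat _ (fun j k => lam j * \sum_(0 <= i < k) ip (e i) (f j) ^+ 2)
      (fun j => lam j * ip (f j) (f j))) => j; apply: cvgMr; exact: parseval.
  rewrite -(cvg_lim (@Rhausdorff R) h).
  apply: limr_le; first by apply/cvg_ex; eexists; exact: h.
  apply: nearW => k; apply: le_trans (trK k).
  under eq_bigr do rewrite mulr_sumr.
  rewrite exchange_big/=; apply: ler_sum => i _.
  have [[_ _ _ pD] _] := tD n.
  have := pD (e i); rewrite DE ipBr ip_sumr subr_ge0; apply: le_trans.
  rewrite le_eqVlt; apply/orP; left; apply/eqP; apply: eq_bigr => j _.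
  by rewrite ipZr (ipC ip (f j)); ring.
have laml : lam @ \oo --> (0 : R).
  by apply: cvg_series_cvg_0; exact: cvg_series_bounded sumK.
(* f j is orthogonal to its predecessors, so T and [D j] agree on it. *)
split=> //; first by move=> j; have [<- _ _] := top j; rewrite DE big_nat big1 ?subr0// => i
  /andP[_ lij]; rewrite ipC olt// mulr0 scale0r.
  by exists K.
move=> x.
(* Cauchy-Schwarz for the form of [D n] bounds |D n x| by lam n |x|, and lam tends to 0 because it
   is summable. *)
have Dn0 : (fun n => D n x) @ \oo --> (0 : H).
  apply: norm_cvg0.
  have b : (fun n => lam n * `|x|) @ \oo --> (0 : R).
    by rewrite -[X in _ --> X](mul0r `|x|); apply: cvgMl.
  apply: (squeeze_cvgr _ (cvg_cst 0) b); apply: nearW => n; rewrite normr_ge0/=.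
  have [pD _] := tD n; have [_ hn _] := top n.
  have CS := positive_operator_CauchySchwarz (D n x) x pD.
  have [z|nz] := eqVneq (ip (D n x) (D n x)) 0.
    by rewrite (ip_eq0 ipn z) normr0 mulr_ge0.
  have zp : 0 < ip (D n x) (D n x) by rewrite lt_neqAle eq_sym nz ip_ge0.
  rewrite -(ler_pXn2r (_ : 0 < 2)%N) ?nnegrE ?mulr_ge0// exprMn -!ipn.
  rewrite -(ler_pM2l zp) -expr2; apply: le_trans CS _.
  have [_ _ _ pp] := pD.
  have -> : ip (D n x) (D n x) * (lam n ^+ 2 * ip x x) =
    (lam n * ip (D n x) (D n x)) * (lam n * ip x x) by ring.
  by apply: ler_pM.
have -> : (fun n => \sum_(0 <= j < n) (lam j * ip (f j) x) *: f j) =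
    (fun n => T x - D n x).
  by apply/funext => n; rewrite DE opprB addrC subrK.
by rewrite -[X in _ --> X]subr0; apply: cvgB => //; exact: cvg_cst.
Qed.
End SpectralDecomposition.

(** * The Fredholm determinant as a limit of spectral products *)

Section FredholmDeterminant.
Variables (R : realType) (H : completeNormedModType R).
Variable ip : {dot H for idfun}.
Hypothesis ipn : norm_induced_by ip.
Implicit Types (T : H -> H) (lam : nat -> R) (f : nat -> H).

Lemma spectral_cvg0 T lam f : spectral ip T lam f -> lam @ \oo --> (0 : R).
Proof.
move=> sT; apply: cvg_series_cvg_0; have [K lamK] := spectral_summable sT.
exact: cvg_series_bounded (spectral_ge0 sT) lamK.
Qed.

Lemma spectral_finite T lam f mu : spectral ip T lam f -> mu != 0 ->
  finite_set [set j | lam j = mu].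
Proof.
move=> sT mu0.
have m0 : 0 < `|mu| by rewrite normr_gt0.
have /cvgrPdist_lt/(_ _ m0)[N _ hN] := spectral_cvg0 sT.
apply: (sub_finite_set (B := `I_N)); last exact: finite_II.
move=> j /= lj; rewrite ltnNge; apply/negP => Nj.
by have := hN j Nj; rewrite /= sub0r normrN lj ltxx.
Qed.

Lemma spectral_orthogonal_eigenvector T lam f mu x j : positive_operator ip T ->
  spectral ip T lam f -> T x = mu *: x -> lam j != mu -> ip (f j) x = 0.
Proof.
move=> [_ _ sT _] sp Tx lm; apply/eqP.
have : lam j * ip (f j) x = mu * ip (f j) x.
  by rewrite -ipZl -(spectral_eigen sp) sT Tx ipZr.
move/eqP; rewrite -subr_eq0 -mulrBl mulf_eq0 subr_eq0 (negbTE lm)/=.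
by [].
Qed.

Lemma spectral_kernel T lam f x : spectral ip T lam f ->
  (forall j, lam j != 0 -> ip (f j) x = 0) -> T x = 0.
Proof.
move=> sp h; have := @spectral_cvg _ _ _ _ _ _ sp x.
have -> : (fun n => \sum_(0 <= j < n) (lam j * ip (f j) x) *: f j) = cst 0.
  apply/funext => n; rewrite big1// => j _.
  have [->|/h ->] := eqVneq (lam j) 0; first by rewrite mul0r scale0r.
  by rewrite mulr0 scale0r.
by move=> c; exact: (cvg_unique (@norm_hausdorff _ H) c (cvg_cst 0)).
Qed.

(** An eigenvector for mu minus its expansion in the f j with lam j = mu is orthogonal to every f j
    with nonzero eigenvalue; T kills it, and mu is nonzero. *)
Lemma spectral_eigenvalue_sequence T lam f : positive_operator ip T ->
  spectral ip T lam f -> eigenvalue_sequence T lam.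
Proof.
move=> pT sp mu mu0.
have [n cn] := spectral_finite sp mu0; exists n; split=> //.
have /card_esym/card_set_bijP[g [gf gi gs]] := cn.
have lg (i : 'I_n) : lam (g i) = mu by apply: gf; exact: ltn_ord.
have [lT _ _ _] := pT.
have og (i j : 'I_n) : ip (f (g i)) (f (g j)) = (i == j)%:R.
  have [->|ij] := eqVneq i j; first by apply: (spectral_unit sp); rewrite lg.
  apply: (spectral_ortho sp).2; apply: contra ij => /eqP h.
  by apply/eqP/val_inj; apply: gi => //; rewrite inE/=; exact: ltn_ord.
have coord (c : 'rV[R]_n) (i : 'I_n) : ip (f (g i)) (\sum_k c 0 k *: f (g k)) = c 0 i.
  rewrite ip_sumr (bigD1 i)//= ipZr og eqxx mulr1 big1 ?addr0// => k ki.
  by rewrite ipZr og eq_sym (negbTE ki) mulr0.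
exists (fun i : 'I_n => f (g i)); split.
  by move=> i; have := spectral_eigen sp (g i); rewrite lg.
move=> x Ex; exists (\row_i ip (f (g i)) x); split; last first.
  by move=> c xE; apply/rowP => i; rewrite mxE [in LHS]xE coord.
set y := \sum_i _; apply/eqP; rewrite -subr_eq0; apply/eqP.
have Ty : T (x - y) = mu *: (x - y).
  rewrite (linB _ _ lT) [T x]Ex scalerBr; congr (_ - _).
  rewrite /y (lin_sum _ _ _ lT) scaler_sumr; apply: eq_bigr => i _.
  by rewrite (spectral_eigen sp) lg scalerA mulrC -scalerA.
have T0 : T (x - y) = 0.
  apply: (spectral_kernel sp) => j _.
  have [lj|lj] := eqVneq (lam j) mu; last exact: spectral_orthogonal_eigenvector Ty lj.
  have [i ii gij] := gs j lj.
  have -> : j = g (Ordinal ii) by rewrite -gij.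
  by rewrite ipBr coord mxE subrr.
move: Ty; rewrite T0 => /esym/eqP; rewrite scaler_eq0 (negbTE mu0)/=.
by move/eqP.
Qed.

(** The two changes of coordinates compose to an identity matrix by uniqueness of coordinates, and a
    factorization of the identity of size n through size m forces n <= m. *)
Lemma has_dim_le (E : set H) n m : has_dim E n -> has_dim E m -> (n <= m)%N.
Proof.
move=> [e [Ee eb]] [e' [Ee' eb']].
have chA i : exists c : 'rV[R]_m, e i = \sum_j c 0 j *: e' j.
  by have [c [cE _]] := eb' _ (Ee i); exists c.
have chB j : exists c : 'rV[R]_n, e' j = \sum_i c 0 i *: e i.
  by have [c [cE _]] := eb _ (Ee' j); exists c.
have [A hA] := choice chA; have [B hB] := choice chB.
pose MA := \matrix_(i, j) A i 0 j; pose MB := \matrix_(j, i) B j 0 i.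
apply: (@mulmx1_min _ _ _ MA MB).
apply/row_matrixP => i.
have [c [_ cu]] := eb _ (Ee i).
have -> : row i (MA *m MB) = c.
  symmetry; apply: cu; rewrite [LHS]hA.
  under eq_bigr do rewrite hB scaler_sumr.
  rewrite exchange_big/=; apply: eq_bigr => k _; rewrite !mxE scaler_suml.
  by apply: eq_bigr => j _; rewrite scalerA !mxE.
apply: cu; rewrite (bigD1 i)//= big1 ?addr0.
  by rewrite !mxE eqxx scale1r.
by move=> k ki; rewrite !mxE eq_sym (negbTE ki) scale0r.
Qed.

Lemma prodr_uniq_le (a : nat -> R) (s : seq nat) : (forall i, 1 <= a i) -> uniq s ->
  exists N, \prod_(i <- s) a i <= \prod_(i < N) a i.
Proof.
move=> a1 us; pose N := (\max_(i <- s) i).+1; exists N.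
have sN i : i \in s -> (i < N)%N by move=> si; rewrite ltnS; exact: (@leq_bigmax_seq _ s xpredT (fun i => i) i).
have p : perm_eq [seq i <- index_iota 0 N | i \in s] s.
  apply: uniq_perm => //; first by rewrite filter_uniq// iota_uniq.
  by move=> i; rewrite mem_filter mem_index_iota/=; case: (boolP (i \in s)) => // /sN ->.
have E : \prod_(0 <= i < N | i \in s) a i = \prod_(i <- s) a i.
  by rewrite -big_filter; exact: perm_big.
rewrite -(big_mkord xpredT) [leRHS](bigID (mem s))/= E ler_peMr//.
  by apply: prodr_ge0 => i _; exact: le_trans (a1 i).
by apply: (big_ind (fun x => 1 <= x)) => // x y; exact: mulr_ege1.
Qed.

(** Equal multiplicities give a value-preserving injection on the nonzero entries. Used in both
    directions, it makes the infinite product independent of the enumeration. *)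
Lemma eigenvalue_sequence_prod_le T lam lam' : (forall j, 0 <= lam' j) ->
  eigenvalue_sequence T lam -> eigenvalue_sequence T lam' ->
  forall N, exists N', \prod_(j < N) (1 + lam j) <= \prod_(j < N') (1 + lam' j).
Proof.
move=> l0 el el' N.
have chphi mu : exists g : nat -> nat, mu != 0 ->
    set_bij [set j | lam j = mu] [set j | lam' j = mu] g.
  have [->|mu0] := eqVneq mu 0; first by exists id.
  have [n [dn cn]] := el mu mu0; have [m [dm cm]] := el' mu mu0.
  have nm : n = m by apply/eqP; rewrite eqn_leq !(has_dim_le dn dm, has_dim_le dm dn).
  have : ([set j | lam j = mu] #= [set j | lam' j = mu])%card.
    by apply: card_eq_trans cn _; rewrite nm card_esym.
  by move=> /card_set_bijP[g hg]; exists g.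
have [phi hphi] := choice chphi.
pose sg j := phi (lam j) j.
have sgl j : lam j != 0 -> lam' (sg j) = lam j.
  by move=> lj; have [h _ _] := hphi _ lj; exact: h.
have sgi i j : lam i != 0 -> lam j != 0 -> sg i = sg j -> i = j.
  move=> li lj sij; have lij : lam i = lam j by rewrite -(sgl _ li) -(sgl _ lj) sij.
  have [_ h _] := hphi _ li; apply: h; rewrite ?inE//=.
  by move: sij; rewrite /sg -lij.
pose s := [seq sg j | j <- index_iota 0 N & lam j != 0].
have us : uniq s.
  rewrite map_inj_in_uniq ?filter_uniq ?iota_uniq// => i j.
  by rewrite !mem_filter => /andP[li _] /andP[lj _]; exact: sgi.
have a1 i : 1 <= 1 + lam' i by rewrite lerDl.
have [N' hN'] := prodr_uniq_le a1 us; exists N'; apply: le_trans hN'.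
rewrite /s big_map big_filter -(big_mkord xpredT (fun j => 1 + lam j)).
rewrite [leLHS](bigID (fun j => lam j != 0))/=.
rewrite [X in _ * X]big1 ?mulr1; last by move=> j /negPn/eqP ->; rewrite addr0.
rewrite le_eqVlt; apply/orP; left; apply/eqP; apply: eq_bigr => j lj.
by rewrite sgl.
Qed.

Lemma nondecreasing_prod1D lam : (forall j, 0 <= lam j) ->
  nondecreasing_seq (fun n => \prod_(j < n) (1 + lam j)).
Proof.
move=> l0; apply/nondecreasing_seqP => n; rewrite big_ord_recr/= ler_peMr ?lerDl//.
by apply: prodr_ge0 => j _; rewrite addr_ge0.
Qed.

Lemma prod1D_le_expR lam K : (forall j, 0 <= lam j) ->
  (forall n, \sum_(0 <= j < n) lam j <= K) ->
  forall n, \prod_(j < n) (1 + lam j) <= expR K.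
Proof.
move=> l0 lK n; apply: (@le_trans _ _ (expR (\sum_(0 <= j < n) lam j))).
  rewrite big_mkord expR_sum; apply: ler_prod => j _.
  by rewrite addr_ge0//= expR_ge1Dx.
by rewrite ler_expR.
Qed.

Lemma spectral_prod_cvg T lam f : spectral ip T lam f ->
  cvgn (fun n => \prod_(j < n) (1 + lam j)).
Proof.
move=> sp; have l0 := spectral_ge0 sp; have [K lK] := spectral_summable sp.
apply: nondecreasing_is_cvgn; first exact: nondecreasing_prod1D.
by exists (expR K) => _ [n _ <-]; exact: prod1D_le_expR.
Qed.

(** The enumeration picked by [get] is unknown, but its nonzero values are eigenvalues listed in
    lam, hence positive; the two families of partial products then dominate each other. *)
Lemma fredholm_det_spectral T lam f : positive_operator ip T ->
  spectral ip T lam f ->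
  (fun n => \prod_(j < n) (1 + lam j)) @ \oo --> fredholm_det T.
Proof.
move=> pT sp; have l0 := spectral_ge0 sp.
have el := spectral_eigenvalue_sequence pT sp.
set lam' : nat -> R := get [set lam | eigenvalue_sequence T lam].
have el' : eigenvalue_sequence T lam'.
  by have := @getPex _ [set lam | eigenvalue_sequence T lam] (ex_intro _ lam el).
have l0' j : 0 <= lam' j.
  have [->//|lj] := eqVneq (lam' j) 0.
  have [n [dn cn]] := el _ lj; have [m [dm cm]] := el' _ lj.
  have nm : m = n by apply/eqP; rewrite eqn_leq !(has_dim_le dn dm, has_dim_le dm dn).
  have /card_set_bijP[g [gf _ _]] : ([set i | lam' i = lam' j] #= [set i | lam i = lam' j])%card.
    by apply: card_eq_trans cm _; rewrite nm card_esym.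
  by have <- := gf j erefl.
pose u n := \prod_(j < n) (1 + lam j); pose v n := \prod_(j < n) (1 + lam' j).
have cu : cvgn u := spectral_prod_cvg sp.
have ul N : u N <= limn u by apply: nondecreasing_cvgn_le => //; exact: nondecreasing_prod1D.
have vu N : v N <= limn u.
  by have [N' h] := eigenvalue_sequence_prod_le l0 el' el N; exact: le_trans h (ul N').
have cv : cvgn v.
  apply: nondecreasing_is_cvgn; first exact: nondecreasing_prod1D.
  by exists (limn u) => _ [n _ <-].
have vl N : v N <= limn v by apply: nondecreasing_cvgn_le => //; exact: nondecreasing_prod1D.
have -> : fredholm_det T = limn v by [].
suff <- : limn u = limn v by exact: cu.
apply/eqP; rewrite eq_le; apply/andP; split.
- apply: limr_le => //; apply: nearW => N.
  by have [N' h] := eigenvalue_sequence_prod_le l0' el el' N; exact: le_trans h (vl N').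
- by apply: limr_le => //; apply: nearW.
Qed.

Lemma spectralZ T lam f a : 0 <= a -> spectral ip T lam f ->
  spectral ip (fun x => a *: T x) (fun j => a * lam j) f.
Proof.
move=> a0 [ort l0 eg un [K lK] cv]; split=> //.
- by move=> j; rewrite mulr_ge0.
- by move=> j; rewrite eg scalerA.
- by move=> j; rewrite mulf_eq0 negb_or => /andP[_]; exact: un.
- by exists (a * K) => n; rewrite -mulr_sumr ler_wpM2l.
- move=> x.
  have -> : (fun n => \sum_(0 <= j < n) (a * lam j * ip (f j) x) *: f j) =
      (fun n => a *: \sum_(0 <= j < n) (lam j * ip (f j) x) *: f j).
    apply/funext => n; rewrite scaler_sumr; apply: eq_bigr => j _.
    by rewrite scalerA mulrA.
  by apply: cvgZr; exact: cv.
Qed.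
End FredholmDeterminant.

(** * Diagonal operators and inverse square roots *)

Section DiagonalOperators.
Variables (R : realType) (H : completeNormedModType R).
Variable ip : {dot H for idfun}.
Hypothesis ipn : norm_induced_by ip.
Variable f : nat -> H.
Hypothesis of_ : orthoseq ip f.
Implicit Types (d : nat -> R) (x y : H).

Definition bounded_seq d := exists D : R, forall j, `|d j| <= D.

Definition diagop d x := limn (series (fun j => (d j * ip (f j) x) *: f j)).

Lemma diag_series_cvg d x : bounded_seq d ->
  series (fun j => (d j * ip (f j) x) *: f j) @ \oo --> diagop d x.
Proof.
move=> [D dD]; apply: (@cvg_orthoseq_series _ _ _ ipn _ _ (D ^+ 2 * ip x x)) => // n.
apply: (@le_trans _ _ (\sum_(0 <= i < n) D ^+ 2 * ip (f i) x ^+ 2)).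
  apply: ler_sum => i _; rewrite exprMn ler_wpM2r ?sqr_ge0//.
  rewrite -[leLHS]real_normK ?num_real// ler_pXn2r ?nnegrE//.
  exact: le_trans (dD i).
by rewrite -mulr_sumr ler_wpM2l ?sqr_ge0// bessel.
Qed.

Lemma ip_diagop d x j : bounded_seq d -> ip (f j) (diagop d x) = d j * ip (f j) x.
Proof.
move=> bd.
have c : (ip (f j) \o series (fun j => (d j * ip (f j) x) *: f j)) @ \oo -->
    ip (f j) (diagop d x).
  exact: (continuous_cvg _ (@ip_continuous _ _ _ ipn (f j) _) (@diag_series_cvg d x bd)).
have c2 : (ip (f j) \o series (fun j => (d j * ip (f j) x) *: f j)) @ \oo -->
    d j * ip (f j) x.
  apply: cvg_near_cst; exists j.+1 => // k /= jk.
  rewrite orthoseq_ip_sum ?iota_uniq// mem_index_iota jk mul1r -mulrA.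
  by rewrite orthoseq_absorb.
exact: (cvg_unique (@Rhausdorff R) c c2).
Qed.

Lemma diagop_lin d e c x : bounded_seq d -> bounded_seq e ->
  c *: diagop e x + diagop d x = diagop (fun j => c * e j + d j) x.
Proof.
move=> bd be.
have h : series (fun j => ((c * e j + d j) * ip (f j) x) *: f j) @ \oo -->
    c *: diagop e x + diagop d x.
  have -> : series (fun j => ((c * e j + d j) * ip (f j) x) *: f j) =
    (fun n => c *: series (fun j => (e j * ip (f j) x) *: f j) n +
       series (fun j => (d j * ip (f j) x) *: f j) n).
    apply/funext => n; rewrite /series/= scaler_sumr -big_split/=; apply: eq_bigr => j _.
    by rewrite scalerA -scalerDl; congr (_ *: _); ring.
  by apply: cvgD; [apply: cvgZr|]; exact: diag_series_cvg.
by rewrite /diagop (cvg_lim (@norm_hausdorff _ H) h).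
Qed.

Lemma diagop_linear d : bounded_seq d -> linear (diagop d).
Proof.
move=> bd c x y.
have h : series (fun j => (d j * ip (f j) (c *: x + y)) *: f j) @ \oo -->
    c *: diagop d x + diagop d y.
  have -> : series (fun j => (d j * ip (f j) (c *: x + y)) *: f j) =
    (fun n => c *: series (fun j => (d j * ip (f j) x) *: f j) n +
       series (fun j => (d j * ip (f j) y) *: f j) n).
    apply/funext => n; rewrite /series/= scaler_sumr -big_split/=; apply: eq_bigr => j _.
    by rewrite scalerA -scalerDl ipDr ipZr; congr (_ *: _); ring.
  by apply: cvgD; [apply: cvgZr|]; exact: diag_series_cvg.
by rewrite [LHS](cvg_lim (@norm_hausdorff _ H) h).
Qed.

Lemma diagop_form d x y : bounded_seq d ->
  series (fun j => d j * (ip (f j) x * ip (f j) y)) @ \oo --> ip y (diagop d x).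
Proof.
move=> bd; have c := continuous_cvg _ (@ip_continuous _ _ _ ipn y _)
  (@diag_series_cvg d x bd).
have -> : series (fun j => d j * (ip (f j) x * ip (f j) y)) =
  ip y \o series (fun j => (d j * ip (f j) x) *: f j); last exact: c.
apply/funext => n; rewrite /series/= ip_sumr; apply: eq_bigr => j _.
by rewrite ipZr (ipC ip y) mulrA.
Qed.

Lemma diagop_sym d x y : bounded_seq d -> ip (diagop d x) y = ip x (diagop d y).
Proof.
move=> bd; rewrite (ipC ip _ y).
have c1 := diagop_form (x := x) (y := y) bd.
suff c2 : series (fun j => d j * (ip (f j) x * ip (f j) y)) @ \oo --> ip x (diagop d y).
  exact: (cvg_unique (@Rhausdorff R) c1 c2).
have -> : series (fun j => d j * (ip (f j) x * ip (f j) y)) =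
  series (fun j => d j * (ip (f j) y * ip (f j) x)).
  by apply/funext => n; apply: eq_bigr => j _; rewrite (mulrC (ip _ x)).
exact: diagop_form.
Qed.

Lemma diagop_norm d D x : (forall j, `|d j| <= D) -> `|diagop d x| <= D * `|x|.
Proof.
move=> dD; have D0 : 0 <= D by apply: le_trans (dD 0%N).
have bd : bounded_seq d by exists D.
rewrite -(ler_pXn2r (_ : 0 < 2)%N) ?nnegrE ?mulr_ge0// exprMn -!ipn.
have h := diagop_form (x := x) (y := diagop d x) bd.
rewrite -(cvg_lim (@Rhausdorff R) h).
apply: limr_le; first by apply/cvg_ex; eexists; exact: h.
apply: nearW => n; rewrite /series/=.
apply: (@le_trans _ _ (\sum_(0 <= j < n) D ^+ 2 * ip (f j) x ^+ 2)).
  apply: ler_sum => j _; rewrite ip_diagop//.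
  have -> : d j * (ip (f j) x * (d j * ip (f j) x)) = d j ^+ 2 * ip (f j) x ^+ 2 by ring.
  rewrite ler_wpM2r ?sqr_ge0// -[leLHS]real_normK ?num_real// ler_pXn2r ?nnegrE//.
by rewrite -mulr_sumr ler_wpM2l ?sqr_ge0// bessel.
Qed.

Lemma diagop_continuous d : bounded_seq d -> continuous (diagop d).
Proof.
move=> bd x; have [D dD] := bd.
have D0 : 0 <= D by apply: le_trans (dD 0%N).
apply/cvgrPdist_lt => eps e0.
have k0 : 0 < eps / (D + 1) by rewrite divr_gt0// ltr_wpDl.
have /cvgrPdist_lt/(_ _ k0) : x0 @[x0 --> x] --> x by exact: cvg_id.
apply: filterS => y yx; have lD := diagop_linear bd.
rewrite -(linB _ _ lD); apply: le_lt_trans (diagop_norm _ dD) _.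
apply: (@le_lt_trans _ _ ((D + 1) * `|x - y|)); first by rewrite ler_wpM2r// lerDl.
by rewrite mulrC -ltr_pdivlMr ?ltr_wpDl.
Qed.

(** The scalar part is what acts on the orthogonal complement of f, which need not be a basis. These
    operators are closed under composition. *)
Definition affop c d x := c *: x + diagop d x.

Lemma affop_comp c d c' e x : bounded_seq d -> bounded_seq e ->
  affop c d (affop c' e x) =
  affop (c * c') (fun j => c * e j + d j * (c' + e j)) x.
Proof.
move=> bd be; have [D dD] := bd; have [E eE] := be.
have b : bounded_seq (fun j => d j * (c' + e j)).
  exists (D * (`|c'| + E)) => j; rewrite normrM; apply: ler_pM => //.
  by apply: le_trans (ler_normD _ _) _; rewrite lerD2l.
rewrite /affop scalerDr scalerA -addrA; congr (_ + _).
rewrite -diagop_lin//; congr (_ + _); rewrite /diagop; congr (limn (series _)).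
apply/funext => j; rewrite ipDr ipZr ip_diagop//; congr (_ *: _); ring.
Qed.

Lemma diagop0 d x : (forall j, d j = 0) -> diagop d x = 0.
Proof.
move=> d0; rewrite /diagop (_ : series _ = cst 0); last first.
  by apply/funext => n; rewrite /series/= big1// => j _; rewrite d0 mul0r scale0r.
exact: (cvg_lim (@norm_hausdorff _ H) (cvg_cst 0)).
Qed.

Lemma positive_affop c d : bounded_seq d -> 0 <= c -> (forall j, - c <= d j) ->
  positive_operator ip (affop c d).
Proof.
move=> bd c0 cd; split.
- move=> a x y; rewrite /affop diagop_linear// !scalerDr !scalerA mulrC addrACA.
  by [].
- move=> x; apply: cvgD; last exact: diagop_continuous.
  by apply: cvgZr; exact: cvg_id.
- by move=> x y; rewrite /affop ipDl ipDr ipZl ipZr diagop_sym.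
- move=> x; rewrite /affop ipDr ipZr.
  have h := diagop_form (x := x) (y := x) bd.
  suff : - (c * ip x x) <= ip x (diagop d x) by lra.
  rewrite -(cvg_lim (@Rhausdorff R) h).
  apply: limr_ge; first by apply/cvg_ex; eexists; exact: h.
  apply: nearW => n; rewrite /series/=.
  apply: (@le_trans _ _ (\sum_(0 <= j < n) (- c) * ip (f j) x ^+ 2)).
    by rewrite -mulr_sumr mulNr lerN2 ler_wpM2l// bessel.
  by apply: ler_sum => j _; rewrite -expr2 ler_wpM2r ?sqr_ge0.
Qed.
End DiagonalOperators.

Section InverseSquareRoot.
Variables (R : realType) (H : completeNormedModType R).
Variable ip : {dot H for idfun}.
Hypothesis ipn : norm_induced_by ip.

(** The root is a^(-1/2) off the span of f and (lam j + a)^(-1/2) along f j, so the diagonal part is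
    the difference of these values. *)
Lemma inv_sqrt_op_exists V lam f (a : R) : spectral ip V lam f -> 0 < a ->
  exists S : H -> H, positive_operator ip S /\
    forall x, S (S (V x + a *: x)) = x /\ V (S (S x)) + a *: S (S x) = x.
Proof.
move=> sp a0; have of_ := spectral_ortho sp; have l0 := spectral_ge0 sp.
have [K lK] := spectral_summable sp.
have bl : bounded_seq lam.
  exists K => j; rewrite ger0_norm//; apply: le_trans (lK j.+1).
  by rewrite big_nat_recr//= lerDr sumr_ge0.
pose al := (Num.sqrt a)^-1.
have sa : 0 < Num.sqrt a by rewrite sqrtr_gt0.
have al0 : 0 < al by rewrite invr_gt0.
pose r j := (Num.sqrt (lam j + a))^-1.
have la j : 0 < lam j + a by rewrite ltr_wpDl.
have r0 j : 0 < r j by rewrite invr_gt0 sqrtr_gt0.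
have ral j : r j <= al.
  by rewrite /r /al lef_pV2 ?posrE ?sqrtr_gt0//; apply: ler_wsqrtr; rewrite lerDr.
pose d j := r j - al.
have bd : bounded_seq d.
  by exists al => j; rewrite /d ler_norml; have := r0 j; have := ral j; lra.
have al2 : al * al * a = 1.
  by rewrite /al -[in X in _ * X](sqr_sqrtr (ltW a0)) expr2; field; rewrite gt_eqF.
have r2 j : r j * r j * (lam j + a) = 1.
  by rewrite /r -[in X in _ * X](sqr_sqrtr (ltW (la j))) expr2; field; rewrite gt_eqF ?sqrtr_gt0.
have VE x : V x + a *: x = affop ip f a lam x.
  rewrite addrC /affop; congr (_ + _).
  exact/esym/(cvg_lim (@norm_hausdorff _ H))/(spectral_cvg sp).
have b2 : bounded_seq (fun j => al * d j + d j * (al + d j)).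
  by exists (al * al) => j; rewrite /d ler_norml; have := r0 j; have := ral j; nra.
have b3 : bounded_seq (fun j => al * lam j + d j * (a + lam j)).
  have [L lL] := bl; exists (al * L + al * (a + L)) => j.
  apply: le_trans (ler_normD _ _) _; rewrite !normrM; apply: lerD.
    by rewrite (gtr0_norm al0) ler_wpM2l// ltW.
  apply: ler_pM => //; last first.
    by apply: le_trans (ler_normD _ _) _; rewrite (gtr0_norm a0) lerD2l.
  by rewrite /d ler_norml; have := r0 j; have := ral j; lra.
exists (affop ip f al d); split.
  by apply: positive_affop => //; [exact: ltW|move=> j; rewrite /d; have := r0 j; lra].
move=> x; rewrite !VE; split.
- rewrite [affop ip f al d (affop ip f a lam x)]affop_comp// affop_comp//.
  rewrite /affop diagop0 ?addr0 ?mulrA ?al2 ?scale1r// => j.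
  have -> : al * (al * lam j + d j * (a + lam j)) +
     d j * (al * a + (al * lam j + d j * (a + lam j))) =
     r j * r j * (lam j + a) - al * al * a by rewrite /d; ring.
  by rewrite r2 al2 subrr.
- rewrite [affop ip f al d (affop ip f al d x)]affop_comp// affop_comp//.
  rewrite /affop diagop0 ?addr0 ?(mulrC a) ?al2 ?scale1r// => j.
  have -> : a * (al * d j + d j * (al + d j)) +
     lam j * (al * al + (al * d j + d j * (al + d j))) =
     r j * r j * (lam j + a) - al * al * a by rewrite /d; ring.
  by rewrite r2 al2 subrr.
Qed.

Lemma self_norm_sqr V lam f (a : R) (m : H) : positive_operator ip V ->
  spectral ip V lam f -> 0 < a ->
  exists n, V n + a *: n = m /\ self_norm ip V a m ^+ 2 = ip m n.
Proof.
move=> pV sp a0; have ex := inv_sqrt_op_exists sp a0.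
have := @getPex _ [set S : H -> H | positive_operator ip S /\
    forall x, S (S (V x + a *: x)) = x /\ V (S (S x)) + a *: S (S x) = x] ex.
rewrite /self_norm /inv_sqrt_op; set S := get _ => -[[_ _ sS _] hS].
exists (S (S m)); split; first by case: (hS m).
by rewrite -ipn sS.
Qed.
End InverseSquareRoot.

(** * Finite sections and their limits *)

(** The block matrices M U and U M are both lower triangular and have the same determinant. *)
Lemma sylvester_det (R : comNzRingType) k N (A : 'M[R]_(k, N)) (B : 'M[R]_(N, k)) :
  \det (1%:M + A *m B) = \det (1%:M + B *m A).
Proof.
pose M := block_mx 1%:M (- A) B 1%:M; pose U := block_mx 1%:M A 0 (1%:M : 'M[R]_N).
have dU : \det U = 1 by rewrite /U det_ublock !det1 mulr1.
have E1 : M *m U = block_mx 1%:M 0 B (B *m A + 1%:M).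
  by rewrite /M /U mulmx_block !mul1mx !mulmx1 !mulmx0 !addr0 subrr.
have E2 : U *m M = block_mx (1%:M + A *m B) 0 B 1%:M.
  rewrite /M /U mulmx_block !mul1mx !mulmx1 !mul0mx !add0r.
  by rewrite addNr.
have : \det (M *m U) = \det (U *m M) by rewrite !det_mulmx mulrC.
by rewrite E1 E2 !det_lblock !det1 mul1r mulr1 [B *m A + _]addrC => ->.
Qed.

Section FiniteSections.
Variables (R : realType).

Lemma cvg_sum_seq (I : Type) (r : seq I) (u : nat -> I -> R) (a : I -> R) :
  (forall i, (fun n => u n i) @ \oo --> a i) ->
  (fun n => \sum_(i <- r) u n i) @ \oo --> \sum_(i <- r) a i.
Proof.
move=> ua; elim: r => [|i r IHr].
  by rewrite big_nil; under eq_fun do rewrite big_nil; exact: cvg_cst.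
by rewrite big_cons; under eq_fun do rewrite big_cons; exact: cvgD.
Qed.

Lemma cvg_prod_seq (I : Type) (r : seq I) (u : nat -> I -> R) (a : I -> R) :
  (forall i, (fun n => u n i) @ \oo --> a i) ->
  (fun n => \prod_(i <- r) u n i) @ \oo --> \prod_(i <- r) a i.
Proof.
move=> ua; elim: r => [|i r IHr].
  by rewrite big_nil; under eq_fun do rewrite big_nil; exact: cvg_cst.
by rewrite big_cons; under eq_fun do rewrite big_cons; exact: cvgM.
Qed.

Lemma cvg_det k (A : nat -> 'M[R]_k) (B : 'M[R]_k) :
  (forall i j, (fun n => A n i j) @ \oo --> B i j) ->
  (fun n => \det (A n)) @ \oo --> \det B.
Proof.
move=> AB; rewrite /determinant.
apply: cvg_sum_seq => s.
by apply: cvgMr; apply: cvg_prod_seq.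
Qed.

Lemma posdef_1D k (A : 'M[R]_k) : psdmx A -> posdefmx (1%:M + A).
Proof. by move=> pA; rewrite addrC; exact: posdef_addscalar. Qed.

Variables (H : completeNormedModType R) (ip : {dot H for idfun}).
Hypothesis ipn : norm_induced_by ip.
Variable e : nat -> H.
Hypotheses (oe : orthoseq ip e) (te : total ip e).
Implicit Types (V T : H -> H) (m x : H).

Definition section_mx k T : 'M[R]_k := \matrix_(i, j) ip (e i) (T (e j)).
Definition section_col k m : 'cV[R]_k := \col_i ip (e i) m.
Definition lift_col k (c : 'cV[R]_k) : H := \sum_i c i 0 *: e i.

Lemma qform_section k T (c : 'cV[R]_k) : linear T ->
  qform (section_mx k T) c c = ip (lift_col c) (T (lift_col c)).
Proof.
move=> lT; rewrite qformE /lift_col (lin_sum _ _ _ lT) ip_suml; apply: eq_bigr => i _.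
rewrite ipZl ip_sumr mulr_sumr; apply: eq_bigr => j _.
by rewrite ipZr mxE; ring.
Qed.

Lemma section_psd k T : positive_operator ip T -> psdmx (section_mx k T).
Proof.
move=> [lT _ sT pT]; split; last by move=> u; rewrite qform_section.
by apply/matrixP => i j; rewrite !mxE -sT ipC.
Qed.

Lemma dotc_section k (c : 'cV[R]_k) m : dotc c (section_col k m) = ip (lift_col c) m.
Proof.
by rewrite dotcE /lift_col ip_suml; apply: eq_bigr => i _; rewrite ipZl mxE.
Qed.

Lemma lift_col_norm k (c : 'cV[R]_k) : ip (lift_col c) (lift_col c) <= dotc c c.
Proof.
rewrite dotcE /lift_col ip_suml; apply: ler_sum => i _; rewrite ipZl ip_sumr.
rewrite (bigD1 i)//= big1 => [|j ji]; last first.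
  by rewrite ipZr oe.2 ?mulr0// eq_sym; apply: contra ji => /eqP/val_inj ->.
rewrite addr0 ipZr mulrA ler_piMr//; first by rewrite -expr2 sqr_ge0.
by case/andP: (orthoseq_sqr_le1 ipn i oe).
Qed.

Lemma lift_section k x : lift_col (section_col k x) = fproj ip e k x.
Proof.
by rewrite /lift_col /fproj big_mkord; apply: eq_bigr => i _; rewrite mxE.
Qed.

(** A squeeze. From above, positivity of V + a at the difference of n and the lifted solution shows
    that compression only lowers the dual form; from below, the projections of n are test
    vectors. *)
Lemma iqform_section_cvg V (a : R) n m : positive_operator ip V -> 0 < a ->
  V n + a *: n = m ->
  (fun k => iqform (section_mx k V + a%:M) (section_col k m)) @ \oo --> ip m n.
Proof.
move=> pV a0 nE; have [lV cV sV p0] := pV.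
have pk k : posdefmx (section_mx k V + a%:M).
  by apply: posdef_addscalar => //; exact: section_psd.
have mn : ip m n = ip n (V n) + a * ip n n by rewrite -nE ipDl ipZl sV.
have up k : iqform (section_mx k V + a%:M) (section_col k m) <= ip m n.
  set y := invmx (section_mx k V + a%:M) *m section_col k m.
  have E1 : iqform (section_mx k V + a%:M) (section_col k m) = dotc y (section_col k m).
    by rewrite iqformE// qform_inv.
  have := iqformE (section_col k m) (pk k).
  rewrite -/y qformDm qform_scalar qform_section// => E2.
  have E3 := dotc_section y m; rewrite E1 in E2 *.
  set u := lift_col y in E2 E3.
  have nu := lift_col_norm y; rewrite -/u in nu.
  have hV : ip n (V u) = ip u (V n) by rewrite -sV ipC.
  have h1 := p0 (u - n); rewrite (linB _ _ lV) !ipBl !ipBr hV in h1.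
  have h2 := mulr_ge0 (ltW a0) (ip_ge0 ipn (u - n)).
  rewrite !ipBl !ipBr (ipC ip n u) in h2.
  have h3 : ip u m = ip u (V n) + a * ip u n by rewrite -nE ipDr ipZr.
  have h4 := ler_wpM2l (ltW a0) nu.
  rewrite mn; lra.
pose yk k := fproj ip e k n.
have lo k : 2 * ip (yk k) m - ip (yk k) (V (yk k)) - a * ip (yk k) (yk k) <=
    iqform (section_mx k V + a%:M) (section_col k m).
  apply: le_trans (iqform_ge (section_col k n) _ (pk k)).
  rewrite dotc_section lift_section qformDm qform_scalar qform_section// lift_section -/(yk k).
  have -> : dotc (section_col k n) (section_col k n) = ip (yk k) (yk k).
    rewrite /yk fproj_sqr// dotcE big_mkord; apply: eq_bigr => i _.
    by rewrite mxE expr2.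
  by rewrite opprD addrA.
have yc : yk @ \oo --> n by exact: fproj_cvg.
have lc : (fun k => 2 * ip (yk k) m - ip (yk k) (V (yk k)) - a * ip (yk k) (yk k)) @ \oo -->
    2 * ip n m - ip n (V n) - a * ip n n.
  apply: cvgB; [apply: cvgB; [apply: cvgMr|]|apply: cvgMr]; apply: (cvg_ip ipn) => //.
  - exact: cvg_cst.
  - exact: (continuous_cvg _ (cV n) yc).
have E : 2 * ip n m - ip n (V n) - a * ip n n = ip m n.
  by rewrite (ipC ip n m) mn; ring.
rewrite E in lc.
by apply: (squeeze_cvgr _ lc (cvg_cst (ip m n))); apply: nearW => k; rewrite lo up.
Qed.

Section DeterminantLimit.
Variables (T : H -> H) (lam : nat -> R) (f : nat -> H).
Hypotheses (pT : positive_operator ip T) (sp : spectral ip T lam f).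

Let l0 := spectral_ge0 sp.
Let of_ := spectral_ortho sp.

(** F F^T is the section of T truncated to N eigenvectors. By Sylvester its determinant can be
    computed from F^T F, whose size N does not depend on k. *)
Let F k N : 'M[R]_(k, N) := \matrix_(i, j) (Num.sqrt (lam j) * ip (e i) (f j)).

Let FF k N i l : (F k N *m (F k N)^T) i l =
  \sum_(0 <= j < N) lam j * ip (f j) (e l) * ip (e i) (f j).
Proof.
rewrite mxE big_mkord; apply: eq_bigr => j _; rewrite !mxE.
rewrite (ipC ip (e l)) -[lam j in RHS](sqr_sqrtr (l0 j)) expr2; ring.
Qed.

Let psdFF k N : psdmx (F k N *m (F k N)^T).
Proof.
split; first by rewrite trmx_mul trmxK.
by move=> u; rewrite /qform -mulmxA dotcC dotc_mull dotc_ge0.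
Qed.

Let psdFTF k N : psdmx ((F k N)^T *m F k N).
Proof.
split; first by rewrite trmx_mul trmxK.
by move=> u; rewrite /qform -mulmxA -dotc_mull dotc_ge0.
Qed.

Let Lam N : 'M[R]_N := diag_mx (\row_j lam j).

Let LamE N u : qform (Lam N) u u = \sum_(j < N) lam j * u j 0 ^+ 2.
Proof.
rewrite /qform dotcE; apply: eq_bigr => j _.
by rewrite mul_diag_mx !mxE; ring.
Qed.

Let psdLam N : psdmx (Lam N).
Proof.
split; first by rewrite tr_diag_mx.
by move=> u; rewrite LamE sumr_ge0// => j _; rewrite mulr_ge0 ?sqr_ge0.
Qed.

Let det1Lam N : \det (1%:M + Lam N) = \prod_(j < N) (1 + lam j).
Proof.
have -> : 1%:M + Lam N = diag_mx (\row_j (1 + lam j)).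
  by apply/matrixP => i j; rewrite !mxE -mulrnDl.
by rewrite det_diag; apply: eq_bigr => j _; rewrite mxE.
Qed.

Let FTF_le_Lam k N u : qform ((F k N)^T *m F k N) u u <= qform (Lam N) u u.
Proof.
pose c (j : nat) := if (insub j : option 'I_N) is Some j' then Num.sqrt (lam j') * u j' 0 else 0.
pose g := \sum_(0 <= j < N) c j *: f j.
have cE (j : 'I_N) : c j = Num.sqrt (lam j) * u j 0 by rewrite /c valK.
have FuE : forall i, (F k N *m u) i 0 = ip (e i) g.
  move=> i; rewrite mxE /g big_mkord ip_sumr; apply: eq_bigr => j _.
  by rewrite mxE ipZr cE; ring.
have -> : qform ((F k N)^T *m F k N) u u = \sum_(0 <= i < k) ip (e i) g ^+ 2.
  rewrite /qform -mulmxA -dotc_mull dotcE big_mkord; apply: eq_bigr => i _.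
  by rewrite FuE expr2.
apply: le_trans (bessel ipn k g oe) _; rewrite ipn LamE.
apply: le_trans (orthoseq_sum_norm_le ipn c of_ (iota_uniq _ _)) _.
rewrite -/(index_iota 0 N).
rewrite le_eqVlt; apply/orP; left; apply/eqP.
transitivity (\sum_(j < N) c j ^+ 2).
  by rewrite -(big_mkord xpredT (fun j => c j ^+ 2)) /index_iota subn0.
by apply: eq_bigr => j _; rewrite cE exprMn sqr_sqrtr.
Qed.

(** N grows with k fixed. Bessel's inequality for e puts F^T F below the diagonal matrix of
    eigenvalues, so the determinants are at most the spectral products. *)
Lemma det_section_le k : \det (1%:M + section_mx k T) <= fredholm_det T.
Proof.
have c1 : (fun N => \det (1%:M + F k N *m (F k N)^T)) @ \oo --> \det (1%:M + section_mx k T).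
  apply: cvg_det => i l.
  have -> : (fun n => (1%:M + F k n *m (F k n)^T) i l) =
     (fun n => (1%:M : 'M[R]_k) i l + (F k n *m (F k n)^T) i l).
    by apply/funext => n; rewrite mxE.
  rewrite [X in _ --> X]mxE; apply: cvgD; first exact: cvg_cst.
  have -> : (fun n => (F k n *m (F k n)^T) i l) =
     (fun n => ip (e i) (\sum_(0 <= j < n) (lam j * ip (f j) (e l)) *: f j)).
    by apply/funext => n; rewrite FF ip_sumr; apply: eq_bigr => j _; rewrite ipZr.
  rewrite mxE; apply: (cvg_ip ipn); first exact: cvg_cst.
  exact: (@spectral_cvg _ _ _ _ _ _ sp (e l)).
rewrite -(cvg_lim (@Rhausdorff R) c1).
apply: limr_le; first by apply/cvg_ex; eexists; exact: c1.
apply: nearW => N; rewrite sylvester_det.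
apply: (@le_trans _ _ (\prod_(j < N) (1 + lam j))).
  rewrite -det1Lam; apply: det_posdef_le; [exact: posdef_1D..|] => u.
  by rewrite !qformDm lerD2l FTF_le_Lam.
have c2 := fredholm_det_spectral pT sp.
rewrite -(cvg_lim (@Rhausdorff R) c2).
apply: nondecreasing_cvgn_le; first exact: nondecreasing_prod1D.
by apply/cvg_ex; eexists; exact: c2.
Qed.

Let FF_le_section k N u : qform (F k N *m (F k N)^T) u u <= qform (section_mx k T) u u.
Proof.
have [lT _ _ _] := pT.
rewrite qform_section//; set g := lift_col u.
have FuE (j : 'I_N) : ((F k N)^T *m u) j 0 = Num.sqrt (lam j) * ip (f j) g.
  rewrite mxE /g /lift_col ip_sumr mulr_sumr; apply: eq_bigr => i _.
  by rewrite !mxE ipZr (ipC ip (e i)); ring.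
have -> : qform (F k N *m (F k N)^T) u u = \sum_(0 <= j < N) lam j * ip (f j) g ^+ 2.
  rewrite /qform -mulmxA dotcC dotc_mull dotcE big_mkord.
  by apply: eq_bigr => j _; rewrite FuE -[in RHS](sqr_sqrtr (l0 j)) !expr2; ring.
have c : (fun n => \sum_(0 <= j < n) lam j * ip (f j) g ^+ 2) @ \oo --> ip g (T g).
  have -> : (fun n => \sum_(0 <= j < n) lam j * ip (f j) g ^+ 2) =
      (fun n => ip g (\sum_(0 <= j < n) (lam j * ip (f j) g) *: f j)).
    apply/funext => n; rewrite ip_sumr; apply: eq_bigr => j _.
    by rewrite ipZr (ipC ip g); ring.
  apply: (cvg_ip ipn); first exact: cvg_cst.
  exact: (@spectral_cvg _ _ _ _ _ _ sp g).
rewrite -(cvg_lim (@Rhausdorff R) c).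
apply: (@nondecreasing_cvgn_le _ (fun n => \sum_(0 <= j < n) lam j * ip (f j) g ^+ 2)).
  apply/nondecreasing_seqP => n; rewrite big_nat_recr//= lerDl.
  by rewrite mulr_ge0 ?sqr_ge0.
by apply/cvg_ex; eexists; exact: c.
Qed.

(** k grows with N fixed. F F^T lies below the section, and F^T F tends to the diagonal matrix of
    eigenvalues because e is total; N is chosen beforehand so that the product is close to its
    limit. *)
Lemma det_section_cvg : (fun k => \det (1%:M + section_mx k T)) @ \oo --> fredholm_det T.
Proof.
have c2 := fredholm_det_spectral pT sp.
apply/cvgrPdist_lt => eps eps0.
have eps2 : 0 < eps / 2 by rewrite divr_gt0.
have /cvgrPdist_lt/(_ _ eps2)[N _ /(_ N (leqnn N)) hN] := c2.
have ck : (fun k => \det (1%:M + (F k N)^T *m F k N)) @ \oo --> \det (1%:M + Lam N).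
  apply: cvg_det => j l.
  have -> : (fun k => (1%:M + (F k N)^T *m F k N) j l) =
    (fun k => (1%:M : 'M[R]_N) j l + ((F k N)^T *m F k N) j l).
    by apply/funext => k; rewrite mxE.
  rewrite [X in _ --> X]mxE; apply: cvgD; first exact: cvg_cst.
  have -> : (fun k => ((F k N)^T *m F k N) j l) =
    (fun k => Num.sqrt (lam j) * Num.sqrt (lam l) * ip (f j) (fproj ip e k (f l))).
    apply/funext => k; rewrite mxE /fproj ip_sumr big_mkord mulr_sumr.
    by apply: eq_bigr => i _; rewrite !mxE ipZr (ipC ip (f j)); ring.
  have -> : Lam N j l = Num.sqrt (lam j) * Num.sqrt (lam l) * ip (f j) (f l).
    rewrite !mxE; have [->|jl] := eqVneq j l.
      rewrite mulr1n -expr2 sqr_sqrtr//.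
      by have [->|/(spectral_unit sp) ->] := eqVneq (lam l) 0; rewrite ?mul0r ?mulr1.
    by rewrite mulr0n of_.2 ?mulr0.
  apply: cvgMr; apply: (cvg_ip ipn); first exact: cvg_cst.
  exact: fproj_cvg.
have /cvgrPdist_lt/(_ _ eps2) := ck.
apply: filterS => k hk.
have lo : \det (1%:M + (F k N)^T *m F k N) <= \det (1%:M + section_mx k T).
  rewrite -sylvester_det; apply: det_posdef_le.
  - exact: posdef_1D.
  - by apply: posdef_1D; exact: section_psd.
  - by move=> u; rewrite !qformDm lerD2l FF_le_section.
have up := det_section_le k.
move: hN hk; rewrite /= det1Lam !ltr_norml => /andP[h1 h2] /andP[h3 h4].
by apply/andP; split; lra.
Qed.
End DeterminantLimit.
End FiniteSections.

(** * Measurability of matrix expressions *)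

Section MeasurableMatrices.
Variables (R : realType) (d : measure_display) (T : measurableType d).

Definition mx_measurable m n (A : T -> 'M[R]_(m, n)) :=
  forall i j, measurable_fun [set: T] (fun w => A w i j).

Lemma mx_measurable_mul m n p (A : T -> 'M[R]_(m, n)) (B : T -> 'M[R]_(n, p)) :
  mx_measurable A -> mx_measurable B -> mx_measurable (fun w => A w *m B w).
Proof.
move=> mA mB i j; under eq_fun do rewrite mxE.
by apply: measurable_sum => k; apply: measurable_funM; [exact: mA|exact: mB].
Qed.

Lemma mx_measurable_tr m n (A : T -> 'M[R]_(m, n)) :
  mx_measurable A -> mx_measurable (fun w => (A w)^T).
Proof. by move=> mA i j; under eq_fun do rewrite mxE; exact: mA. Qed.

Lemma mx_measurableD m n (A B : T -> 'M[R]_(m, n)) :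
  mx_measurable A -> mx_measurable B -> mx_measurable (fun w => A w + B w).
Proof.
move=> mA mB i j; under eq_fun do rewrite mxE.
by apply: measurable_funD; [exact: mA|exact: mB].
Qed.

Lemma mx_measurableZ m n a (A : T -> 'M[R]_(m, n)) :
  mx_measurable A -> mx_measurable (fun w => a *: A w).
Proof.
move=> mA i j; under eq_fun do rewrite mxE; apply: measurable_funM; last exact: mA.
exact: measurable_cst.
Qed.

Lemma mx_measurable_cst m n (A : 'M[R]_(m, n)) : mx_measurable (fun=> A).
Proof. by move=> i j; exact: measurable_cst. Qed.

Lemma measurable_det n (A : T -> 'M[R]_n) : mx_measurable A ->
  measurable_fun [set: T] (fun w => \det (A w)).
Proof.
move=> mA; rewrite /determinant; apply: measurable_sum => s.
apply: measurable_funM; first exact: measurable_cst.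
by apply: measurable_prod => i _; exact: mA.
Qed.

Lemma measurable_inv_ge0 (g : T -> R) : (forall w, 0 <= g w) ->
  measurable_fun [set: T] g ->
  measurable_fun [set: T] (fun w => (g w)^-1).
Proof.
move=> g0 mg; under eq_fun do rewrite -powR_inv1//.
exact: (measurableT_comp (measurable_powR (-1)) mg).
Qed.

(** By the adjugate formula: positive definiteness selects the invertible branch of [invmx] and
    makes the determinant positive. *)
Lemma mx_measurable_inv n (A : T -> 'M[R]_n) : (forall w, posdefmx (A w)) ->
  mx_measurable A -> mx_measurable (fun w => invmx (A w)).
Proof.
move=> pA mA i j.
have E w : invmx (A w) i j = (\det (A w))^-1 * cofactor (A w) j i.
  by rewrite /invmx (posdef_unitmx (pA w)) !mxE.
under eq_fun do rewrite E.
apply: measurable_funM.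
  apply: measurable_inv_ge0; first by move=> w; exact/ltW/det_posdef_gt0.
  exact: measurable_det.
rewrite /cofactor; apply: measurable_funM; first exact: measurable_cst.
by apply: measurable_det => k l; under eq_fun do rewrite !mxE; exact: mA.
Qed.

Lemma measurable_qform n (A : T -> 'M[R]_n) (u v : T -> 'cV[R]_n) :
  mx_measurable A -> mx_measurable u -> mx_measurable v ->
  measurable_fun [set: T] (fun w => qform (A w) (u w) (v w)).
Proof.
move=> mA mu mv; rewrite /qform /dotc.
apply: (mx_measurable_mul (mx_measurable_tr mu) (mx_measurable_mul mA mv)).
Qed.

Lemma measurable_sqrt (g : T -> R) :
  measurable_fun [set: T] g ->
  measurable_fun [set: T] (fun w => Num.sqrt (g w)).
Proof.
move=> mg; apply: (measurableT_comp _ mg); apply: continuous_measurable_fun.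
exact: sqrt_continuous.
Qed.

Variables (n : nat) (r : R) (V : T -> 'M[R]_n) (m : T -> 'cV[R]_n).
Hypotheses (r0 : 0 < r) (pV : forall w, psdmx (V w)).
Hypotheses (mV : mx_measurable V) (mm : mx_measurable m).

Lemma mx_measurable_shift_inv : mx_measurable (fun w => invmx (V w + r%:M)).
Proof.
apply: mx_measurable_inv => [w|]; first exact: posdef_addscalar.
by apply: mx_measurableD => //; exact: mx_measurable_cst.
Qed.

Lemma measurable_iqform_shift :
  measurable_fun [set: T] (fun w => iqform (V w + r%:M) (m w)).
Proof. by apply: measurable_qform => //; exact: mx_measurable_shift_inv. Qed.

Lemma measurable_bnorm :
  measurable_fun [set: T] (fun w => bnorm r (V w) (m w)).
Proof.
apply: measurable_sqrt; apply: measurable_funM; last exact: measurable_cst.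
exact: measurable_iqform_shift.
Qed.

Lemma measurable_det_normalized :
  measurable_fun [set: T] (fun w => \det (1%:M + r^-1 *: V w)).
Proof.
apply: measurable_det; apply: mx_measurableD; first exact: mx_measurable_cst.
exact: mx_measurableZ.
Qed.

Lemma measurable_ln1D_bnorm :
  measurable_fun [set: T] (fun w => ln (1 + bnorm r (V w) (m w))).
Proof.
apply: (measurableT_comp (@measurable_ln R)).
by apply: measurable_funD; [exact: measurable_cst|exact: measurable_bnorm].
Qed.

Lemma measurable_bennett :
  measurable_fun [set: T] (fun w => bennett r (V w) (m w)).
Proof.
apply: (measurableT_comp (@measurable_expR R)); apply: measurable_funB.
  apply: measurable_funM; first exact: measurable_cst.
  apply: measurable_funB; last exact: measurable_bnorm.
  apply: measurable_funM; last exact: measurable_ln1D_bnorm.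
  by apply: measurable_funD; [exact: measurable_cst|exact: measurable_bnorm].
apply: measurable_funM; last exact: measurable_cst.
exact: (measurableT_comp (@measurable_ln R) measurable_det_normalized).
Qed.

Lemma measurable_bslope :
  measurable_fun [set: T] (fun w => bslope r (V w) (m w)).
Proof.
apply: measurable_funM; first exact: measurable_ln1D_bnorm.
by apply: measurable_inv_ge0 => [w|]; [exact: bnorm_ge0|exact: measurable_bnorm].
Qed.

Lemma measurable_bcoef1 i :
  measurable_fun [set: T] (fun w => bcoef1 r (V w) (m w) i).
Proof.
apply: measurable_funM; first exact: measurable_bennett.
apply: measurable_funM; first exact: measurable_bslope.
exact: (mx_measurable_mul mx_measurable_shift_inv mm).
Qed.

Lemma measurable_bcoef2 i j :
  measurable_fun [set: T] (fun w => bcoef2 r (V w) (m w) i j).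
Proof.
apply: measurable_funM; first exact: measurable_bennett.
apply: measurable_funD.
  by apply: measurable_funM; [exact: mx_measurable_shift_inv|exact: measurable_cst].
apply: measurable_funM.
  by apply: measurable_funM; [exact: measurable_bslope|exact: measurable_cst].
by apply: measurable_funM; exact: (mx_measurable_mul mx_measurable_shift_inv mm).
Qed.
End MeasurableMatrices.

(** * Brackets and their sections *)

Section Bracket.
Variables (R : realType) (H : completeNormedModType R).
Variable ip : {dot H for idfun}.
Hypothesis ipn : norm_induced_by ip.
Variable e : nat -> H.
Hypotheses (oe : orthoseq ip e) (te : total ip e).

Lemma finite_trace0 : finite_trace ip e (fun=> 0).
Proof.
split; last by exists 0 => n; rewrite big1// => i _; rewrite ip0r.
split=> [a u v|x|u v|u]; rewrite ?scaler0 ?addr0 ?ip0l ?ip0r//.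
exact: cvg_cst.
Qed.

Lemma finite_traceD T S : finite_trace ip e T -> finite_trace ip e S ->
  finite_trace ip e (fun x => T x + S x).
Proof.
move=> [[lT cT sT pT] [K hK]] [[lS cS sS pS] [L hL]]; split.
  split=> [a u v|x|u v|u].
  - by rewrite lT lS scalerDr addrACA.
  - by apply: cvgD; [exact: cT|exact: cS].
  - by rewrite ipDl ipDr sT sS.
  - by rewrite ipDr addr_ge0.
exists (K + L) => n; under eq_bigr do rewrite ipDr.
by rewrite big_split/= lerD.
Qed.

Lemma finite_trace_class T : positive_trace_class ip T -> finite_trace ip e T.
Proof.
move=> tT; split; first by case: tT.
exact: (trace_class_bounded_trace ipn oe te).
Qed.

Lemma bracketS (Omega : Type) (C : nat -> Omega -> H -> H) n w :
  bracket C n.+1 w = fun x => bracket C n w x + C n.+1 w x.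
Proof. by apply/funext => x; rewrite /bracket big_nat_recr. Qed.

Lemma bracket0 (Omega : Type) (C : nat -> Omega -> H -> H) w :
  bracket C 0 w = fun=> 0.
Proof. by apply/funext => x; rewrite /bracket big_geq. Qed.

Lemma finite_trace_bracket (Omega : Type) (C : nat -> Omega -> H -> H) n w :
  (forall i, (1 <= i)%N -> positive_trace_class ip (C i w)) ->
  finite_trace ip e (bracket C n w).
Proof.
move=> tC; elim: n => [|n IHn]; first by rewrite bracket0; exact: finite_trace0.
by rewrite bracketS; apply: finite_traceD => //; apply: finite_trace_class; exact: tC.
Qed.

Lemma section_mxD k T S :
  section_mx ip e k (fun x => T x + S x) = section_mx ip e k T + section_mx ip e k S.
Proof. by apply/matrixP => i j; rewrite !mxE ipDr. Qed.

Lemma section_mx0 k : section_mx ip e k (fun=> 0) = 0.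
Proof. by apply/matrixP => i j; rewrite !mxE ip0r. Qed.

Lemma section_mxZ k a T :
  section_mx ip e k (fun x => a *: T x) = a *: section_mx ip e k T.
Proof. by apply/matrixP => i j; rewrite !mxE ipZr. Qed.

Lemma section_colD k x y :
  section_col ip e k (x + y) = section_col ip e k x + section_col ip e k y.
Proof. by apply/matrixP => i j; rewrite !mxE ipDr. Qed.
End Bracket.

(** * The supermartingale at a fixed scale *)

Section SectionProcess.
Variables (R : realType) (H : completeNormedModType R).
Variable ip : {dot H for idfun}.
Hypothesis ipn : norm_induced_by ip.
Variable e : nat -> H.
Hypotheses (oe : orthoseq ip e) (te : total ip e).
Variables (d : measure_display) (Omega : measurableType d) (P : probability Omega R).
Variables (F : nat -> set (set Omega)) (M : nat -> Omega -> H).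
Hypothesis martM : martingale P F M.
Hypothesis M0 : {ae P, forall w, M 0%N w = 0}.
Hypothesis centered : forall n, (1 <= n)%N ->
  is_vcondexp P (F n.-1) (increment M n) (fun=> 0).
Hypothesis bounded : forall n, (1 <= n)%N ->
  {ae P, forall w, `|increment M n w| <= 1}.
Variable C : nat -> Omega -> H -> H.
Hypothesis condC : forall i, (1 <= i)%N ->
  is_opcondexp P ip (F i.-1)
    (fun w => rank_one ip (increment M i w) (increment M i w)) (C i).

Lemma filtration_sub_sigma n : sub_sigma (F n).
Proof. by have [fF _ _ _] := martM; have [sF mF _] := fF n. Qed.

Lemma filtration_le m n : (m <= n)%N -> F m `<=` F n.
Proof.
have [fF _ _ _] := martM.
elim: n => [|n IHn]; first by rewrite leqn0 => /eqP ->.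
rewrite leq_eqVlt => /orP[/eqP ->//|]; rewrite ltnS => /IHn mn A /mn.
by have [_ _] := fF n; exact.
Qed.

(** The shift in the bound on n is predictability: the bracket at time m + 1 is known at time m. *)
Lemma bracket_entry_measurable n m u v : (n <= m.+1)%N ->
  wrt_measurable (F m) (fun w => ip u (bracket C n w v)).
Proof.
elim: n => [|n IHn] nm.
  by under eq_fun do rewrite bracket0 ip0r; exact: measurable_cst.
under eq_fun do rewrite bracketS ipDr.
apply: measurable_funD; first exact: (IHn (ltnW nm)).
apply: wrt_measurable_borel; first exact: filtration_sub_sigma.
have [_ /(_ u v)[_ _ bC _]] := @condC n.+1 isT.
by move=> U oU; apply: (filtration_le (nm : (n <= m)%N)); exact: bC.
Qed.

Lemma section_mx_measurable k n m : (n <= m.+1)%N ->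
  mx_measurable (fun w : g_sigma_algebraType (F m) => section_mx ip e k (bracket C n w)).
Proof.
by move=> nm i j; under eq_fun do rewrite mxE; exact: bracket_entry_measurable.
Qed.

Lemma coord_measurable u n : wrt_measurable (F n) (fun w => ip u (M n w)).
Proof.
have [_ bM _ _] := martM.
apply: (borel_wrt_comp (filtration_sub_sigma n) (bM n)).
by move=> x; exact: (@ip_continuous _ _ _ ipn u x).
Qed.

Lemma section_col_measurable k n :
  mx_measurable (fun w : g_sigma_algebraType (F n) => section_col ip e k (M n w)).
Proof. by move=> i j; under eq_fun do rewrite mxE; exact: coord_measurable. Qed.

Lemma C_trace_class w i : (1 <= i)%N -> positive_trace_class ip (C i w).
Proof. by move=> i1; case: (@condC i i1). Qed.

Lemma bracket_finite_trace n w : finite_trace ip e (bracket C n w).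
Proof. by apply: finite_trace_bracket => // i i1; exact: C_trace_class. Qed.

Lemma section_bracket_psd k n w : psdmx (section_mx ip e k (bracket C n w)).
Proof. by apply: section_psd; case: (bracket_finite_trace n w). Qed.

Definition section_process k (r : R) n w :=
  bennett r (section_mx ip e k (bracket C n w)) (section_col ip e k (M n w)).

Lemma section_process_ge0 k (r : R) n w : 0 <= section_process k r n w.
Proof. exact: expR_ge0. Qed.

Lemma section_process_measurable k (r : R) n : 0 < r ->
  wrt_measurable (F n) (section_process k r n).
Proof.
move=> r0; apply: measurable_bennett => //.
- by move=> w; exact: section_bracket_psd.
- exact: section_mx_measurable.
- exact: section_col_measurable.
Qed.

Lemma section_process_measurable_fun k (r : R) n : 0 < r ->
  measurable_fun [set: Omega] (section_process k r n).
Proof.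
move=> r0; have mY := @section_process_measurable k r n r0.
exact: (wrt_measurable_fun (filtration_sub_sigma n) mY).
Qed.

Lemma section_process0 k (r : R) : 0 < r ->
  (\int[P]_w (section_process k r 0%N w)%:E <= 1)%E.
Proof.
move=> r0; rewrite (ae_eq_integral (fun=> 1%:E))//=.
- rewrite integral_cst// mul1e; exact: probability_le1.
- apply/measurable_EFinP.
  exact: section_process_measurable_fun.
- apply: filterS M0 => w M0w _; rewrite /section_process bracket0 section_mx0 M0w.
  suff -> : section_col ip e k 0 = 0 by rewrite bennett0.
  by apply/matrixP => i j; rewrite !mxE ip0r.
Qed.

Lemma increment_integrable n u : P.-integrable setT (EFin \o (fun w => ip u (increment M n.+1 w))).
Proof.
have [vX _ _ zX] := @centered n.+1 isT.
have [z [Xz _]] := zX setT (wrt_measurableT (filtration_sub_sigma n)).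
by case: (bochner_integral_inner ipn u measurableT vX Xz).
Qed.

Lemma increment_centered n u A : F n A -> \int[P]_(w in A) ip u (increment M n.+1 w) = 0.
Proof.
move=> FA; have [vX v0 _ zX] := @centered n.+1 isT.
have mA : measurable A by exact: (filtration_sub_sigma n).2.
have [z [Xz z0]] := zX A FA.
have [_ ->] := bochner_integral_inner ipn u mA vX Xz.
have [_ <-] := bochner_integral_inner ipn u mA v0 z0.
by under eq_Rintegral do rewrite ip0r; rewrite Rintegral_cst// mul0r.
Qed.

Lemma section_col_unit k x : `|x| <= 1 -> dotc (section_col ip e k x) (section_col ip e k x) <= 1.
Proof.
move=> x1; rewrite /dotc mxE.
have -> : \sum_j (section_col ip e k x)^T 0 j * section_col ip e k x j 0
    = \sum_(0 <= i < k) ip (e i) x ^+ 2.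
  by rewrite big_mkord; apply: eq_bigr => i _; rewrite !mxE expr2.
apply: le_trans (bessel ipn k x oe) _.
by rewrite ipn expr_le1.
Qed.

Lemma section_process_super k (r : R) n A : 0 < r -> F n A ->
  (\int[P]_(w in A) (section_process k r n.+1 w)%:E <=
   \int[P]_(w in A) (section_process k r n w)%:E)%E.
Proof.
move=> r0.
pose U w := section_mx ip e k (bracket C n.+1 w).
pose m w := section_col ip e k (M n w).
pose X w := increment M n.+1 w.
pose S w := section_mx ip e k (C n.+1 w).
(* Indices of the monomials of degree 0, 1 and 2. c holds the coefficients, known at time n because
   they use the next bracket with the present position; Z holds the monomials and Z' their
   conditional expectations. *)
pose I : finType := ('I_1 + ('I_k + 'I_k * 'I_k))%type.
pose c (s : I) w := match s with inl _ => bennett r (U w) (m w)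
  | inr (inl i) => bcoef1 r (U w) (m w) i
  | inr (inr ij) => bcoef2 r (U w) (m w) ij.1 ij.2 end.
pose Z (s : I) w := match s with inl _ => 1
  | inr (inl i) => ip (e i) (X w)
  | inr (inr ij) => ip (e ij.1) (rank_one ip (X w) (X w) (e ij.2)) end.
pose Z' (s : I) w := match s with inl _ => 1
  | inr (inl i) => 0
  | inr (inr ij) => ip (e ij.1) (C n.+1 w (e ij.2)) end.
have sF := filtration_sub_sigma n.
have psdU w : psdmx (U w) by exact: section_bracket_psd.
have mU : mx_measurable (U : g_sigma_algebraType (F n) -> _) by exact: section_mx_measurable.
have mm : mx_measurable (m : g_sigma_algebraType (F n) -> _) by exact: section_col_measurable.
have int1 : P.-integrable setT (EFin \o (fun=> 1 : R)).
  by apply: finite_measure_integrable_cst.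
have int0 : P.-integrable setT (EFin \o (fun=> 0 : R)).
  by apply: finite_measure_integrable_cst.
have sumE (f : I -> R) : \sum_s f s = f (inl ord0) + \sum_i f (inr (inl i)) +
    \sum_i \sum_j f (inr (inr (i, j))).
  by rewrite big_sumType/= big_ord1 big_sumType/= addrA pair_bigA; congr (_ + _); apply: eq_bigr => -[].
apply: (@condexp_lincomb_le _ _ _ P (F n) I c Z Z') => //.
- move=> [s|[i|[i j]]]; rewrite /c/=.
  + exact: measurable_bennett.
  + exact: measurable_bcoef1.
  + exact: measurable_bcoef2.
- move=> [s|[i|[i j]]]; rewrite /Z//=; first exact: increment_integrable.
  by have [_ /(_ (e i) (e j))[]] := @condC n.+1 isT.
- move=> [s|[i|[i j]]]; rewrite /Z'//=.
  by have [_ /(_ (e i) (e j))[]] := @condC n.+1 isT.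
- move=> [s|[i|[i j]]] B FB; rewrite /Z/Z'//=.
    by rewrite increment_centered// Rintegral_cst ?mul0r//; exact: sF.2.
  have [_ /(_ (e i) (e j))[_ _ _ h]] := @condC n.+1 isT.
  by rewrite /Rintegral h.
- exact: section_process_measurable_fun.
- exact: section_process_measurable_fun.
- by move=> w; exact: section_process_ge0.
- by move=> w; exact: section_process_ge0.
- apply: filterS (@bounded n.+1 isT) => w X1.
  rewrite sumE/= /section_process -/(U w).
  have -> : section_col ip e k (M n.+1 w) = m w + section_col ip e k (X w).
    by rewrite /m -section_colD; congr section_col; rewrite /X/increment/= addrC subrK.
  apply: le_trans (bennett_step (m w) (psdU w) r0 (section_col_unit k X1)) _.
  rewrite mulr1; apply: lerD.
    by apply: lerD => //; apply: ler_sum => i _; rewrite !mxE.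
  apply: ler_sum => i _; apply: ler_sum => j _.
  by rewrite !mxE /rank_one ipZr (ipC ip (e j)) (mulrC (ip (X w) (e j))).
- move=> w; rewrite sumE/= mulr1 [X in _ + X + _]big1 ?addr0; last by move=> i _; rewrite mulr0.
  have US : U w = section_mx ip e k (bracket C n w) + S w.
    by rewrite /U bracketS section_mxD.
  have pS : psdmx (S w).
    by apply: section_psd; case: (C_trace_class w (isT : (1 <= n.+1)%N)).
  apply: le_trans (bennett_average (m w) (section_bracket_psd k n w) pS r0).
  rewrite US lerD2l; apply: ler_sum => i _; apply: ler_sum => j _.
  by rewrite !mxE.
Qed.
End SectionProcess.

Lemma hfun_continuous (R : realType) (x : R) : 0 <= x -> {for x, continuous (@hfun R)}.
Proof.
move=> x0; apply: differentiable_continuous; apply/derivable1_diffP.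
by case: (is_derive_hfun x0).
Qed.

Definition score (R : realType) (H : completeNormedModType R) (ip : {dot H for idfun})
    (V : H -> H) (m : H) (a u : R) :=
  u * a * hfun (self_norm ip V a m / (u * Num.sqrt a)) - ell a V.

(** * Passage to the limit and dependence on the scale *)

Section Limits.
Variables (R : realType) (H : completeNormedModType R).
Variable ip : {dot H for idfun}.
Hypothesis ipn : norm_induced_by ip.
Variable e : nat -> H.
Hypotheses (oe : orthoseq ip e) (te : total ip e).
Variable V : H -> H.
Hypothesis tV : finite_trace ip e V.

Let pV : positive_operator ip V := tV.1.

Lemma spectral_inv_scaled lam f (a : R) : 0 < a -> spectral ip V lam f ->
  positive_operator ip (fun x => a^-1 *: V x) /\
  spectral ip (fun x => a^-1 *: V x) (fun j => a^-1 * lam j) f.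
Proof.
move=> a0 sp; have ai0 : 0 <= a^-1 by rewrite invr_ge0 ltW.
by split; [exact: positive_operatorZ|exact: spectralZ].
Qed.

Lemma bnorm_section_cvg (a : R) m : 0 < a ->
  bnorm a (section_mx ip e k V) (section_col ip e k m) @[k --> \oo] -->
  self_norm ip V a m / Num.sqrt a.
Proof.
move=> a0; have [lam [f sp]] := spectral_theorem ipn oe te tV.
have [n [nm E]] := self_norm_sqr ipn m pV sp a0.
have -> : self_norm ip V a m / Num.sqrt a = Num.sqrt (ip m n * a^-1).
  by rewrite -E sqrtrM ?sqr_ge0// sqrtr_sqr ger0_norm ?normr_ge0// sqrtrV// ltW.
have c : iqform (section_mx ip e k V + a%:M) (section_col ip e k m) * a^-1
    @[k --> \oo] --> ip m n * a^-1.
  apply: cvgM; last exact: cvg_cst.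
  exact: (@iqform_section_cvg _ _ _ ipn _ oe te V a n m pV a0 nm).
exact: (continuous_cvg _ (@sqrt_continuous R _) c).
Qed.

Lemma det_section_inv_cvg (a : R) : 0 < a ->
  \det (1%:M + a^-1 *: section_mx ip e k V) @[k --> \oo] -->
  fredholm_det (fun x => a^-1 *: V x).
Proof.
move=> a0; have [lam [f sp]] := spectral_theorem ipn oe te tV.
have [pVa spa] := spectral_inv_scaled a0 sp.
have := @det_section_cvg _ _ _ ipn _ oe te _ _ _ pVa spa.
by under eq_fun do rewrite section_mxZ.
Qed.

Lemma fredholm_det_ge1 (a : R) : 0 < a -> 1 <= fredholm_det (fun x => a^-1 *: V x).
Proof.
move=> a0; have [lam [f sp]] := spectral_theorem ipn oe te tV.
have [pVa spa] := spectral_inv_scaled a0 sp.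
have c := @fredholm_det_spectral _ _ _ _ _ _ pVa spa.
rewrite -(cvg_lim (@Rhausdorff R) c); apply: limr_ge; first exact: cvgP c.
near=> n; apply: (@le_trans _ _ (\prod_(j < n) 1)); first by rewrite big1_eq.
apply: ler_prod => j _; rewrite ler01 lerDl mulr_ge0 ?invr_ge0 ?(ltW a0)//.
exact: spectral_ge0 sp j.
Unshelve. all: by end_near.
Qed.

Lemma ell_section_cvg (a : R) : 0 < a ->
  ln (\det (1%:M + a^-1 *: section_mx ip e k V)) / 2 @[k --> \oo] --> ell a V.
Proof.
move=> a0; rewrite /ell mulrC; apply: cvgM; last exact: cvg_cst.
have f0 := lt_le_trans ltr01 (fredholm_det_ge1 a0).
exact: (continuous_cvg _ (continuous_ln f0) (det_section_inv_cvg a0)).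
Qed.

(** The parameter u becomes a sequence because the discretized mixture reaches slightly beyond
    [a, ua]. *)
Lemma score_section_cvg m (a u : R) (v : nat -> R) : 0 < a -> 0 < u ->
  v k @[k --> \oo] --> u ->
  v k * a * hfun (bnorm a (section_mx ip e k V) (section_col ip e k m) / v k)
    - ln (\det (1%:M + a^-1 *: section_mx ip e k V)) / 2 @[k --> \oo] -->
  score ip V m a u.
Proof.
move=> a0 u0 vu; apply: cvgB; last exact: ell_section_cvg.
apply: cvgM; first by apply: cvgM => //; exact: cvg_cst.
have u_neq0 : u != 0 by rewrite gt_eqF.
have c : bnorm a (section_mx ip e k V) (section_col ip e k m) / v k
    @[k --> \oo] --> self_norm ip V a m / (u * Num.sqrt a).
  rewrite invfM mulrCA mulrC.
  apply: cvgM; first exact: bnorm_section_cvg.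
  exact: cvgV.
have s0 : 0 <= self_norm ip V a m / (u * Num.sqrt a).
  by rewrite divr_ge0 ?normr_ge0// mulr_ge0 ?sqrtr_ge0 ?ltW.
exact: (continuous_cvg _ (hfun_continuous s0) c).
Qed.

(** Resolvent identity: with x and z the inverses applied to m at scales a and b, <m, x - z> = (b -
    a) <z, x>. Positivity of V + a at x - z gives <z, x> >= <z, z>. *)
Lemma self_norm_antitone (a b : R) m : 0 < a -> a <= b ->
  self_norm ip V b m <= self_norm ip V a m.
Proof.
move=> a0 ab; have b0 := lt_le_trans a0 ab.
have [lam [f sp]] := spectral_theorem ipn oe te tV.
have [x [xm Ex]] := self_norm_sqr ipn m pV sp a0.
have [z [zm Ez]] := self_norm_sqr ipn m pV sp b0.
rewrite -(@ler_pXn2r _ 2) ?nnegrE ?normr_ge0// Ex Ez -subr_ge0 -ipBr.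
have [lV _ sV psdV] := pV.
have VB u v : V (u - v) = V u - V v by exact: linB.
have Vxz : V (x - z) + a *: (x - z) = (b - a) *: z.
  have xz : V x + a *: x = V z + b *: z by rewrite xm zm.
  rewrite VB scalerBr scalerBl addrACA xz -opprD.
  by rewrite opprD addrACA subrr add0r.
have E1 : ip m (x - z) = (b - a) * ip z x.
  have W : ip z (V (x - z)) + a * (ip z x - ip z z) = (b - a) * ip z z.
    by rewrite -ipBr -ipZr -ipDr Vxz ipZr.
  rewrite -zm ipDl sV ipZl ipBr.
  have -> : ip z (V (x - z)) = (b - a) * ip z z - a * (ip z x - ip z z).
    by rewrite -W addrK.
  by ring.
have h : 0 <= (b - a) * ip z (x - z).
  have h1 := psdV (x - z); have h2 := ip_ge0 ipn (x - z).
  by rewrite -ipZl -Vxz ipDl ipZl sV addr_ge0// mulr_ge0// ltW.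
rewrite E1; have [->|ba] := eqVneq b a; first by rewrite subrr mul0r.
have ba0 : 0 < b - a by rewrite subr_gt0 lt_neqAle eq_sym ba.
move: h; rewrite pmulr_rge0// ipBr subr_ge0 => h.
by rewrite mulr_ge0 ?(ltW ba0)// (le_trans _ h)// ip_ge0.
Qed.

(** Lowering the scale raises [ell]; the loss is bounded factor by factor through 1 + lam / b <= (1
    + lam / a) exp (lam (1 / b - 1 / a)), so K is half a bound on the trace. *)
Lemma ell_perturb (a : R) : 0 < a -> exists K, forall b, 0 < b -> b <= a ->
  ell b V <= ell a V + K * (b^-1 - a^-1).
Proof.
move=> a0; have [lam [f sp]] := spectral_theorem ipn oe te tV.
have [K hK] := spectral_summable sp; exists (2^-1 * K) => b b0 ba.
have [pVa spa] := spectral_inv_scaled a0 sp.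
have [pVb spb] := spectral_inv_scaled b0 sp.
have ca := @fredholm_det_spectral _ _ _ _ _ _ pVa spa.
have cb := @fredholm_det_spectral _ _ _ _ _ _ pVb spb.
have l0 := spectral_ge0 sp.
have dab : 0 <= b^-1 - a^-1 by rewrite subr_ge0 lef_pV2 ?posrE.
have ai0 : 0 <= a^-1 by rewrite invr_ge0 ltW.
rewrite /ell -mulrA -mulrDr ler_pM2l ?invr_gt0 ?ltr0n//.
have fa0 := lt_le_trans ltr01 (fredholm_det_ge1 a0).
have fb0 := lt_le_trans ltr01 (fredholm_det_ge1 b0).
rewrite -ler_expR expRD !lnK ?posrE//.
have c : \prod_(j < n) (1 + a^-1 * lam j) * expR (K * (b^-1 - a^-1)) @[n --> \oo] -->
    fredholm_det (fun x => a^-1 *: V x) * expR (K * (b^-1 - a^-1)).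
  by apply: cvgM => //; exact: cvg_cst.
rewrite -(cvg_lim (@Rhausdorff R) cb) -(cvg_lim (@Rhausdorff R) c).
apply: ler_lim; [exact: cvgP cb|exact: cvgP c|near=> n].
apply: (@le_trans _ _ (\prod_(j < n) ((1 + a^-1 * lam j) * expR (lam j * (b^-1 - a^-1))))).
  apply: ler_prod => j _; have lj := l0 j.
  rewrite addr_ge0 ?mulr_ge0 ?invr_ge0 ?(ltW b0)//=.
  have := expR_ge1Dx (lam j * (b^-1 - a^-1)) => /(ler_wpM2l (addr_ge0 ler01 (mulr_ge0 ai0 lj))).
  apply: le_trans; rewrite -subr_ge0.
  have -> : (1 + a^-1 * lam j) * (1 + lam j * (b^-1 - a^-1)) - (1 + b^-1 * lam j)
    = a^-1 * lam j * (lam j * (b^-1 - a^-1)) by ring.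
  by rewrite !mulr_ge0.
rewrite big_split/= -expR_sum -mulr_suml ler_wpM2l//.
  by apply: prodr_ge0 => j _; rewrite addr_ge0 ?mulr_ge0.
by rewrite ler_expR ler_wpM2r//; have := hK n; rewrite big_mkord.
Unshelve. all: by end_near.
Qed.
End Limits.

(** * Discretization of the mixing measure *)

Section Mixture.
Variables (R : realType) (pi : probability (measurableTypeR R) R).

Lemma fine_probability_ge0 (A : set R) : 0 <= fine (pi A).
Proof. by rewrite fine_ge0. Qed.

(** Exponentiation removes the extended reals; on an interval of measure zero both sides are
    false. *)
Lemma Delta_ltP (a u y l x : R) :
  (y%:E + l%:E + Delta pi a u < x%:E)%E <->
  expR y < fine (pi `[a, (u * a)%R]%classic) * expR (x - l).
Proof.
rewrite /Delta; set q := pi _.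
have qf : q \is a fin_num by exact: fin_num_measure.
have q0 : (0 <= q)%E by exact: measure_ge0.
have [r Er] : exists r, q = r%:E by exists (fine q); rewrite fineK.
rewrite Er in q0 *; rewrite lee_fin in q0; rewrite [fine _]/=.
have [->|r0] := eqVneq r 0.
  rewrite mul0r le0_lneNy//.
  by split=> [//|]; rewrite ltNge expR_ge0.
have rp : 0 < r by rewrite lt_neqAle eq_sym r0.
rewrite lne_EFin// -EFinN -!EFinD lte_fin -[in r * _](lnK (x := r)) ?posrE// -expRD ltr_expR.
by split; lra.
Qed.

(** The node is the right end of its cell, so the scales are positive and mass in [a, b] never moves
    below a. *)
Definition node k j : R := j.+1%:R / k.+1%:R.
Definition cell k j : set R := `]j%:R / k.+1%:R, node k j]%classic.
Definition weight k j : R := fine (pi (cell k j)).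

Lemma node_gt0 k j : 0 < node k j.
Proof. by rewrite divr_gt0. Qed.

Lemma weight_ge0 k j : 0 <= weight k j.
Proof. exact: fine_probability_ge0. Qed.

Lemma measurable_cell k j : measurable (cell k j : set (measurableTypeR R)).
Proof. exact: measurable_itv. Qed.

Lemma weightE k j : pi (cell k j) = (weight k j)%:E.
Proof. by rewrite fineK// fin_num_measure//; exact: measurable_cell. Qed.

Lemma cell_disjoint k (i j : nat) : i != j -> cell k i `&` cell k j = set0.
Proof.
suff h i' j' : (i' < j')%N -> cell k i' `&` cell k j' = set0.
  rewrite neq_ltn => /orP[|ji]; first exact: h.
  by rewrite setIC; exact: h.
move=> ij; rewrite -subset0 => x []; rewrite /cell /= !in_itv/= => /andP[_ xi] /andP[jx _].
have := lt_le_trans jx xi; rewrite ltr_pM2r ?invr_gt0// ltr_nat.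
by rewrite ltnS leqNgt ij.
Qed.

Lemma weight_sum_le1 k n : \sum_(j < n) weight k j <= 1.
Proof.
rewrite -lee_fin -sumEFin.
under eq_bigr do rewrite -weightE.
rewrite -(@measure_bigsetU_ord_cond _ _ _ pi n xpredT (fun j : 'I_n => cell k j)).
- apply: probability_le1; apply: bigsetU_measurable => i _; exact: measurable_cell.
- by move=> i _; exact: measurable_cell.
- by apply/trivIsetP => i j _ _ ij; exact: cell_disjoint.
Qed.

(** [Num.truncn] rounds down, but cells are closed on the right: at an integer the preceding cell is
    the one needed. *)
Lemma exists_cell (t : R) : 0 < t -> exists j : nat, j%:R < t /\ t <= j.+1%:R.
Proof.
move=> t0; have /andP[nt tn] := truncn_itv (ltW t0).
have [E|nE] := eqVneq (Num.truncn t)%:R t; last first.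
  by exists (Num.truncn t); rewrite lt_neqAle nE nt (ltW tn).
move: E; case: (Num.truncn t) => [E|n E]; first by rewrite -E ltxx in t0.
by exists n; rewrite -E lexx ltr_nat ltnSn.
Qed.

(** The (k + 1)^2 cells of length 1 / (k + 1) reach up to k + 1 >= b, and a point lies at most one
    cell length below its node. *)
Lemma weight_cover (a b : R) k : 0 < a -> b <= k.+1%:R ->
  fine (pi `[a, b]%classic) <=
  \sum_(j < k.+1 ^ 2 | (a <= node k j) && (node k j <= b + k.+1%:R^-1)) weight k j.
Proof.
move=> a0 bk; set p := (fun j : nat => (a <= node k j) && (node k j <= b + k.+1%:R^-1)).
pose A j := if p j then cell k j else set0.
have mA j : measurable (A j : set (measurableTypeR R)).
  by rewrite /A; case: ifP => // _; exact: measurable_cell.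
have K0 : (0 : R) < k.+1%:R by [].
have sub : `[a, b]%classic `<=` \big[setU/set0]_(j < k.+1 ^ 2) A j.
  move=> x /=; rewrite in_itv/= => /andP[ax xb].
  have x0 := lt_le_trans a0 ax.
  have [j [jx xj]] := exists_cell (mulr_gt0 x0 K0).
  have xnode : x <= node k j by rewrite ler_pdivlMr.
  have nodex : node k j <= x + k.+1%:R^-1.
    by rewrite /node -natr1 mulrDl mul1r lerD2r ler_pdivrMr// ltW.
  have jk : (j < k.+1 ^ 2)%N.
    rewrite -(ltr_nat R); apply: lt_le_trans jx _.
    by rewrite natrX expr2 ler_pM2r// (le_trans xb).
  rewrite (bigD1 (Ordinal jk))//=; left; rewrite /A /p.
  rewrite (le_trans ax xnode) (le_trans nodex) ?lerD2r//=.
  by rewrite /cell/= in_itv/= ltr_pdivrMr// jx.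
rewrite -lee_fin fineK; last first.
  by rewrite fin_num_measure//; exact: measurable_itv.
apply: le_trans (le_measure pi _ _ sub) _; rewrite ?inE.
- exact: measurable_itv.
- by apply: bigsetU_measurable => j _; exact: mA.
apply: le_trans (Boole_inequality pi (fun j _ => mA j)) _.
rewrite -sumEFin [leRHS]big_mkcond/=.
apply: lee_sum => j _; rewrite /A -/(p j); case: ifP => _; last by rewrite measure0.
by rewrite weightE.
Qed.
End Mixture.

(** * Reduction to rational parameters *)

Section RationalApproximation.
Variable R : realType.
Implicit Types (a b c : R) (f : R -> R).

Lemma rat_approx_left f a c : 0 < a -> f x @[x --> a] --> f a -> c < f a ->
  exists p : rat, [/\ 0 < (ratr p : R), (ratr p : R) < a & c < f (ratr p)].
Proof.
move=> a0 fa cfa; have /nbhs_ballP[eps /= eps0 sub] : nbhs a [set x | c < f x] by exact: (cvgr_gt (f a) fa).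
have : Num.max 0 (a - eps) < a by rewrite gt_max a0 gtrBl.
move=> /rat_in_itvoo[p]; rewrite in_itv/= gt_max => /andP[/andP[p0 pa] ap].
exists p; split => //; apply: sub; rewrite /ball/= gtr0_norm ?subr_gt0//.
by rewrite ltrBlDr addrC -ltrBlDr.
Qed.

Lemma rat_approx_right f b c : f x @[x --> b] --> f b -> c < f b ->
  exists p : rat, b < (ratr p : R) /\ c < f (ratr p).
Proof.
move=> fb cfb; have /nbhs_ballP[eps /= eps0 sub] : nbhs b [set x | c < f x] by exact: (cvgr_gt (f b) fb).
have : b < b + eps by rewrite ltrDl.
move=> /rat_in_itvoo[p]; rewrite in_itv/= => /andP[bp pe].
exists p; split => //; apply: sub; rewrite /ball/= distrC gtr0_norm ?subr_gt0//.
by rewrite ltrBlDl.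
Qed.
End RationalApproximation.

Section Crossing.
Variables (R : realType) (H : completeNormedModType R).
Variable ip : {dot H for idfun}.
Hypothesis ipn : norm_induced_by ip.
Variable e : nat -> H.
Hypotheses (oe : orthoseq ip e) (te : total ip e).
Variables (pi : probability (measurableTypeR R) R) (y : R).

Definition crossing V m (a u : R) :=
  expR y < fine (pi `[a, (u * a)%R]%classic) * expR (score ip V m a u).

Lemma scoreE V m (a b : R) : 0 < a -> 0 < b ->
  score ip V m a (b / a) = b * hfun (self_norm ip V a m * Num.sqrt a / b) - ell a V.
Proof.
move=> a0 b0; rewrite /score divfK ?gt_eqF//; congr (b * hfun _ - _).
have s0 : Num.sqrt a != 0 by rewrite gt_eqF// sqrtr_gt0.
have -> : b / a * Num.sqrt a = b / Num.sqrt a.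
  by rewrite -[in b / a](sqr_sqrtr (ltW a0)); field.
by field; rewrite s0 gt_eqF.
Qed.

Lemma score_cvg (c : R) (r s l : R -> R) (t : R) :
  0 < s t -> 0 <= c -> 0 <= r t -> r x @[x --> t] --> r t -> s x @[x --> t] --> s t ->
  l x @[x --> t] --> l t ->
  s x * hfun (c * r x / s x) - l x @[x --> t] --> s t * hfun (c * r t / s t) - l t.
Proof.
move=> s0 c0 r0 cr cs cl; apply: cvgB => //.
apply: cvgM => //.
have h : c * r x / s x @[x --> t] --> c * r t / s t.
  apply: cvgM; first by apply: cvgM => //; exact: cvg_cst.
  by apply: cvgV => //; rewrite gt_eqF.
have h0 : 0 <= c * r t / s t by rewrite divr_ge0 ?mulr_ge0// (ltW s0).
exact: (continuous_cvg _ (hfun_continuous h0) h).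
Qed.

(** The lower end a moves down to a rational with b = ua fixed, then b moves up to a rational. The
    interval only grows, so no continuity of pi is involved. *)
Lemma crossing_rational V m (a u : R) : finite_trace ip e V ->
  0 < a -> 1 < u -> crossing V m a u ->
  exists p q : rat, [/\ 0 < (ratr p : R), (ratr p : R) < ratr q &
    crossing V m (ratr p) (ratr q / ratr p)].
Proof.
move=> tV a0 u1; rewrite /crossing; set b := u * a => cr.
have b0 : 0 < b by rewrite mulr_gt0// (lt_trans ltr01).
have ab : a < b by rewrite -[ltLHS]mul1r ltr_pM2r.
have ub : u = b / a by rewrite mulfK// gt_eqF.
have [K hK] := ell_perturb ipn oe te tV a0.
set w := fine _ in cr; have w0 : 0 <= w by exact: fine_probability_ge0.
rewrite ub scoreE// in cr.
(* A continuous minorant with the mass and the norm frozen at their values for a: the true ones only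
   grow as t decreases, and [ell_perturb] controls the remaining term. *)
pose f t := w * expR (b * hfun (self_norm ip V a m * Num.sqrt t / b) -
  (ell a V + K * (t^-1 - a^-1))).
have fa : f a = w * expR (b * hfun (self_norm ip V a m * Num.sqrt a / b) - ell a V).
  by rewrite /f subrr mulr0 addr0.
have cf : f x @[x --> a] --> f a.
  apply: cvgM; first exact: cvg_cst.
  have h : b * hfun (self_norm ip V a m * Num.sqrt x / b) - (ell a V + K * (x^-1 - a^-1))
    @[x --> a] --> b * hfun (self_norm ip V a m * Num.sqrt a / b) - (ell a V + K * (a^-1 - a^-1)).
    apply: (@score_cvg _ Num.sqrt (fun=> b) (fun x => ell a V + K * (x^-1 - a^-1)) a b0) => //.
    - exact: normr_ge0.
    - exact: (@sqrt_continuous R a).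
    - exact: cvg_cst.
    - apply: cvgD; first exact: cvg_cst.
      apply: cvgM; first exact: cvg_cst.
      apply: cvgB; last exact: cvg_cst.
      by apply: cvgV; [rewrite gt_eqF|exact: cvg_id].
  exact: (continuous_cvg _ (@continuous_expR R _) h).
rewrite -fa in cr.
have [p [p0 pa crp]] := rat_approx_left a0 cf cr.
pose g s := w * expR (s * hfun (self_norm ip V (ratr p) m * Num.sqrt (ratr p) / s) - ell (ratr p) V).
have cg : g x @[x --> b] --> g b.
  apply: cvgM; first exact: cvg_cst.
  have h : x * hfun (self_norm ip V (ratr p) m * Num.sqrt (ratr p) / x) - ell (ratr p) V
    @[x --> b] --> b * hfun (self_norm ip V (ratr p) m * Num.sqrt (ratr p) / b) - ell (ratr p) V.
    apply: (@score_cvg _ (fun=> Num.sqrt (ratr p)) id (fun=> ell (ratr p) V) b b0) => //.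
    - exact: normr_ge0.
    - exact: cvg_cst.
    - exact: cvg_cst.
  exact: (continuous_cvg _ (@continuous_expR R _) h).
have crg : expR y < g b.
  apply: lt_le_trans crp _; rewrite /f /g ler_wpM2l// ler_expR lerB ?hK ?(ltW pa)//.
  rewrite ler_pM2l//; apply: hfun_le.
    by apply: divr_ge0; [apply: mulr_ge0; [exact: normr_ge0|exact: sqrtr_ge0]|exact: ltW].
  rewrite ler_pM2r ?invr_gt0// ler_pM2r ?sqrtr_gt0//.
  exact: (self_norm_antitone ipn oe te tV m p0 (ltW pa)).
have [q [bq crq]] := rat_approx_right cg crg.
have q0 := lt_trans b0 bq.
exists p, q; split => //; first exact: (lt_trans pa (lt_trans ab bq)).
rewrite scoreE//; apply: lt_le_trans crq _.
rewrite ler_pM2r ?expR_gt0// divfK ?gt_eqF//.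
apply: fine_le; [exact: fin_num_measure|exact: fin_num_measure|].
apply: le_measure; rewrite ?inE; [exact: measurable_itv|exact: measurable_itv|].
move=> x /=; rewrite !in_itv/= => /andP[ax xb].
by rewrite (le_trans (ltW pa))// (le_trans xb)// ltW.
Qed.
End Crossing.

(** * The mixture and the crossing event *)

Section TimeUniform.
Variables (R : realType) (H : completeNormedModType R).
Variable ip : {dot H for idfun}.
Hypothesis ipn : norm_induced_by ip.
Variable e : nat -> H.
Hypotheses (oe : orthoseq ip e) (te : total ip e).
Variables (d : measure_display) (Omega : measurableType d) (P : probability Omega R).
Variables (F : nat -> set (set Omega)) (M : nat -> Omega -> H).
Hypothesis martM : martingale P F M.
Hypothesis M0 : {ae P, forall w, M 0%N w = 0}.
Hypothesis centered : forall n, (1 <= n)%N ->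
  is_vcondexp P (F n.-1) (increment M n) (fun=> 0).
Hypothesis bounded : forall n, (1 <= n)%N ->
  {ae P, forall w, `|increment M n w| <= 1}.
Variable C : nat -> Omega -> H -> H.
Hypothesis condC : forall i, (1 <= i)%N ->
  is_opcondexp P ip (F i.-1)
    (fun w => rank_one ip (increment M i w) (increment M i w)) (C i).
Variables (pi : probability (measurableTypeR R) R) (y : R).

Let tV n w : finite_trace ip e (bracket C n w) := bracket_finite_trace ipn oe te condC n w.

(** A pointwise limit of matrix expressions: the norm and the determinant are defined through [get],
    so their measurability is reached through finite sections. *)
Lemma score_measurable n (a u : R) : 0 < a -> 0 < u ->
  measurable_fun [set: Omega] (fun w => score ip (bracket C n w) (M n w) a u).
Proof.
move=> a0 u0; pose V k w := section_mx ip e k (bracket C n w).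
pose m k w := section_col ip e k (M n w).
have sF := filtration_sub_sigma martM n.
have mV k : mx_measurable (V k).
  move=> i j; apply: (wrt_measurable_fun sF).
  exact: (@section_mx_measurable _ _ _ e _ _ _ _ _ martM _ condC k n n (leqnSn n) i j).
have mm k : mx_measurable (m k).
  move=> i j; apply: (wrt_measurable_fun sF).
  exact: (@section_col_measurable _ _ _ ipn e _ _ _ _ _ martM k n i j).
have pV k w : psdmx (V k w) by apply: section_psd; case: (tV n w).
apply: (measurable_fun_cvg (h := fun k w => u * a * hfun (bnorm a (V k w) (m k w) / u)
    - ln (\det (1%:M + a^-1 *: V k w)) / 2)); last first.
  move=> w _.
  exact: (@score_section_cvg _ _ _ ipn _ oe te _ (tV n w) (M n w) a u (fun=> u) a0 u0 (cvg_cst u)).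
move=> k; have mb : measurable_fun [set: Omega] (fun w => bnorm a (V k w) (m k w) / u).
  apply: measurable_funM; last exact: measurable_cst.
  exact: measurable_bnorm.
apply: measurable_funB.
  apply: measurable_funM; first exact: measurable_cst.
  apply: measurable_funB => //; apply: measurable_funM.
    by apply: measurable_funD => //; exact: measurable_cst.
  apply: (measurableT_comp (@measurable_ln R)).
  by apply: measurable_funD => //; exact: measurable_cst.
apply: measurable_funM; last exact: measurable_cst.
apply: (measurableT_comp (@measurable_ln R)).
exact: measurable_det_normalized.
Qed.

Lemma crossing_measurable n (a u : R) : 0 < a -> 0 < u ->
  measurable [set w | crossing ip pi y (bracket C n w) (M n w) a u].
Proof.
move=> a0 u0; pose f w := fine (pi `[a, (u * a)%R]%classic) *
  expR (score ip (bracket C n w) (M n w) a u).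
have mf : measurable_fun [set: Omega] f.
  apply: measurable_funM; first exact: measurable_cst.
  exact: (measurableT_comp (@measurable_expR R) (score_measurable n a0 u0)).
rewrite (_ : [set w | _] = f @^-1` `]expR y, +oo[%classic).
  by rewrite -[X in measurable X]setTI; exact: mf.
by apply/seteqP; split=> w /=; rewrite in_itv/= andbT.
Qed.

Definition ever_crossing := [set w | exists n : nat, (1 <= n)%N /\
  exists a : R, 0 < a /\ exists u : R, 1 < u /\
  crossing ip pi y (bracket C n w) (M n w) a u].

Lemma ever_crossing_measurable : measurable ever_crossing.
Proof.
pose G (n : nat) (p q : rat) : set Omega :=
  if (1 <= n)%N && (0 < (ratr p : R)) && ((ratr p : R) < ratr q) then
    [set w | crossing ip pi y (bracket C n w) (M n w) (ratr p) (ratr q / ratr p)]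
  else set0.
rewrite (_ : ever_crossing = \bigcup_n \bigcup_p \bigcup_q G n p q).
  apply: bigcupT_measurable => n; apply: bigcupT_measurable_rat => p.
  apply: bigcupT_measurable_rat => q; rewrite /G; case: ifP => [/andP[/andP[n1 p0] pq]|_] //.
  by apply: crossing_measurable => //; rewrite divr_gt0// (lt_trans p0).
apply/seteqP; split=> w.
  move=> [n [n1 [a [a0 [u [u1 cr]]]]]].
  have [p [q [p0 pq crpq]]] := crossing_rational ipn oe te (tV n w) a0 u1 cr.
  by exists n => //; exists p => //; exists q => //; rewrite /G n1 p0 pq.
move=> [n _ [p _ [q _]]]; rewrite /G; case: ifP => [/andP[/andP[n1 p0] pq]|_]//= cr.
exists n; split => //; exists (ratr p); split => //; exists (ratr q / ratr p).
by rewrite ltr_pdivlMr// mul1r.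
Qed.

Definition mixture k n w :=
  \sum_(j < k.+1 ^ 2) weight pi k j * section_process ip e M C k (node R k j) n w.

Lemma mixture_ge0 k n w : 0 <= mixture k n w.
Proof.
by apply: sumr_ge0 => j _; rewrite mulr_ge0 ?weight_ge0// section_process_ge0.
Qed.

Lemma integral_mixture k n (A : set Omega) : measurable A ->
  (\int[P]_(w in A) (mixture k n w)%:E = \sum_(j < k.+1 ^ 2) (weight pi k j)%:E *
    \int[P]_(w in A) (section_process ip e M C k (node R k j) n w)%:E)%E.
Proof.
move=> mA; have mY j : measurable_fun A
    (fun w => (section_process ip e M C k (node R k j) n w)%:E).
  apply/measurable_EFinP; apply: measurable_funTS.
  exact: (section_process_measurable_fun ipn oe te martM condC _ _ (node_gt0 _ _ _)).
under eq_integral do rewrite /mixture -sumEFin.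
rewrite ge0_integral_sum//.
- apply: eq_bigr => j _; under eq_integral do rewrite EFinM.
  rewrite ge0_integralZl_EFin ?weight_ge0// => w _.
  by rewrite lee_fin section_process_ge0.
- by move=> j; under eq_fun do rewrite EFinM; exact: measurable_funeM.
- by move=> j w _; rewrite lee_fin mulr_ge0 ?weight_ge0// section_process_ge0.
Qed.

Lemma mixture_ville k :
  measurable [set w | exists n, expR y < mixture k n w] /\
  (P [set w | exists n, (expR y < mixture k n w)%R] <= (expR (- y))%:E)%E.
Proof.
rewrite expRN; have [fF _ _ _] := martM.
apply: (@ville _ _ _ P F (mixture k) (expR y) fF).
- move=> n; apply: measurable_sum => j; apply: measurable_funM; first exact: measurable_cst.
  exact: (@section_process_measurable _ _ _ ipn _ oe te _ _ P F M martM C condC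
    k (node R k j) n (node_gt0 R k j)).
- by move=> n w; exact: mixture_ge0.
- rewrite integral_mixture//.
  apply: (@le_trans _ _ (\sum_(j < k.+1 ^ 2) (weight pi k j)%:E)%E).
    apply: lee_sum => j _; rewrite -[leRHS]mule1 lee_wpmul2l ?lee_fin ?weight_ge0//.
    exact: (section_process0 ipn oe te martM M0 condC k (node_gt0 _ _ _)).
  by rewrite sumEFin lee_fin weight_sum_le1.
- move=> n A FA; have mA : measurable A by exact: (filtration_sub_sigma martM n).2.
  have eq_le x x' z z' : x = x' -> z = z' -> (x' <= z' -> x <= z :> \bar R)%E by move=> -> ->.
  apply: (eq_le _ _ _ _ (integral_mixture k n.+1 mA) (integral_mixture k n mA)).
  apply: lee_sum => j _.
  apply: lee_wpmul2l; first by rewrite lee_fin weight_ge0.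
  exact: (section_process_super ipn oe te martM centered bounded condC k (node_gt0 _ _ _) FA).
- exact: expR_gt0.
Qed.

(* Only the nodes of [a, ua + 1/(k+1)] are kept: bennett_ge bounds every one of
   their processes below by the same quantity. *)
Lemma mixture_ge k n w (a u : R) : 0 < a -> 0 < u -> u * a <= k.+1%:R ->
  let v := u + k.+1%:R^-1 / a in
  fine (pi `[a, (u * a)%R]%classic) *
  expR (v * a * hfun (bnorm a (section_mx ip e k (bracket C n w)) (section_col ip e k (M n w)) / v)
    - ln (\det (1%:M + a^-1 *: section_mx ip e k (bracket C n w))) / 2) <= mixture k n w.
Proof.
move=> a0 u0 uk /=; set v := u + _; set V := section_mx _ _ _ _; set m := section_col _ _ _ _.
have va : v * a = u * a + k.+1%:R^-1 by rewrite mulrDl divfK ?gt_eqF.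
have pV : psdmx V by apply: section_psd; case: (tV n w).
apply: le_trans (ler_wpM2r (expR_ge0 _) (weight_cover pi a0 uk)) _.
rewrite mulr_suml [leRHS](bigID (fun j : 'I_(k.+1 ^ 2) =>
  (a <= node R k j) && (node R k j <= u * a + k.+1%:R^-1)))/= -[leLHS]addr0.
apply: lerD; last first.
  by apply: sumr_ge0 => j _; rewrite mulr_ge0 ?weight_ge0// section_process_ge0.
apply: ler_sum => j /andP[aj ju]; apply: ler_wpM2l; first exact: weight_ge0.
rewrite -va in ju; exact: (bennett_ge m pV a0 aj ju).
Qed.

(** The lower bounds of [mixture_ge] converge to the crossing quantity, and a strict inequality
    survives for all large k. *)
Lemma crossing_mixture w : ever_crossing w ->
  exists N, forall k, (N <= k)%N -> exists n, expR y < mixture k n w.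
Proof.
move=> [n [n1 [a [a0 [u [u1]]]]]]; rewrite /crossing; set q := fine _ => cr.
have u0 := lt_trans ltr01 u1.
pose v k : R := u + k.+1%:R^-1 / a.
have vu : v k @[k --> \oo] --> u.
  rewrite -[X in _ --> X]addr0 -(mul0r a^-1); apply: cvgD; first exact: cvg_cst.
  by apply: cvgM; [exact: cvg_harmonic|exact: cvg_cst].
have sc := @score_section_cvg _ _ _ ipn _ oe te _ (tV n w) (M n w) a u v a0 u0 vu.
pose b k := v k * a * hfun (bnorm a (section_mx ip e k (bracket C n w))
    (section_col ip e k (M n w)) / v k)
  - ln (\det (1%:M + a^-1 *: section_mx ip e k (bracket C n w))) / 2.
have c : q * expR (b k) @[k --> \oo] --> q * expR (score ip (bracket C n w) (M n w) a u).
  apply: cvgM; first exact: cvg_cst.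
  exact: (continuous_cvg _ (@continuous_expR R _) sc).
have [N1 _ hN1] : \forall k \near \oo, expR y < q * expR (b k).
  exact: (cvgr_gt _ c).
have [N2 hN2] : exists N, u * a <= N%:R.
  by exists (Num.truncn (u * a)).+1; exact/ltW/truncnS_gt.
exists (maxn N1 N2) => k; rewrite geq_max => /andP[k1 k2]; exists n.
apply: lt_le_trans (hN1 k k1) (mixture_ge n w a0 u0 _).
by rewrite (le_trans hN2)// ler_nat (leq_trans k2).
Qed.

(** A crossing lies in all but finitely many of the events E k. Their lower limit is the increasing
    union of the [B N], each contained in E N, so continuity from below keeps the bound. *)
Lemma ever_crossing_le : (P ever_crossing <= (expR (- y))%:E)%E.
Proof.
pose E k := [set w | exists n, expR y < mixture k n w].
have mE k : measurable (E k) by case: (mixture_ville k).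
pose B N := \bigcap_(k in [set k | (N <= k)%N]) E k.
have mB N : measurable (B N) by apply: bigcap_measurable => // ; exists N => /=.
have mU : measurable (\bigcup_N B N) by exact: bigcupT_measurable.
have ndB : {homo B : n m / (n <= m)%N >-> (n <= m)%O}.
  by move=> n m nm; apply/subsetPset => w Bw k /= mk; apply: Bw; exact: leq_trans mk.
have sub : ever_crossing `<=` \bigcup_N B N.
  by move=> w /crossing_mixture[N hN]; exists N => // k /= Nk; exact: hN.
have mX := ever_crossing_measurable.
apply: le_trans (le_measure P (mem_set mX) (mem_set mU) sub) _.
have c := @nondecreasing_cvg_mu _ _ _ P _ mB mU ndB.
have h : (lim ((P \o B) n @[n --> \oo]) <= (expR (- y))%:E)%E; last first.
  by have := h; rewrite (cvg_lim (@ereal_hausdorff R) c).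
apply: lime_le; first exact: cvgP c.
near=> N; apply: (@le_trans _ _ (P (E N))); last by case: (mixture_ville N).
apply: (le_measure P (mem_set (mB N)) (mem_set (mE N))) => w; apply => /=; exact: leqnn.
Unshelve. all: by end_near.
Qed.
End TimeUniform.

Unset Implicit Arguments.

Theorem mainTheorem5
  (R : realType)
  (H : completeNormedModType R) (ip : {dot H for idfun})
  (H_hilbert : norm_induced_by ip) (H_separable : separable H)
  (d : measure_display) (Omega : measurableType d) (P : probability Omega R)
  (F : nat -> set (set Omega)) (M : nat -> Omega -> H)
  (M_martingale : martingale P F M)
  (M_0 : {ae P, forall w, M 0%N w = 0})
  (X_centered : forall n, (1 <= n)%N ->
     is_vcondexp P (F n.-1) (increment M n) (fun=> 0))
  (X_bounded : forall n, (1 <= n)%N ->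
     {ae P, forall w, `|increment M n w| <= 1})
  (C : nat -> Omega -> H -> H)
  (C_condexp : forall i, (1 <= i)%N ->
     is_opcondexp P ip (F i.-1)
       (fun w => rank_one ip (increment M i w) (increment M i w)) (C i))
  (pi : probability (measurableTypeR R) R)
  (pi_pos : pi `]0, +oo[%classic = 1%E)
  (y : R) (y_ge0 : 0 <= y) :
  let V := bracket C in
  let E := [set w | exists n : nat, (1 <= n)%N /\
    exists a : R, 0 < a /\
    exists u : R, 1 < u /\
      ((u * a * hfun (self_norm ip (V n w) a (M n w) / (u * Num.sqrt a)))%:E
        > y%:E + (ell a (V n w))%:E + Delta pi a u)%E] in
  measurable E /\ (P E <= (expR (- y))%:E)%E.
Proof.
have [e [oe te]] := separable_total_orthoseq H_hilbert H_separable.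
move=> V E; have -> : E = @ever_crossing R H ip d Omega M C pi y.
  by apply/seteqP; split => w [n [n1 [a [a0 [u [u1 cr]]]]]]; exists n; split => //;
    exists a; split => //; exists u; split => //; exact/Delta_ltP.
split; first exact: (ever_crossing_measurable H_hilbert oe te M_martingale C_condexp).
exact: (ever_crossing_le H_hilbert oe te M_martingale M_0 X_centered X_bounded C_condexp).
Qed.
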